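(* Let $0<\alpha<1$ and consider the problem described in the context with the thermal conductivity $k$ unknown (Case 3), the data $\rho,c,\ell>0$, $T_m$, $T_0>T_m$, $q_0>0$ being given. For any such data, the equation $$\frac{x\left[1-W\left(-x;-\frac{\alpha}{2},1\right)\right]}{M_{\alpha/2}(x)}=\frac{c(T_0-T_m)\,\Gamma\left(1-\frac{\alpha}{2}\right)}{\ell\,\Gamma\left(1+\frac{\alpha}{2}\right)},\quad x>0,$$ has a unique solution $\xi_\alpha>0$, and the solution of Case 3 is given by $$k=k_\alpha=\frac{q_0^2\,\Gamma^2\left(1-\frac{\alpha}{2}\right)}{\rho c(T_0-T_m)^2}\left[1-W\left(-\xi_\alpha;-\frac{\alpha}{2},1\right)\right]^2,$$ $$T_\alpha(x,t)=T_0-\frac{T_0-T_m}{1-W\left(-\xi_\alpha;-\frac{\alpha}{2},1\right)}\left[1-W\left(-\frac{x}{\lambda_\alpha t^{\alpha/2}};-\frac{\alpha}{2},1\right)\right],\qquad s_\alpha(t)=\lambda_\alpha\xi_\alpha t^{\alpha/2},$$ where $$\lambda_\alpha=\frac{q_0\,\Gamma\left(1-\frac{\alpha}{2}\right)}{\rho c(T_0-T_m)}\left[1-W\left(-\xi_\alpha;-\frac{\alpha}{2},1\right)\right].$$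
   Context: For $0<\alpha<1$ the Caputo fractional derivative of a function $f$ of $t$ is $D^\alpha f(t)=\frac{1}{\Gamma(1-\alpha)}\int_0^t \frac{f'(\tau)}{(t-\tau)^\alpha}\,d\tau$, where $\Gamma$ is Euler's Gamma function. The Wright function is $W(z;a,b)=\sum_{n=0}^{\infty}\frac{z^n}{n!\,\Gamma(na+b)}$ for $z\in\mathbb{C}$, $a>-1$, $b\in\mathbb{R}$; the Mainardi function is $M_\nu(z)=W(-z;-\nu,1-\nu)$ for $\nu<1$. The problem: $\rho,k,c,\ell$ are positive constants (density, conductivity, specific heat, latent heat), $\lambda^2=k/(\rho c)$, $T_m$ is the melting temperature, $T_0>T_m$ and $q_0>0$ are constants. Find $x=s(t)$, $T=T(x,t)$ and the unknown coefficient such that: $D^\alpha T=\lambda^2 T_{xx}$ for $0<x<s(t)$, $t>0$ (Caputo derivative in $t$); $s(0)=0$; $T(x,0)=T(+\infty,t)=T_m$ for $x>0,t>0$; $T(s(t),t)=T_m$; $-kT_x(s(t),t)=\rho\ell\, D^\alpha s(t)$; $T(0,t)=T_0$; $kT_x(0,t)=-q_0/t^{\alpha/2}$, for all $t>0$.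
   Formalization: The conditions T(x,0)=T(+∞,t)=T_m are dropped: they lie outside 0<x<s(t) and the stated T_α violates them for all data, since T_α(+∞,t)=T_0-(T_0-T_m)/(1-W(-ξ_α;-α/2,1))<T_m. *)

(* Defs.v *)
From Stdlib Require Import Reals Factorial.
From Coquelicot Require Import Coquelicot.
Open Scope R_scope.

(* t^a for t >= 0 and a > 0 (with 0^a = 0; note Stdlib's Rpower 0 a = 1). *)
Definition powr (t a : R) : R := if Rlt_dec 0 t then Rpower t a else 0.

Definition Gamma (x : R) : R :=
  RInt_gen (fun t => Rpower t (x - 1) * exp (- t)) (at_right 0) (Rbar_locally p_infty).

Fixpoint pochhammer (x : R) (n : nat) : R :=
  match n with
  | O => 1
  | S m => pochhammer x m * (x + INR m)
  end.

(* Reciprocal Gamma function 1/Gamma(x) on all of R (entire; 0 at the poles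
   0,-1,-2,...), via 1/Gamma(x) = (x)_N / Gamma(x+N) for any N with x+N > 0. *)
Definition rgamma (x : R) : R :=
  let N := Z.to_nat (up (- x)) in pochhammer x N / Gamma (x + INR N).

Definition Wright (z a b : R) : R :=
  Series (fun n => z ^ n / INR (fact n) * rgamma (INR n * a + b)).

Definition Mainardi (nu z : R) : R := Wright (- z) (- nu) (1 - nu).

Definition caputo (alpha : R) (f : R -> R) (t v : R) : Prop :=
  (forall tau, 0 < tau < t -> ex_derive f tau) /\
  exists I, is_RInt_gen (fun tau => Derive f tau * Rpower (t - tau) (- alpha))
                        (at_right 0) (at_left t) I
            /\ v = I / Gamma (1 - alpha).

Definition is_derive2 (f : R -> R) (x d : R) : Prop :=
  locally x (fun y => ex_derive f y) /\ is_derive (Derive f) x d.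

Definition is_right_derive (f : R -> R) (x d : R) : Prop :=
  filterlim (fun y => (f y - f x) / (y - x)) (at_right x) (locally d).
Definition is_left_derive (f : R -> R) (x d : R) : Prop :=
  filterlim (fun y => (f y - f x) / (y - x)) (at_left x) (locally d).

Definition stefan_solution (alpha rho c l Tm T0 q0 : R)
    (k : R) (T : R -> R -> R) (s : R -> R) : Prop :=
  (forall x t, 0 < t -> 0 < x < s t ->
     exists v d2, caputo alpha (fun tau => T x tau) t v
                  /\ is_derive2 (fun y => T y t) x d2
                  /\ v = k / (rho * c) * d2) /\
  s 0 = 0 /\
  (forall t, 0 < t -> T (s t) t = Tm) /\
  (forall t, 0 < t -> exists dTx v,
     is_left_derive (fun y => T y t) (s t) dTx /\ caputo alpha s t v /\
     - k * dTx = rho * l * v) /\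
  (forall t, 0 < t -> T 0 t = T0) /\
  (forall t, 0 < t -> exists dTx,
     is_right_derive (fun y => T y t) 0 dTx /\
     k * dTx = - q0 / powr t (alpha / 2)).

(* Main.v *)
Require Import Defs.
From Stdlib Require Import Reals ZArith Lra Lia Factorial.
From Coquelicot Require Import Coquelicot.
Open Scope R_scope.

(** Put [nu = alpha/2 < 1/2] and [W b z = W(-z; -nu, b)]; the similarity solution is built from
    [G b y t = t^(b-1) W b (y t^(-nu))], for which [dG_{b+1}/dt = G_b] and [dG_b/dy = -G_{b-nu}].
    The heart of the matter is that fractional integration in [t] of order [be] maps [G_0] to [G_be]:
    with [be = 1 - alpha] this is the fractional heat equation.

    Taylor expansion in [y] identifies both sides, but it cannot be carried out under the integral, whose
    convergence at [t = 0] rests on the decay of the Wright series at infinity. That decay comes from the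
    Hankel integral collapsed onto the negative axis (hence the need for the reflection formula), where
    [nu < 1/2] makes [cos (pi nu) > 0], together with a rotation of the ray of integration. The Taylor
    coefficients at [y = 0] are then obtained by the recurrence [t G_b = b G_{b+1} + nu y G_{b+1-nu}],
    which raises [b] into the range where the Beta integral converges.

    With [be = 1 - nu] the same identity says that minus the derivative of [W 1] is, up to a factor, its Caputo
    derivative of order [nu] along [z = y t^(-nu)]; the extremum principle for the Caputo derivative then
    forces [W 1] to be strictly decreasing, i.e. the Mainardi function to be positive, and
    [be = 1 - 2 nu] shows that the Mainardi function decreases. Hence the left side of the equation for
    [xi] is strictly increasing from 0 to infinity. *)

(** The constants of the solution come from the ansatz [T = T0 - B + B W 1 (x / (lam t^nu))],
    [s = lam xi t^nu]. The heat equation requires [k = rho c lam^2], the temperature at the front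
    gives [B = (T0 - Tm) / (1 - W 1 xi)], the flux at [x = 0] gives
    [rho c lam B = q0 Gamma (1 - nu)], and the Stefan condition is what remains: the equation for
    [xi].

    The analysis stays on the real line. Convergence of an integral is shown by a majorant with an
    explicit primitive. Differentiation under the integral uses an integrable bound on the second
    parameter derivative instead of dominated convergence. Contour rotation becomes differentiation
    in the angle.

    The Wright series contains [1/Gamma] at [b - nu n], eventually at negative arguments, while the
    integral on the negative axis produces [Gamma (1 - b + nu n) sin (PI (b - nu n))]; reflection
    matches the two. All Taylor arguments end in a race between [n!] and a factorial of a smaller
    multiple of [n]. *)

(** * Improper integrals on (0, B) *)

(* [dom B] is the interval (0, B) and [left_filter B] the approach to its right end; only 0 < B matters. *)
Definition left_filter (B : Rbar) : (R -> Prop) -> Prop :=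
  match B with Finite b => at_left b | _ => Rbar_locally p_infty end.

Definition dom (B : Rbar) (x : R) : Prop := 0 < x /\ Rbar_lt x B.

Definition is_int (B : Rbar) (f : R -> R) (l : R) : Prop :=
  is_RInt_gen f (at_right 0) (left_filter B) l.

Lemma ball_Rabs (x e y : R) : ball x e y -> Rabs (y - x) < e.
Proof. intros H. exact H. Qed.

#[export] Instance left_filter_proper B : ProperFilter (left_filter B).
Proof.
destruct B as [b| |]; simpl; unfold at_left; apply _.
Qed.

Lemma left_filter_above B (x : R) : Rbar_lt x B -> left_filter B (fun y => x < y /\ Rbar_lt y B).
Proof.
destruct B as [b| |]; simpl; intros H.
- assert (Hp : 0 < b - x) by (simpl in H; lra).
  exists (mkposreal _ Hp). intros y Hy Hyb.
  apply ball_Rabs in Hy; simpl in Hy.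
  apply Rabs_lt_between in Hy. simpl in *. split; lra.
- exists x. intros; split; auto.
- easy.
Qed.

Lemma at_right_below x : 0 < x -> at_right 0 (fun y => 0 < y < x).
Proof.
intros H. exists (mkposreal x H). intros y Hy Hy0.
apply ball_Rabs in Hy; simpl in Hy.
apply Rabs_lt_between in Hy. split; lra.
Qed.

Lemma dom_mid B (x y z : R) : dom B x -> dom B y -> x <= z <= y -> dom B z.
Proof.
intros [H1 H2] [H3 H4] H. split. lra.
destruct B; simpl in *; auto; lra.
Qed.

Lemma dom_le B (x y : R) : dom B x -> 0 < y <= x -> dom B y.
Proof.
intros [H1 H2] H. split. lra. destruct B; simpl in *; auto; lra.
Qed.

Lemma dom_ex B : Rbar_lt 0 B -> exists x, dom B x.
Proof.
destruct B as [b| |]; simpl; intros H.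
- exists (b/2). split; simpl; lra.
- exists 1. split; simpl; auto; lra.
- easy.
Qed.

Lemma dom_pair B : Rbar_lt 0 B ->
  filter_prod (at_right 0) (left_filter B)
    (fun ab => dom B (fst ab) /\ dom B (snd ab) /\ fst ab <= snd ab).
Proof.
intros HB. destruct (dom_ex B HB) as [x0 [H1 H2]].
apply (Filter_prod _ _ _ (fun a => 0 < a < x0) (fun b => x0 < b /\ Rbar_lt b B)).
- now apply at_right_below.
- now apply left_filter_above.
- intros a b Ha [Hb Hb']. simpl. repeat split; try lra; auto.
  destruct B; simpl in *; auto; lra.
Qed.

Lemma is_int_ext B f g l : Rbar_lt 0 B -> (forall x, dom B x -> f x = g x) ->
  is_int B f l -> is_int B g l.
Proof.
intros HB H. apply (@is_RInt_gen_ext R_NormedModule (at_right 0) (left_filter B) _ _ f g l).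
generalize (dom_pair B HB). apply filter_imp.
intros [a b]; simpl; intros [Ha [Hb Hab]] x.
rewrite Rmin_left, Rmax_right by lra. intros Hx. apply H.
apply (dom_mid B a b); auto; lra.
Qed.

Lemma is_int_plus B f g lf lg : is_int B f lf -> is_int B g lg ->
  is_int B (fun x => f x + g x) (lf + lg).
Proof. apply (@is_RInt_gen_plus R_NormedModule _ _ _ _ f g lf lg). Qed.

Lemma is_int_minus B f g lf lg : is_int B f lf -> is_int B g lg ->
  is_int B (fun x => f x - g x) (lf - lg).
Proof. apply (@is_RInt_gen_minus R_NormedModule _ _ _ _ f g lf lg). Qed.

Lemma is_int_scal B f k l : is_int B f l -> is_int B (fun x => k * f x) (k * l).
Proof. apply (@is_RInt_gen_scal R_NormedModule _ _ _ _ f k l). Qed.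

Lemma is_int_unique B f l1 l2 : is_int B f l1 -> is_int B f l2 -> l1 = l2.
Proof.
intros H1 H2. rewrite <- (is_RInt_gen_unique f l1 H1).
apply (is_RInt_gen_unique f l2 H2).
Qed.

Lemma flim_plus {T} (F : (T -> Prop) -> Prop) {FF : Filter F} (f g : T -> R) (a b : R) :
  filterlim f F (locally a) -> filterlim g F (locally b) ->
  filterlim (fun x => f x + g x) F (locally (a + b)).
Proof.
intros H1 H2. eapply filterlim_comp_2. exact H1. exact H2.
apply (@filterlim_plus R_AbsRing R_NormedModule a b).
Qed.

Lemma flim_mult {T} (F : (T -> Prop) -> Prop) {FF : Filter F} (f g : T -> R) (a b : R) :
  filterlim f F (locally a) -> filterlim g F (locally b) ->
  filterlim (fun x => f x * g x) F (locally (a * b)).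
Proof.
intros H1 H2. eapply filterlim_comp_2. exact H1. exact H2.
apply (@filterlim_mult R_AbsRing a b).
Qed.

Lemma flim_const {T} (F : (T -> Prop) -> Prop) {FF : Filter F} (a : R) :
  filterlim (fun _ : T => a) F (locally a).
Proof. apply filterlim_const. Qed.

Lemma flim_scal {T} (F : (T -> Prop) -> Prop) {FF : Filter F} (k : R) (f : T -> R) (a : R) :
  filterlim f F (locally a) -> filterlim (fun x => k * f x) F (locally (k * a)).
Proof. intros H. apply flim_mult; auto. now apply flim_const. Qed.

Lemma flim_minus {T} (F : (T -> Prop) -> Prop) {FF : Filter F} (f g : T -> R) (a b : R) :
  filterlim f F (locally a) -> filterlim g F (locally b) ->
  filterlim (fun x => f x - g x) F (locally (a - b)).
Proof.
intros H1 H2. replace (a - b) with (a + -1 * b) by ring.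
apply filterlim_ext with (fun x => f x + -1 * g x). intros; ring.
apply flim_plus; auto. apply flim_scal; auto.
Qed.

Lemma is_int_antideriv B (F f : R -> R) (lA lB : R) : Rbar_lt 0 B ->
  (forall x, dom B x -> is_derive F x (f x)) ->
  (forall x, dom B x -> continuous f x) ->
  filterlim F (at_right 0) (locally lA) ->
  filterlim F (left_filter B) (locally lB) ->
  is_int B f (lB - lA).
Proof.
intros HB HF Hf HA HlB P HP.
unfold filtermapi.
assert (Hl : filterlim (fun ab : R * R => F (snd ab) - F (fst ab))
          (filter_prod (at_right 0) (left_filter B)) (locally (lB - lA))).
{ apply flim_minus; [apply _| |].
  - eapply filterlim_comp. apply filterlim_snd. exact HlB.
  - eapply filterlim_comp. apply filterlim_fst. exact HA. }
assert (HlP : filter_prod (at_right 0) (left_filter B) (fun ab : R * R => P (F (snd ab) - F (fst ab)))).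
{ exact (Hl P HP). }
generalize (filter_and _ _ (dom_pair B HB) HlP).
apply filter_imp. intros [a b]; simpl. intros [[Ha [Hb Hab]] HPab].
exists (F b - F a). split; auto.
apply (is_RInt_derive F f).
- intros x. rewrite Rmin_left, Rmax_right by lra. intros Hx.
  apply HF, (dom_mid B a b); auto.
- intros x. rewrite Rmin_left, Rmax_right by lra. intros Hx.
  apply Hf, (dom_mid B a b); auto.
Qed.

Lemma is_int_nonneg B f l : Rbar_lt 0 B -> (forall x, dom B x -> 0 <= f x) ->
  is_int B f l -> 0 <= l.
Proof.
intros HB Hf Hl. destruct (Rle_or_lt 0 l) as [H|H]; auto. exfalso.
assert (HP : locally l (fun y => y < 0)).
{ assert (Hp : 0 < - l) by lra. exists (mkposreal _ Hp). intros y Hy.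
  apply ball_Rabs in Hy; simpl in Hy.
  apply Rabs_lt_between in Hy. lra. }
generalize (filter_and _ _ (dom_pair B HB) (Hl _ HP)). intros H1.
apply filter_ex in H1. destruct H1 as [[a b] [[Ha [Hb Hab]] [y [Hy Hy0]]]]. simpl in *.
assert (0 <= y); [|lra].
apply (is_RInt_ge_0 f a b y); auto.
intros x Hx. apply Hf, (dom_mid B a b); auto; lra.
Qed.

Lemma is_int_le B f g lf lg : Rbar_lt 0 B -> (forall x, dom B x -> f x <= g x) ->
  is_int B f lf -> is_int B g lg -> lf <= lg.
Proof.
intros HB H Hf Hg. assert (0 <= lg - lf); [|lra].
apply (is_int_nonneg B (fun x => g x - f x)); auto.
- intros x Hx. specialize (H x Hx). lra.
- now apply is_int_minus.
Qed.

Lemma is_int_Rabs B f g lf lg : Rbar_lt 0 B -> (forall x, dom B x -> Rabs (f x) <= g x) ->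
  is_int B f lf -> is_int B g lg -> Rabs lf <= lg.
Proof.
intros HB H Hf Hg. apply Rabs_le. split.
- assert (-1 * lg <= lf); [|lra].
  apply (is_int_le B (fun x => -1 * g x) f); auto.
  + intros x Hx. specialize (H x Hx). apply Rabs_le_between in H. lra.
  + now apply is_int_scal.
- apply (is_int_le B f g); auto.
  intros x Hx. specialize (H x Hx). apply Rabs_le_between in H. lra.
Qed.

(** Comparison test in which the majorant comes with a primitive [G]: increments of a primitive of
    [f] are bounded by those of [G], so the Cauchy criterion passes from [G] to it at both ends. *)
Lemma ex_int_dominated B f g G lA lB : Rbar_lt 0 B ->
  (forall x, dom B x -> continuous f x) ->
  (forall x, dom B x -> Rabs (f x) <= g x) ->
  (forall x, dom B x -> is_derive G x (g x)) ->
  (forall x, dom B x -> continuous g x) ->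
  filterlim G (at_right 0) (locally lA) ->
  filterlim G (left_filter B) (locally lB) ->
  exists l, is_int B f l.
Proof.
intros HB Hf Hfg HG Hg HA HlB.
destruct (dom_ex B HB) as [x0 Hx0].
assert (Hex : forall a b, dom B a -> dom B b -> ex_RInt f a b).
{ intros a b Ha Hb. apply (ex_RInt_continuous f). intros z Hz. apply Hf.
  destruct (Rle_or_lt a b).
  - rewrite Rmin_left, Rmax_right in Hz by lra. now apply (dom_mid B a b).
  - rewrite Rmin_right, Rmax_left in Hz by lra. now apply (dom_mid B b a). }
assert (Hle : forall a b, dom B a -> dom B b -> a <= b -> Rabs (RInt f a b) <= G b - G a).
{ intros a b Ha Hb Hab.
  assert (Hi : is_RInt g a b (G b - G a)).
  { apply (is_RInt_derive G g); intros x; rewrite Rmin_left, Rmax_right by lra; intros Hx.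
    apply HG, (dom_mid B a b); auto. apply Hg, (dom_mid B a b); auto. }
  apply (norm_RInt_le f g a b (RInt f a b) (G b - G a)); auto.
  intros x Hx. apply Hfg, (dom_mid B a b); auto.
  apply (RInt_correct f). now apply Hex. }
set (F0 := fun x => RInt f x0 x).
assert (HF0 : forall a b, dom B a -> dom B b -> Rabs (F0 b - F0 a) <= Rabs (G b - G a)).
{ assert (Hw : forall a b, dom B a -> dom B b -> a <= b -> Rabs (F0 b - F0 a) <= Rabs (G b - G a)).
  { intros a b Ha Hb Hab. replace (F0 b) with (F0 a + RInt f a b)
      by (apply (RInt_Chasles f x0 a b); now apply Hex).
    replace (F0 a + RInt f a b - F0 a) with (RInt f a b : R)
      by (generalize (F0 a) (RInt f a b : R); intros; simpl in *; ring).
    eapply Rle_trans. apply Hle; auto. apply Rle_abs. }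
  intros a b Ha Hb. destruct (Rle_or_lt a b). now apply Hw.
  rewrite Rabs_minus_sym, (Rabs_minus_sym (G b)). apply Hw; auto; lra. }
assert (HF0d : forall x, dom B x -> is_derive F0 x (f x)).
{ intros x Hx. apply (is_derive_RInt f F0 x0 x); [|now apply Hf].
  assert (locally x (dom B)).
  { destruct Hx as [H1 H2]. apply filter_and.
    - now apply (open_gt 0).
    - now apply (open_Rbar_lt' x B). }
  revert H. apply filter_imp. intros y Hy. apply (RInt_correct f). now apply Hex. }
assert (Hc : forall F (PF : ProperFilter F) l, F (dom B) -> filterlim G F (locally l) ->
   exists y : R, filterlim F0 F (locally y)).
{ intros F PF l HFd HGl.
  apply (@filterlim_locally_cauchy R R_CompleteSpace F PF). intros eps.
  destruct (proj2 (filterlim_locally_cauchy (F := F) (U := R_CompleteSpace) G)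
     (ex_intro _ l HGl) eps) as [P [HP HPe]].
  exists (fun x => dom B x /\ P x). split. now apply filter_and.
  intros u v [Hu HPu] [Hv HPv]. specialize (HPe u v HPu HPv).
  unfold ball in *; simpl in *; unfold AbsRing_ball, abs, minus, plus, opp in *; simpl in *.
  eapply Rle_lt_trans; [|exact HPe]. apply HF0; auto. }
destruct (Hc (at_right 0) _ lA) as [l1 Hl1]; auto.
{ generalize (at_right_below x0 (proj1 Hx0)). apply filter_imp.
  intros y Hy. apply (dom_le B x0); auto; lra. }
destruct (Hc (left_filter B) _ lB) as [l2 Hl2]; auto.
{ generalize (left_filter_above B x0 (proj2 Hx0)). apply filter_imp.
  intros y Hy. destruct Hx0. split; [lra|tauto]. }
exists (l2 - l1). now apply (is_int_antideriv B F0).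
Qed.

(** * Differentiation under the integral sign *)

Lemma second_order_bound (f f1 f2 : R -> R) u0 u M :
  (forall v, Rmin u0 u <= v <= Rmax u0 u -> is_derive f v (f1 v)) ->
  (forall v, Rmin u0 u <= v <= Rmax u0 u -> is_derive f1 v (f2 v)) ->
  (forall v, Rmin u0 u <= v <= Rmax u0 u -> Rabs (f2 v) <= M) ->
  Rabs (f u - f u0 - (u - u0) * f1 u0) <= (u - u0) ^ 2 * M.
Proof.
intros H1 H2 H3.
assert (Hr : Rmin u0 u <= u0 /\ u0 <= Rmax u0 u).
{ split. apply Rmin_l. apply Rmax_l. }
destruct (MVT_gen f u0 u f1) as [c [Hc Ec]].
{ intros x Hx. apply H1. lra. }
{ intros x Hx. apply continuity_pt_filterlim, (ex_derive_continuous f).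
  eexists. apply H1, Hx. }
assert (Hcc : forall v, Rmin u0 c <= v <= Rmax u0 c -> Rmin u0 u <= v <= Rmax u0 u).
{ intros v Hv. unfold Rmin, Rmax in *. destruct (Rle_dec u0 u), (Rle_dec u0 c); lra. }
destruct (MVT_gen f1 u0 c f2) as [d [Hd Ed]].
{ intros x Hx. apply H2, Hcc. lra. }
{ intros x Hx. apply continuity_pt_filterlim, (ex_derive_continuous f1).
  eexists. apply H2, Hcc, Hx. }
rewrite Ec. replace (f1 c * (u - u0) - (u - u0) * f1 u0) with ((u - u0) * (f1 c - f1 u0)) by ring.
rewrite Ed.
replace ((u - u0) * (f2 d * (c - u0))) with ((u - u0) * (c - u0) * f2 d) by ring.
rewrite Rabs_mult. apply Rmult_le_compat; try apply Rabs_pos; auto.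
rewrite Rabs_mult. rewrite <- Rsqr_pow2, Rsqr_abs. unfold Rsqr.
apply Rmult_le_compat_l. apply Rabs_pos.
unfold Rmin, Rmax in Hc. destruct (Rle_dec u0 u).
- rewrite !Rabs_right by lra. lra.
- rewrite !Rabs_left1 by lra. lra.
Qed.

Lemma is_derive_second_order (F : R -> R) u0 l delta K : 0 < delta ->
  (forall u, Rabs (u - u0) < delta -> Rabs (F u - F u0 - (u - u0) * l) <= (u - u0) ^ 2 * K) ->
  is_derive F u0 l.
Proof.
intros Hd H. apply is_derive_Reals. intros eps He.
assert (HK : 0 < Rabs K + 1). { generalize (Rabs_pos K). lra. }
assert (Hd2 : 0 < Rmin delta (eps / (Rabs K + 1))).
{ apply Rmin_pos; auto. apply Rdiv_lt_0_compat; auto. }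
exists (mkposreal _ Hd2). intros h Hh0 Hh. simpl in Hh.
assert (Hh1 : Rabs h < delta). { eapply Rlt_le_trans. apply Hh. apply Rmin_l. }
assert (Hh2 : Rabs h < eps / (Rabs K + 1)). { eapply Rlt_le_trans. apply Hh. apply Rmin_r. }
specialize (H (u0 + h)). replace (u0 + h - u0) with h in H by ring. specialize (H Hh1).
replace ((F (u0 + h) - F u0) / h - l) with ((F (u0 + h) - F u0 - h * l) / h) by (field; auto).
assert (Hp : 0 < Rabs h) by now apply Rabs_pos_lt.
rewrite Rabs_div by auto.
apply Rmult_lt_reg_r with (Rabs h); auto.
replace (Rabs (F (u0 + h) - F u0 - h * l) / Rabs h * Rabs h)
  with (Rabs (F (u0 + h) - F u0 - h * l)) by (field; lra).
eapply Rle_lt_trans. exact H.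
replace (h ^ 2) with (Rabs h * Rabs h) by (rewrite <- Rabs_mult, Rabs_right; [ring|nra]).
apply Rlt_div_r in Hh2; auto.
assert (K <= Rabs K) by apply Rle_abs. nra.
Qed.

(** An integrable bound on the second parameter derivative makes the integrated Taylor remainder
    [O((u - u0)^2)], so a comparison of integrals suffices and no limit is exchanged. *)
Lemma is_derive_int B (F F1 F2 : R -> R -> R) (I : R -> R) u0 I1 delta g Ig :
  Rbar_lt 0 B -> 0 < delta ->
  (forall u, Rabs (u - u0) < delta -> is_int B (F u) (I u)) ->
  is_int B (F1 u0) I1 ->
  (forall u x, Rabs (u - u0) < delta -> dom B x -> is_derive (fun v => F v x) u (F1 u x)) ->
  (forall u x, Rabs (u - u0) < delta -> dom B x -> is_derive (fun v => F1 v x) u (F2 u x)) ->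
  (forall u x, Rabs (u - u0) < delta -> dom B x -> Rabs (F2 u x) <= g x) ->
  is_int B g Ig ->
  is_derive I u0 I1.
Proof.
intros HB Hd HI HI1 H1 H2 H3 Hg.
apply (is_derive_second_order I u0 I1 delta Ig); auto.
intros u Hu.
apply (is_int_Rabs B (fun x => F u x - F u0 x - (u - u0) * F1 u0 x) (fun x => (u - u0)^2 * g x)); auto.
- intros x Hx.
  assert (Hv : forall v, Rmin u0 u <= v <= Rmax u0 u -> Rabs (v - u0) < delta).
  { intros v Hv. apply Rabs_lt_between in Hu. apply Rabs_lt_between.
    unfold Rmin, Rmax in Hv. destruct (Rle_dec u0 u); lra. }
  apply (second_order_bound (fun v => F v x) (fun v => F1 v x) (fun v => F2 v x)); intros v Hv'; auto.
- apply is_int_minus. apply is_int_minus. now apply HI.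
  apply HI. rewrite Rminus_diag, Rabs_R0. auto.
  now apply is_int_scal.
- now apply is_int_scal.
Qed.

Definition scale_bound (k : R) (B : Rbar) : Rbar :=
  match B with Finite b => Finite (k * b) | _ => p_infty end.

Lemma is_int_comp_scal B k f l : 0 < k -> Rbar_lt 0 B ->
  is_int B f l -> is_int (scale_bound k B) (fun x => / k * f (/ k * x)) l.
Proof.
intros Hk HB H P HP. specialize (H P HP).
unfold filtermapi in *. destruct H as [Q1 Q2 H1 H2 H3].
assert (Hk' : 0 < / k) by now apply Rinv_0_lt_compat.
apply (Filter_prod _ _ _ (fun a => Q1 (/ k * a)) (fun b => Q2 (/ k * b))).
- destruct H1 as [d Hd1].
  assert (Hkd : 0 < k * d). { apply Rmult_lt_0_compat; auto. apply cond_pos. }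
  exists (mkposreal _ Hkd). intros y Hy Hy0. apply Hd1.
  + unfold ball in *; simpl in *; unfold AbsRing_ball, abs, minus, plus, opp in *; simpl in *.
    rewrite Ropp_0, Rplus_0_r in *. rewrite Rabs_mult, (Rabs_right (/ k)) by lra.
    apply Rmult_lt_reg_l with k; auto. rewrite <- Rmult_assoc, Rinv_r by lra. lra.
  + now apply Rmult_lt_0_compat.
- destruct B as [b| |]; simpl in *; try easy.
  + destruct H2 as [d Hd1].
    assert (Hkd : 0 < k * d). { apply Rmult_lt_0_compat; auto. apply cond_pos. }
    exists (mkposreal _ Hkd). intros y Hy Hy0. apply Hd1.
    * unfold ball in *; simpl in *; unfold AbsRing_ball, abs, minus, plus, opp in *; simpl in *.
      replace (/ k * y + - b) with (/ k * (y + - (k * b))) by (field; lra).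
      rewrite Rabs_mult, (Rabs_right (/ k)) by lra.
      apply Rmult_lt_reg_l with k; auto. rewrite <- Rmult_assoc, Rinv_r by lra. lra.
    * apply Rmult_lt_reg_l with k; auto. rewrite <- Rmult_assoc, Rinv_r by lra. lra.
  + destruct H2 as [M HM]. exists (k * M). intros x Hx. apply HM.
    apply Rmult_lt_reg_l with k; auto. rewrite <- Rmult_assoc, Rinv_r by lra. lra.
- intros a b Ha Hb. destruct (H3 _ _ Ha Hb) as [y [Hy HPy]]. simpl in *.
  exists y. split; auto.
  replace (/ k * a) with (/ k * a + 0) in Hy by ring.
  replace (/ k * b) with (/ k * b + 0) in Hy by ring.
  generalize (is_RInt_comp_lin f (/ k) 0 a b y Hy). apply is_RInt_ext.
  intros x _. unfold scal; simpl; unfold mult; simpl. now rewrite Rplus_0_r.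
Qed.

Lemma is_int_zero B : Rbar_lt 0 B -> is_int B (fun _ => 0) 0.
Proof.
intros HB. replace (is_int B (fun _ => 0) 0) with (is_int B (fun _ => 0) (0 - 0)) by (f_equal; ring).
apply (is_int_antideriv B (fun _ => 0)); auto.
- intros x _. apply (is_derive_const 0 x).
- intros x _. apply continuous_const.
- apply filterlim_const.
- apply filterlim_const.
Qed.

(** * Powers and exponentials: bounds, limits and integrable majorants *)

Lemma Rpower_pos x a : 0 < Rpower x a.
Proof. apply exp_pos. Qed.

Lemma is_derive_Rpower a x : 0 < x ->
  is_derive (fun t => Rpower t a) x (a * Rpower x (a - 1)).
Proof. intros H. apply is_derive_Reals. now apply derivable_pt_lim_power. Qed.

Lemma continuous_Rpower a x : 0 < x -> continuous (fun t => Rpower t a) x.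
Proof.
intros H. apply (ex_derive_continuous (fun t => Rpower t a)).
eexists. now apply is_derive_Rpower.
Qed.

Lemma Rpower_mult_self x a : 0 < x -> x * Rpower x a = Rpower x (a + 1).
Proof. intros H. rewrite Rpower_plus, Rpower_1; auto. ring. Qed.

Lemma Rpower_1_l a : Rpower 1 a = 1.
Proof. unfold Rpower. rewrite ln_1, Rmult_0_r. apply exp_0. Qed.

Lemma Rpower_le_le1 x a b : 0 < x <= 1 -> a <= b -> Rpower x b <= Rpower x a.
Proof.
intros Hx Hab. unfold Rpower.
assert (ln x <= 0). { rewrite <- ln_1. apply ln_le; lra. }
destruct (Req_dec (b * ln x) (a * ln x)) as [E|E]. rewrite E; lra.
left. apply exp_increasing. nra.
Qed.

Lemma Rpower_le1 x a : 0 < x <= 1 -> 0 <= a -> Rpower x a <= 1.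
Proof.
intros Hx Ha. rewrite <- (Rpower_O x) by lra. apply Rpower_le_le1; lra.
Qed.

Lemma exp_le x y : x <= y -> exp x <= exp y.
Proof. intros [H|H]. left; now apply exp_increasing. subst; lra. Qed.

Lemma Rpower_exp_bound K delta nu : 0 <= K -> 0 < delta -> 0 < nu ->
  exists C, 0 < C /\ forall t, 0 < t -> Rpower t K * exp (- (delta * Rpower t nu)) <= C.
Proof.
intros HK Hd Hn. destruct (Req_dec K 0) as [E|E].
- exists 1. split. lra. intros t Ht. subst. rewrite Rpower_O, Rmult_1_l by auto.
  rewrite <- exp_0. apply exp_le. generalize (Rpower_pos t nu). nra.
(* With this [e], the inequality [ln u <= u - 1] at [u = e t^nu], multiplied by [K / nu], has
   exactly [delta t^nu] on the right; [e t^nu = 1] is the point of the maximum. *)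
- set (e := delta * nu / K).
  assert (HKp : 0 < K) by lra.
  assert (He : 0 < e). { unfold e. apply Rdiv_lt_0_compat; nra. }
  exists (exp (- (K / nu * (1 + ln e)))). split. apply exp_pos.
  intros t Ht. unfold Rpower at 1. rewrite <- exp_plus. apply exp_le.
  generalize (Rpower_pos t nu); intros Hu.
  assert (Hl : ln (e * Rpower t nu) <= e * Rpower t nu - 1).
  { assert (Heu : 0 < e * Rpower t nu) by nra.
    generalize (exp_ineq1_le (ln (e * Rpower t nu))). rewrite exp_ln; lra. }
  rewrite ln_mult in Hl; auto.
  replace (ln (Rpower t nu)) with (nu * ln t) in Hl by (unfold Rpower; now rewrite ln_exp).
  assert (HKn : 0 < K / nu) by now apply Rdiv_lt_0_compat.
  assert (K / nu * (ln e + nu * ln t) <= K / nu * (e * Rpower t nu - 1)) by (apply Rmult_le_compat_l; lra).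
  replace (K / nu * (ln e + nu * ln t)) with (K / nu * ln e + K * ln t) in H by (field; lra).
  replace (K / nu * (e * Rpower t nu - 1)) with (delta * Rpower t nu - K / nu) in H by (unfold e; field; lra).
  lra.
Qed.

Lemma Rpower_lim_0 a : 0 < a -> filterlim (fun t => Rpower t a) (at_right 0) (locally 0).
Proof.
intros Ha P [e He].
assert (Hp : 0 < Rpower e (/ a)) by apply Rpower_pos.
exists (mkposreal _ Hp). intros y Hy Hy0. apply He.
apply ball_Rabs in Hy. simpl in Hy. rewrite Rminus_0_r, Rabs_right in Hy by lra.
change (Rabs (Rpower y a - 0) < e).
rewrite Rminus_0_r, Rabs_right by (left; apply Rpower_pos).
apply Rlt_le_trans with (Rpower (Rpower e (/ a)) a).
- apply Rlt_Rpower_l; lra.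
- rewrite Rpower_mult. replace (/ a * a) with 1 by (field; lra). rewrite Rpower_1 by apply cond_pos. lra.
Qed.

Lemma Rpower_lim_infty a : 0 < a ->
  filterlim (fun t => Rpower t (- a)) (Rbar_locally p_infty) (locally 0).
Proof.
intros Ha P [e He].
exists (Rpower e (- / a)). intros y Hy. apply He.
assert (Hp : 0 < Rpower e (- / a)) by apply Rpower_pos.
change (Rabs (Rpower y (- a) - 0) < e).
rewrite Rminus_0_r, Rabs_right by (left; apply Rpower_pos).
apply Rlt_le_trans with (Rpower (Rpower e (- / a)) (- a)).
- rewrite (Rpower_Ropp y a), (Rpower_Ropp (Rpower e (- / a)) a). apply Rinv_lt_contravar.
  apply Rmult_lt_0_compat; apply Rpower_pos. apply Rlt_Rpower_l; auto.
- rewrite Rpower_mult. replace (- / a * - a) with 1 by (field; lra). rewrite Rpower_1 by apply cond_pos. lra.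
Qed.

Lemma flim_squeeze {T} (F : (T -> Prop) -> Prop) {FF : Filter F} (f g : T -> R) (l : R) :
  F (fun x => Rabs (f x - l) <= g x) -> filterlim g F (locally 0) -> filterlim f F (locally l).
Proof.
intros H Hg P [e He].
assert (H1 : F (fun x => Rabs (g x) < e)).
{ apply (Hg (fun y => Rabs y < e)). exists e. intros y Hy. apply ball_Rabs in Hy.
  now rewrite Rminus_0_r in Hy. }
change (F (fun x => P (f x))).
generalize (filter_and _ _ H H1). apply filter_imp. intros x [Hx1 Hx2].
apply He. change (Rabs (f x - l) < e). generalize (Rle_abs (g x)). lra.
Qed.

Lemma lim_0_of_Rpower f a C : 0 < a -> (forall t, 0 < t <= 1 -> Rabs (f t) <= C * Rpower t a) ->
  filterlim f (at_right 0) (locally 0).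
Proof.
intros Ha H. apply flim_squeeze with (fun t => C * Rpower t a); [apply _| |].
- generalize (at_right_below 1 Rlt_0_1). apply filter_imp. intros x Hx.
  rewrite Rminus_0_r. apply H. lra.
- replace 0 with (C * 0) at 2 by ring. apply flim_scal; [apply _|]. now apply Rpower_lim_0.
Qed.

Lemma lim_infty_of_Rpower f a C : 0 < a -> (forall t, 1 <= t -> Rabs (f t) <= C * Rpower t (- a)) ->
  filterlim f (Rbar_locally p_infty) (locally 0).
Proof.
intros Ha H. apply flim_squeeze with (fun t => C * Rpower t (- a)); [apply _| |].
- exists 1. intros x Hx. rewrite Rminus_0_r. apply H. lra.
- replace 0 with (C * 0) by ring. apply flim_scal; [apply _|]. now apply Rpower_lim_infty.
Qed.

(** The majorant is a multiple of [t^(a-1) / (1 + t^a)^2]: it is integrable at both ends and has the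
    closed primitive [- 1 / (a (1 + t^a))]. *)
Lemma ex_int_exp a delta nu C f : 0 < a -> 0 < delta -> 0 < nu ->
  (forall t, 0 < t -> continuous f t) ->
  (forall t, 0 < t -> Rabs (f t) <= C * (Rpower t (a - 1) * exp (- (delta * Rpower t nu)))) ->
  exists l, is_int p_infty f l.
Proof.
intros Ha Hd Hn Hf H.
destruct (Rpower_exp_bound a delta nu) as [C1 [HC1 H1]]; try lra.
destruct (Rpower_exp_bound (a + a) delta nu) as [C2 [HC2 H2]]; try lra.
(* Expanding [(1 + t^a)^2]: the exponential times [1], [t^a] and [t^(2a)] is at most [1], [C1] and
   [C2]. *)
set (D := Rabs C * (1 + 2 * C1 + C2)).
assert (HD : 0 <= D). { apply Rmult_le_pos. apply Rabs_pos. lra. }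
assert (Hex : forall x, 0 < x -> is_derive (fun t => - (D / a) * / (1 + Rpower t a)) x
            (D * (Rpower x (a - 1) / (1 + Rpower x a) ^ 2))).
{ intros x Hx. generalize (Rpower_pos x a); intros Hp.
  assert (E := is_derive_Rpower a x Hx).
  evar_last. apply (is_derive_scal (fun t => / (1 + Rpower t a)) x (- (D / a))).
  apply (is_derive_inv (fun t => 1 + Rpower t a)).
  apply (is_derive_plus (fun _ => 1)). apply is_derive_const. exact E. lra.
  unfold plus, zero, scal; simpl; unfold mult; simpl. field. split; lra. }
apply (ex_int_dominated p_infty f (fun t => D * (Rpower t (a - 1) / (1 + Rpower t a) ^ 2))
   (fun t => - (D / a) * / (1 + Rpower t a)) (- (D / a) * / (1 + 0)) (- (D / a) * 0)).
- easy.
- intros x [Hx _]. auto.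
- intros x [Hx _]. eapply Rle_trans. now apply H.
  generalize (Rpower_pos x a) (Rpower_pos x (a-1)) (exp_pos (- (delta * Rpower x nu))).
  specialize (H1 x Hx). specialize (H2 x Hx). rewrite Rpower_plus in H2.
  revert H1 H2. set (p := Rpower x a). set (q := Rpower x (a - 1)).
  assert (Hexp1 : exp (- (delta * Rpower x nu)) <= 1).
  { rewrite <- exp_0. apply exp_le. generalize (Rpower_pos x nu). nra. }
  revert Hexp1. set (e := exp _).
  intros He1 H1 H2 Hp Hq He.
  assert (HE : e * (1 + p)^2 <= 1 + 2 * C1 + C2) by nra.
  apply Rle_trans with (Rabs C * (q * e)).
  { apply Rmult_le_compat_r. nra. apply Rle_abs. }
  unfold D. replace (Rabs C * (1 + 2 * C1 + C2) * (q / (1 + p) ^ 2))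
    with (Rabs C * (q * ((1 + 2 * C1 + C2) / (1 + p) ^ 2))) by (field; lra).
  apply Rmult_le_compat_l. apply Rabs_pos. apply Rmult_le_compat_l. lra.
  apply Rle_div_r. apply pow_lt; lra. exact HE.
- intros x [Hx _]. now apply Hex.
- intros x [Hx _].
  apply (continuous_scal_r D (fun t => Rpower t (a - 1) / (1 + Rpower t a) ^ 2)).
  apply (continuous_mult (fun t => Rpower t (a - 1)) (fun t => / (1 + Rpower t a) ^ 2)).
  now apply continuous_Rpower.
  generalize (Rpower_pos x a); intros Hp.
  apply (continuous_comp (fun t => Rpower t a) (fun u => / (1 + u) ^ 2)).
  now apply continuous_Rpower.
  apply (ex_derive_continuous (fun u => / (1 + u) ^ 2)). auto_derive. nra.
- apply flim_scal; [apply _|].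
  apply (filterlim_comp _ _ _ (fun t => Rpower t a) (fun u => / (1 + u)) (at_right 0) (locally 0)).
  now apply Rpower_lim_0.
  apply (ex_derive_continuous (fun u => / (1 + u))). auto_derive. lra.
- apply flim_scal; [apply _|].
  apply (lim_infty_of_Rpower _ a 1); auto. intros t Ht.
  generalize (Rpower_pos t a); intros Hp.
  rewrite Rabs_right by (left; apply Rinv_0_lt_compat; lra).
  rewrite Rpower_Ropp, Rmult_1_l. apply Rinv_le_contravar; lra.
Qed.

Lemma exp_poly_bound delta : 0 < delta ->
  exists C, 0 < C /\ forall w, 0 <= w -> (1 + w) ^ 2 * exp (- (delta * w)) <= C.
Proof.
intros Hd. set (C := Rmax 1 (2 / delta)).
assert (HC : 1 <= C) by apply Rmax_l. assert (HC' : 2 / delta <= C) by apply Rmax_r.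
exists (C ^ 2). split. nra.
intros w Hw.
assert (H1 : 1 + w <= C * exp (delta * w / 2)).
{ generalize (exp_ineq1_le (delta * w / 2)). intros H.
  apply Rle_trans with (C * (1 + delta * w / 2)). 2: apply Rmult_le_compat_l; lra.
  assert (2 / delta * (delta * w / 2) <= C * (delta * w / 2)) by (apply Rmult_le_compat_r; nra).
  replace (2 / delta * (delta * w / 2)) with w in H0 by (field; lra). lra. }
replace (exp (- (delta * w))) with (exp (- (delta * w / 2)) ^ 2).
2:{ simpl. rewrite Rmult_1_r, <- exp_plus. f_equal. field. }
rewrite <- Rpow_mult_distr. apply pow_incr. split.
- apply Rmult_le_pos. lra. left; apply exp_pos.
- rewrite exp_Ropp. apply Rle_div_l. apply exp_pos. exact H1.
Qed.

(** * Derivative and continuity rules for real functions *)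

Lemma is_derive_eq (f : R -> R) (x l l' : R) : is_derive f x l -> l = l' -> is_derive f x l'.
Proof. now intros H <-. Qed.

Lemma d_mult (f g : R -> R) (x df dg : R) : is_derive f x df -> is_derive g x dg ->
  is_derive (fun t => f t * g t) x (df * g x + f x * dg).
Proof. intros Hf Hg. apply (is_derive_mult f g x df dg Hf Hg). intros; apply Rmult_comm. Qed.

Lemma d_plus (f g : R -> R) (x df dg : R) : is_derive f x df -> is_derive g x dg ->
  is_derive (fun t => f t + g t) x (df + dg).
Proof. apply (is_derive_plus f g x df dg). Qed.

Lemma d_minus (f g : R -> R) (x df dg : R) : is_derive f x df -> is_derive g x dg ->
  is_derive (fun t => f t - g t) x (df - dg).
Proof. apply (is_derive_minus f g x df dg). Qed.

Lemma d_scal (f : R -> R) (x df k : R) : is_derive f x df -> is_derive (fun t => k * f t) x (k * df).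
Proof. apply (is_derive_scal f x k df). Qed.

Lemma d_const (k x : R) : is_derive (fun _ : R => k) x 0.
Proof. apply (is_derive_const k x). Qed.

Lemma d_id (x : R) : is_derive (fun t : R => t) x 1.
Proof. apply (is_derive_id x). Qed.

Lemma d_comp (f g : R -> R) (x df dg : R) : is_derive f (g x) df -> is_derive g x dg ->
  is_derive (fun t => f (g t)) x (dg * df).
Proof. apply (is_derive_comp f g x df dg). Qed.

Lemma d_Rpower a (f : R -> R) (x df : R) : 0 < f x -> is_derive f x df ->
  is_derive (fun t => Rpower (f t) a) x (df * (a * Rpower (f x) (a - 1))).
Proof. intros H0 H. apply (d_comp (fun u => Rpower u a) f); auto. now apply is_derive_Rpower. Qed.

Lemma is_derive_continuous (f : R -> R) (x df : R) : is_derive f x df -> continuous f x.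
Proof. intros H. apply (ex_derive_continuous f). now exists df. Qed.

Lemma c_mult (f g : R -> R) x : continuous f x -> continuous g x -> continuous (fun t => f t * g t) x.
Proof. apply (continuous_mult f g x). Qed.

Lemma c_plus (f g : R -> R) x : continuous f x -> continuous g x -> continuous (fun t => f t + g t) x.
Proof. apply (continuous_plus f g x). Qed.

Lemma c_minus (f g : R -> R) x : continuous f x -> continuous g x -> continuous (fun t => f t - g t) x.
Proof. apply (continuous_minus f g x). Qed.

Lemma c_const (k x : R) : continuous (fun _ : R => k) x.
Proof. apply continuous_const. Qed.

Lemma c_scal (k : R) (f : R -> R) x : continuous f x -> continuous (fun t => k * f t) x.
Proof. intros H. apply c_mult; auto. apply c_const. Qed.

Lemma c_id (x : R) : continuous (fun t : R => t) x.
Proof. apply continuous_id. Qed.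

Lemma c_exp (f : R -> R) x : continuous f x -> continuous (fun t => exp (f t)) x.
Proof. intros H. apply (continuous_comp f exp); auto. eapply is_derive_continuous, is_derive_exp. Qed.

Lemma c_sin (f : R -> R) x : continuous f x -> continuous (fun t => sin (f t)) x.
Proof. intros H. apply (continuous_comp f sin); auto. eapply is_derive_continuous, is_derive_sin. Qed.

Lemma c_Rpower a (f : R -> R) x : 0 < f x -> continuous f x -> continuous (fun t => Rpower (f t) a) x.
Proof. intros H0 H. apply (continuous_comp f (fun u => Rpower u a)); auto. now apply continuous_Rpower. Qed.

(** * The Gamma function *)

Lemma continuous_exp_neg x : continuous (fun t => exp (- t)) x.
Proof. apply (ex_derive_continuous (fun t => exp (- t))). auto_derive. auto. Qed.

Lemma d_exp_neg x : is_derive (fun t => exp (- t)) x (- exp (- x)).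
Proof. auto_derive; auto. ring. Qed.

Lemma is_int_Gamma x : 0 < x ->
  is_int p_infty (fun t => Rpower t (x - 1) * exp (- t)) (Gamma x).
Proof.
intros Hx.
destruct (ex_int_exp x 1 1 1 (fun t => Rpower t (x - 1) * exp (- t))) as [l Hl]; try lra.
- intros t Ht. apply (continuous_mult (fun t => Rpower t (x-1)) (fun t => exp (- t))).
  now apply continuous_Rpower. apply continuous_exp_neg.
- intros t Ht. rewrite Rabs_right. rewrite Rpower_1, !Rmult_1_l by auto. lra.
  left. apply Rmult_lt_0_compat; apply exp_pos.
- unfold Gamma. erewrite is_RInt_gen_unique; [|exact Hl]. exact Hl.
Qed.

Lemma Gamma_nonneg x : 0 < x -> 0 <= Gamma x.
Proof.
intros Hx. apply (is_int_nonneg p_infty _ _ I) with (2 := is_int_Gamma x Hx).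
intros t _. left. apply Rmult_lt_0_compat; apply exp_pos.
Qed.

Lemma Rpower_mul_exp_lim_infty K delta nu : 0 <= K -> 0 < delta -> 0 < nu ->
  filterlim (fun t => Rpower t K * exp (- (delta * Rpower t nu))) (Rbar_locally p_infty) (locally 0).
Proof.
intros HK Hd Hn. destruct (Rpower_exp_bound (K + 1) delta nu) as [C [HC H]]; try lra.
apply (lim_infty_of_Rpower _ 1 C). lra.
intros t Ht. specialize (H t ltac:(lra)).
rewrite Rabs_right by (left; apply Rmult_lt_0_compat; apply exp_pos).
rewrite Rpower_Ropp, Rpower_1 by lra. apply Rmult_le_reg_r with t. lra. replace (C * / t * t) with C by (field; lra).
rewrite Rpower_plus, Rpower_1 in H by lra. lra.
Qed.

Lemma Rpower_mul_exp_lim_0 K delta nu : 0 < K -> 0 < delta ->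
  filterlim (fun t => Rpower t K * exp (- (delta * Rpower t nu))) (at_right 0) (locally 0).
Proof.
intros HK Hd. apply (lim_0_of_Rpower _ K 1); auto. intros t Ht.
rewrite Rabs_right by (left; apply Rmult_lt_0_compat; apply exp_pos).
assert (exp (- (delta * Rpower t nu)) <= 1).
{ rewrite <- exp_0. apply exp_le. generalize (Rpower_pos t nu). nra. }
generalize (Rpower_pos t K). nra.
Qed.

Lemma Gamma_succ x : 0 < x -> Gamma (x + 1) = x * Gamma x.
Proof.
intros Hx.
assert (H1 : is_int p_infty (fun t => Rpower t (x + 1 - 1) * exp (- t) - x * (Rpower t (x - 1) * exp (- t)))
      (Gamma (x + 1) - x * Gamma x)).
{ apply is_int_minus. apply is_int_Gamma; lra. apply is_int_scal. now apply is_int_Gamma. }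
assert (H2 : is_int p_infty (fun t => Rpower t (x + 1 - 1) * exp (- t) - x * (Rpower t (x - 1) * exp (- t)))
      (-1 * 0 - -1 * 0)).
{ apply (is_int_antideriv p_infty (fun t => -1 * (Rpower t x * exp (- (1 * Rpower t 1))))).
  - easy.
  - intros t [Ht _].
    apply (is_derive_ext_loc (fun t => -1 * (Rpower t x * exp (- t)))).
    { apply (filter_imp (fun y => 0 < y)). intros y Hy. now rewrite Rpower_1, Rmult_1_l by auto.
      now apply (open_gt 0). }
    eapply is_derive_eq. apply d_scal, d_mult. now apply is_derive_Rpower.
    apply d_exp_neg.
    cbv beta. replace (x + 1 - 1) with x by ring. ring.
  - intros t [Ht _].
    apply (continuous_minus (fun t => Rpower t (x + 1 - 1) * exp (- t)) (fun t => x * (Rpower t (x - 1) * exp (- t)))).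
    apply (continuous_mult (fun t => Rpower t (x+1-1)) (fun t => exp (- t))).
    now apply continuous_Rpower. apply continuous_exp_neg.
    apply (continuous_scal_r x (fun t => Rpower t (x - 1) * exp (- t))).
    apply (continuous_mult (fun t => Rpower t (x-1)) (fun t => exp (- t))).
    now apply continuous_Rpower. apply continuous_exp_neg.
  - apply flim_scal; [apply _|]. apply Rpower_mul_exp_lim_0; lra.
  - apply flim_scal; [apply _|]. apply Rpower_mul_exp_lim_infty; lra. }
generalize (is_int_unique _ _ _ _ H1 H2). lra.
Qed.

Lemma Gamma_1 : Gamma 1 = 1.
Proof.
assert (H1 := is_int_Gamma 1 Rlt_0_1).
assert (H2 : is_int p_infty (fun t => Rpower t (1 - 1) * exp (- t)) (0 - -1 * exp (- 0))).
{ apply (is_int_antideriv p_infty (fun t => -1 * exp (- t))).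
  - easy.
  - intros t [Ht _]. replace (1 - 1) with 0 by ring. rewrite Rpower_O by auto.
    auto_derive; auto. ring.
  - intros t [Ht _]. apply (continuous_mult (fun t => Rpower t (1-1)) (fun t => exp (- t))).
    now apply continuous_Rpower. apply continuous_exp_neg.
  - apply flim_scal; [apply _|]. unfold at_right. apply (filterlim_filter_le_1 (F := locally 0)).
    apply filter_le_within. apply continuous_exp_neg.
  - replace 0 with (-1 * 0) by ring. apply flim_scal; [apply _|].
    apply filterlim_ext_loc with (fun t => Rpower t 0 * exp (- (1 * Rpower t 1))).
    { exists 0. intros t Ht. rewrite Rpower_O, Rpower_1 by auto. now rewrite !Rmult_1_l. }
    apply Rpower_mul_exp_lim_infty; lra. }
rewrite (is_int_unique _ _ _ _ H1 H2). rewrite Ropp_0, exp_0. ring.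
Qed.

(** Weighted AM-GM: after division by [u^x] the right side is a weighted sum of two exponentials,
    and the linear terms of their tangent bounds cancel. *)
Lemma Rpower_Bernoulli u x : 0 < u -> 0 <= x <= 1 -> Rpower u x <= 1 - x + x * u.
Proof.
intros Hu Hx. set (w := ln u).
replace u with (exp w) at 2 by (apply exp_ln; auto).
unfold Rpower. fold w.
assert (H1 := exp_ineq1_le (- (x * w))). assert (H2 := exp_ineq1_le ((1 - x) * w)).
assert (E : 1 - x + x * exp w = exp (x * w) * ((1 - x) * exp (- (x * w)) + x * exp ((1 - x) * w))).
{ rewrite Rmult_plus_distr_l. rewrite <- !Rmult_assoc, !(Rmult_comm (exp (x * w))), !Rmult_assoc, <- !exp_plus.
  replace (x * w + - (x * w)) with 0 by ring. replace (x * w + (1 - x) * w) with w by ring.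
  rewrite exp_0. ring. }
rewrite E. generalize (exp_pos (x * w)). intros Hp.
assert (H3 : (1 - x) * (1 + - (x * w)) <= (1 - x) * exp (- (x * w))) by (apply Rmult_le_compat_l; lra).
assert (H4 : x * (1 + (1 - x) * w) <= x * exp ((1 - x) * w)) by (apply Rmult_le_compat_l; lra).
rewrite <- (Rmult_1_r (exp (x * w))) at 1. apply Rmult_le_compat_l. lra.
lra.
Qed.

Lemma Rpower_mean_bound t a x : 0 < t -> 0 < a -> 0 <= x <= 1 ->
  Rpower t x <= Rpower a x * ((1 - x) + x / a * t).
Proof.
intros Ht Ha Hx. replace t with (a * (t / a)) at 1 by (field; lra).
rewrite <- Rpower_mult_distr; auto. 2: now apply Rdiv_lt_0_compat.
apply Rmult_le_compat_l. left; apply Rpower_pos.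
replace (x / a * t) with (x * (t / a)) by (field; lra).
apply Rpower_Bernoulli; auto. now apply Rdiv_lt_0_compat.
Qed.

(** Replaces Hoelder's inequality. The mean of [t] for the weight [t^(a-1) exp (- t)] is [a], so the
    tangent of [t^x] at [a] integrates to exactly [a^x Gamma a]. *)
Lemma Gamma_add_le a x : 0 < a -> 0 <= x <= 1 -> Gamma (a + x) <= Rpower a x * Gamma a.
Proof.
intros Ha Hx.
assert (E : Rpower a x * Gamma a = Rpower a x * ((1 - x) * Gamma a + x / a * Gamma (a + 1))).
{ rewrite Gamma_succ by auto. field. lra. }
rewrite E. clear E.
apply (is_int_le p_infty (fun t => Rpower t (a + x - 1) * exp (- t))
  (fun t => Rpower a x * ((1 - x) * (Rpower t (a - 1) * exp (- t)) + x / a * (Rpower t (a + 1 - 1) * exp (- t))))).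
- easy.
- intros t [Ht _]. replace (a + x - 1) with (a - 1 + x) by ring. replace (a + 1 - 1) with (a - 1 + 1) by ring.
  rewrite !Rpower_plus, Rpower_1 by auto.
  generalize (Rpower_mean_bound t a x Ht Ha Hx) (exp_pos (- t)) (Rpower_pos t (a-1)); intros H1 H2 H3.
  replace (Rpower a x * ((1 - x) * (Rpower t (a - 1) * exp (- t)) + x / a * (Rpower t (a - 1) * t * exp (- t))))
    with (Rpower t (a - 1) * exp (- t) * (Rpower a x * ((1 - x) + x / a * t))) by ring.
  replace (Rpower t (a - 1) * Rpower t x * exp (- t)) with (Rpower t (a - 1) * exp (- t) * Rpower t x) by ring.
  apply Rmult_le_compat_l; auto. nra.
- apply is_int_Gamma. lra.
- apply is_int_scal. apply is_int_plus; apply is_int_scal; apply is_int_Gamma; lra.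
Qed.

(** Strict positivity is obtained quantitatively: [1 = Gamma 2 <= (1 + x)^(1 - x) Gamma (1 + x)],
    and the power is at most [1 + x - x^2 <= 2]. *)
Lemma Gamma_ge_half x : 0 <= x <= 1 -> / 2 <= Gamma (1 + x).
Proof.
intros Hx. assert (H := Gamma_add_le (1 + x) (1 - x) ltac:(lra) ltac:(lra)).
replace (1 + x + (1 - x)) with (1 + 1) in H by ring.
rewrite Gamma_succ, Gamma_1 in H by lra.
assert (H2 := Rpower_Bernoulli (1 + x) (1 - x) ltac:(lra) ltac:(lra)).
assert (0 <= Gamma (1 + x)) by (apply Gamma_nonneg; lra). nra.
Qed.

Lemma Gamma_pos x : 0 < x -> 0 < Gamma x.
Proof.
intros Hx.
assert (H : forall n y, 0 < y <= INR n -> 0 < Gamma y).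
{ induction n; intros y Hy. simpl in Hy; lra.
  rewrite S_INR in Hy. destruct (Rle_or_lt y 1) as [H1|H1].
  - assert (H2 := Gamma_ge_half y ltac:(lra)).
    rewrite Rplus_comm, Gamma_succ in H2 by lra. nra.
  - replace y with (y - 1 + 1) by ring. rewrite Gamma_succ by lra.
    apply Rmult_lt_0_compat. lra. destruct (Rle_or_lt y 2).
    + assert (H3 := Gamma_ge_half (y - 1) ltac:(lra)).
      replace (1 + (y - 1)) with (y - 1 + 1) in H3 by ring.
      rewrite Gamma_succ in H3 by lra. assert (0 <= Gamma (y - 1)) by (apply Gamma_nonneg; lra). nra.
    + apply IHn. lra. }
destruct (INR_unbounded x) as [n Hn]. apply (H n). lra.
Qed.

(* The Bohr-Mollerup conditions; the last one is log-convexity combined with the functional equation. *)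
Definition gamma_like (f : R -> R) : Prop :=
  (forall x, 0 < x -> 0 < f x) /\ (forall x, 0 < x -> f (x + 1) = x * f x) /\
  (forall a x, 0 < a -> 0 <= x <= 1 -> f (a + x) <= Rpower a x * f a).

Lemma gamma_like_Gamma : gamma_like Gamma.
Proof.
repeat split. apply Gamma_pos. apply Gamma_succ. apply Gamma_add_le.
Qed.

Lemma gamma_like_shift f x n : gamma_like f -> 0 < x -> f (x + INR n) = pochhammer x n * f x.
Proof.
intros [_ [H _]] Hx. induction n.
- simpl. rewrite Rplus_0_r. ring.
- rewrite S_INR, <- Rplus_assoc. rewrite H, IHn. simpl. ring.
  generalize (pos_INR n); lra.
Qed.

Lemma pochhammer_pos x n : 0 < x -> 0 < pochhammer x n.
Proof.
intros Hx. induction n; simpl. lra. apply Rmult_lt_0_compat; auto.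
generalize (pos_INR n); lra.
Qed.

(** Uniqueness argument of Bohr and Mollerup: the functional equation carries [x] and [1] to [m + x]
    and [m], where the growth condition bounds [f] above and [g] below up to a factor [1 + x / m];
    then [m] tends to infinity. *)
Lemma gamma_like_le f g x : gamma_like f -> gamma_like g -> 0 < x <= 1 -> f x * g 1 <= g x * f 1.
Proof.
intros Hf Hg Hx.
assert (Pf := proj1 Hf). assert (Pg := proj1 Hg).
assert (Hf1 := Pf 1 Rlt_0_1). assert (Hg1 := Pg 1 Rlt_0_1).
assert (Hfx := Pf x (proj1 Hx)). assert (Hgx := Pg x (proj1 Hx)).
assert (H : forall n, f x * g 1 <= g x * f 1 * (1 + x / INR (S n))).
{ intros n. set (m := INR (S n)).
  assert (Hm : 0 < m) by (apply lt_0_INR; lia).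
  set (q := pochhammer 1 n). set (p := pochhammer x (S n)).
  assert (Hq : 0 < q) by (apply pochhammer_pos; lra).
  assert (Hp : 0 < p) by (apply pochhammer_pos; lra).
  assert (H1 : forall h, gamma_like h -> h m = q * h 1).
  { intros h Hh. unfold m. rewrite S_INR, Rplus_comm. apply gamma_like_shift; auto. lra. }
  assert (H2 : forall h, gamma_like h -> h (m + x) = p * h x).
  { intros h Hh. unfold m. rewrite Rplus_comm. apply gamma_like_shift; auto. lra. }
  assert (U : p * f x <= Rpower m x * (q * f 1)).
  { rewrite <- H1, <- H2 by auto. apply (proj2 (proj2 Hf)); lra. }
  assert (L : m * (q * g 1) <= Rpower (m + x) (1 - x) * (p * g x)).
  { rewrite <- H1, <- H2 by auto. rewrite <- (proj1 (proj2 Hg)) by auto.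
    replace (m + 1) with (m + x + (1 - x)) by ring. apply (proj2 (proj2 Hg)); lra. }
  assert (E : Rpower m x * Rpower (m + x) (1 - x) <= m + x).
  { replace (m + x) with (Rpower (m + x) x * Rpower (m + x) (1 - x)) at 2.
    2:{ rewrite <- Rpower_plus. replace (x + (1 - x)) with 1 by ring. apply Rpower_1; lra. }
    apply Rmult_le_compat_r. left; apply Rpower_pos. apply Rle_Rpower_l; lra. }
  set (A := Rpower m x) in *. set (B := Rpower (m + x) (1 - x)) in *.
  assert (HA : 0 < A) by apply Rpower_pos. assert (HB : 0 < B) by apply Rpower_pos.
  clearbody A B p q m.
  assert (X : (p * f x) * (m * (q * g 1)) <= (A * (q * f 1)) * (B * (p * g x))).
  { apply Rmult_le_compat; auto; try (left; repeat apply Rmult_lt_0_compat; auto). }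
  assert (Y : (A * (q * f 1)) * (B * (p * g x)) <= (p * q) * (g x * f 1) * (m + x)).
  { replace ((A * (q * f 1)) * (B * (p * g x))) with ((p * q) * (g x * f 1) * (A * B)) by ring.
    apply Rmult_le_compat_l; auto. left; repeat apply Rmult_lt_0_compat; auto. }
  apply Rmult_le_reg_l with (p * q * m). repeat apply Rmult_lt_0_compat; auto.
  replace (p * q * m * (g x * f 1 * (1 + x / m))) with ((p * q) * (g x * f 1) * (m + x)) by (field; lra).
  lra. }
assert (H0 : 0 < g x * f 1) by now apply Rmult_lt_0_compat.
destruct (Rle_or_lt (f x * g 1) (g x * f 1)) as [L|L]; auto. exfalso.
destruct (INR_unbounded (g x * f 1 * x / (f x * g 1 - g x * f 1))) as [n Hn].
specialize (H n).
assert (Hm : 0 < INR (S n)) by (apply lt_0_INR; lia).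
assert (INR n < INR (S n)) by (apply lt_INR; lia).
apply Rlt_div_l in Hn; [|lra].
assert (g x * f 1 * x < INR (S n) * (f x * g 1 - g x * f 1)) by nra.
replace (g x * f 1 * (1 + x / INR (S n))) with (g x * f 1 + g x * f 1 * x / INR (S n)) in H by (field; lra).
assert (g x * f 1 * x / INR (S n) < f x * g 1 - g x * f 1).
{ apply Rlt_div_l; auto. lra. }
lra.
Qed.

Lemma gamma_like_unique f g x : gamma_like f -> gamma_like g -> 0 < x -> f x * g 1 = g x * f 1.
Proof.
intros Hf Hg Hx.
assert (H : forall n y, 0 < y <= INR (S n) -> f y * g 1 = g y * f 1).
{ induction n; intros y Hy.
  - simpl in Hy. apply Rle_antisym; apply gamma_like_le; auto.
  - rewrite S_INR in Hy. destruct (Rle_or_lt y (INR (S n))) as [H1|H1]. apply IHn; lra.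
    assert (1 <= INR (S n)) by (apply (le_INR 1); lia).
    replace y with (y - 1 + 1) by ring.
    rewrite (proj1 (proj2 Hf)), (proj1 (proj2 Hg)) by lra. rewrite !Rmult_assoc, IHn by lra. ring. }
destruct (INR_unbounded x) as [n Hn]. apply (H n). rewrite S_INR; lra.
Qed.

(** * The Beta function *)

Lemma lim_right_continuous (f : R -> R) x : continuous f x -> filterlim f (at_right x) (locally (f x)).
Proof.
intros H. apply (filterlim_filter_le_1 (F := locally x)); auto. apply filter_le_within.
Qed.

Lemma lim_left_continuous (f : R -> R) x : continuous f x -> filterlim f (at_left x) (locally (f x)).
Proof.
intros H. apply (filterlim_filter_le_1 (F := locally x)); auto. apply filter_le_within.
Qed.

Lemma one_minus_at_left : filterlim (fun u => 1 - u) (at_left 1) (at_right 0).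
Proof.
intros P [e He]. exists e. intros y Hy Hy1. apply He.
- apply ball_Rabs in Hy. change (Rabs (1 - y - 0) < e).
  replace (1 - y - 0) with (- (y - 1)) by ring. now rewrite Rabs_Ropp.
- lra.
Qed.

Lemma Rpower_one_minus_lim b : 0 < b -> filterlim (fun u => Rpower (1 - u) b) (at_left 1) (locally 0).
Proof.
intros Hb. apply (filterlim_comp _ _ _ (fun u => 1 - u) (fun t => Rpower t b) _ (at_right 0)).
apply one_minus_at_left. now apply Rpower_lim_0.
Qed.

Lemma Rpower_ge_m1 u b : 0 < u <= 1 -> 0 <= b -> Rpower u (b - 1) <= / u.
Proof.
intros Hu Hb. replace (/ u) with (Rpower u (- (1))) by (rewrite Rpower_Ropp, Rpower_1; lra).
apply Rpower_le_le1; lra.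
Qed.

Lemma c_one_minus x : continuous (fun u => 1 - u) x.
Proof. apply c_minus. apply c_const. apply c_id. Qed.

Lemma d_one_minus (x : R) : is_derive (fun u => 1 - u) x (-1).
Proof. eapply is_derive_eq. apply d_minus. apply d_const. apply d_id. lra. Qed.

Lemma d_Rpower_one_minus b (x : R) : x < 1 ->
  is_derive (fun u => Rpower (1 - u) b) x (- (b * Rpower (1 - x) (b - 1))).
Proof.
intros Hx. eapply is_derive_eq. apply (d_Rpower b (fun u => 1 - u)). lra. apply d_one_minus. cbv beta. ring.
Qed.

(** Separates the two endpoint singularities: on each half of the interval one factor is at most 2,
    and the resulting sum has an explicit primitive. *)
Lemma beta_dom_bound u a b : 0 < a -> 0 < b -> 0 < u < 1 ->
  Rpower u (a - 1) * Rpower (1 - u) (b - 1) <= 2 * (Rpower u (a - 1) + Rpower (1 - u) (b - 1)).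
Proof.
intros Ha Hb Hu. generalize (Rpower_pos u (a-1)) (Rpower_pos (1-u) (b-1)); intros H1 H2.
destruct (Rle_or_lt u (/2)) as [H|H].
- assert (Rpower (1 - u) (b - 1) <= 2); [|nra].
  eapply Rle_trans. apply Rpower_ge_m1; lra.
  replace 2 with (/ / 2) by field. apply Rinv_le_contravar; lra.
- assert (Rpower u (a - 1) <= 2); [|nra].
  eapply Rle_trans. apply Rpower_ge_m1; lra.
  replace 2 with (/ / 2) by field. apply Rinv_le_contravar; lra.
Qed.

Lemma ex_int_beta a b C f : 0 < a -> 0 < b ->
  (forall u, 0 < u < 1 -> continuous f u) ->
  (forall u, 0 < u < 1 -> Rabs (f u) <= C * (Rpower u (a - 1) * Rpower (1 - u) (b - 1))) ->
  exists l, is_int 1 f l.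
Proof.
intros Ha Hb Hf H. set (D := 2 * Rabs C).
apply (ex_int_dominated 1 f (fun u => D * (Rpower u (a - 1) + Rpower (1 - u) (b - 1)))
   (fun u => D * (/ a * Rpower u a - / b * Rpower (1 - u) b))
   (D * (/ a * 0 - / b * Rpower (1 - 0) b)) (D * (/ a * Rpower 1 a - / b * 0))).
- simpl; lra.
- intros x [H1 H2]. simpl in H2. apply Hf; lra.
- intros x [H1 H2]. simpl in H2. eapply Rle_trans. apply H; lra.
  generalize (beta_dom_bound x a b Ha Hb ltac:(lra)) (Rpower_pos x (a-1)) (Rpower_pos (1-x) (b-1)); intros H3 H4 H5.
  apply Rle_trans with (Rabs C * (Rpower x (a - 1) * Rpower (1 - x) (b - 1))).
  apply Rmult_le_compat_r. nra. apply Rle_abs. unfold D. generalize (Rabs_pos C). nra.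
- intros x [H1 H2]. simpl in H2.
  eapply is_derive_eq. apply d_scal, d_minus; apply d_scal. now apply is_derive_Rpower.
  now apply d_Rpower_one_minus. cbv beta. field. lra.
- intros x [H1 H2]. simpl in H2. apply c_scal, c_plus. now apply continuous_Rpower.
  apply (c_Rpower (b - 1) (fun u => 1 - u)). lra. apply c_one_minus.
- apply flim_scal; [apply _|]. apply flim_minus; [apply _| |]; apply flim_scal; try apply _.
  now apply Rpower_lim_0.
  apply (lim_right_continuous (fun u => Rpower (1 - u) b)).
  apply (c_Rpower b (fun u => 1 - u)). lra. apply c_one_minus.
- apply flim_scal; [apply _|]. apply flim_minus; [apply _| |]; apply flim_scal; try apply _.
  apply (lim_left_continuous (fun u => Rpower u a)). apply continuous_Rpower; lra.
  now apply Rpower_one_minus_lim.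
Qed.

Definition Beta (a b : R) : R :=
  RInt_gen (fun u => Rpower u (a - 1) * Rpower (1 - u) (b - 1)) (at_right 0) (at_left 1).

Lemma c_beta a b u : 0 < u < 1 -> continuous (fun u => Rpower u (a - 1) * Rpower (1 - u) (b - 1)) u.
Proof.
intros Hu. apply c_mult. apply continuous_Rpower; lra.
apply (c_Rpower (b - 1) (fun u => 1 - u)). lra. apply c_one_minus.
Qed.

Lemma is_int_Beta a b : 0 < a -> 0 < b ->
  is_int 1 (fun u => Rpower u (a - 1) * Rpower (1 - u) (b - 1)) (Beta a b).
Proof.
intros Ha Hb.
destruct (ex_int_beta a b 1 (fun u => Rpower u (a - 1) * Rpower (1 - u) (b - 1))) as [l Hl]; auto.
- intros; now apply c_beta.
- intros u Hu. rewrite Rabs_right. lra. left. apply Rmult_lt_0_compat; apply Rpower_pos.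
- unfold Beta. erewrite is_RInt_gen_unique; [|exact Hl]. exact Hl.
Qed.

Lemma Beta_succ a b : 0 < a -> 0 < b -> Beta (a + 1) b = a / (a + b) * Beta a b.
Proof.
intros Ha Hb.
assert (H1 : is_int 1 (fun u => a * (Rpower u (a - 1) * Rpower (1 - u) (b - 1))
     - (a + b) * (Rpower u (a + 1 - 1) * Rpower (1 - u) (b - 1))) (a * Beta a b - (a + b) * Beta (a + 1) b)).
{ apply is_int_minus; apply is_int_scal; apply is_int_Beta; lra. }
assert (H2 : is_int 1 (fun u => a * (Rpower u (a - 1) * Rpower (1 - u) (b - 1))
     - (a + b) * (Rpower u (a + 1 - 1) * Rpower (1 - u) (b - 1)))
     (Rpower 1 a * 0 - 0 * Rpower (1 - 0) b)).
{ apply (is_int_antideriv 1 (fun u => Rpower u a * Rpower (1 - u) b)).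
  - simpl; lra.
  - intros x [Hx1 Hx2]. simpl in Hx2.
    eapply is_derive_eq. apply d_mult. now apply is_derive_Rpower. now apply d_Rpower_one_minus.
    replace (a + 1 - 1) with a by ring.
    replace (Rpower (1 - x) b) with (Rpower (1 - x) (b - 1) * (1 - x)).
    2:{ rewrite <- (Rpower_1 (1 - x)) at 2 by lra. rewrite <- Rpower_plus. f_equal; ring. }
    replace (Rpower x a) with (Rpower x (a - 1) * x).
    2:{ rewrite <- (Rpower_1 x) at 2 by lra. rewrite <- Rpower_plus. f_equal; ring. }
    ring.
  - intros x [Hx1 Hx2]. simpl in Hx2. apply c_minus; apply c_scal; apply c_beta; lra.
  - apply flim_mult; [apply _| |]. now apply Rpower_lim_0.
    apply (lim_right_continuous (fun u => Rpower (1 - u) b)).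
    apply (c_Rpower b (fun u => 1 - u)). lra. apply c_one_minus.
  - apply flim_mult; [apply _| |].
    apply (lim_left_continuous (fun u => Rpower u a)). apply continuous_Rpower; lra.
    now apply Rpower_one_minus_lim. }
generalize (is_int_unique _ _ _ _ H1 H2). intros E.
apply Rmult_eq_reg_l with (a + b); [|lra]. field_simplify; lra.
Qed.

Lemma Beta_nonneg a b : 0 < a -> 0 < b -> 0 <= Beta a b.
Proof.
intros Ha Hb. apply (is_int_nonneg 1 (fun u => Rpower u (a - 1) * Rpower (1 - u) (b - 1))).
simpl; lra. intros u _. left; apply Rmult_lt_0_compat; apply Rpower_pos. now apply is_int_Beta.
Qed.

Lemma Beta_1 b : 0 < b -> Beta 1 b = / b.
Proof.
intros Hb.
assert (H1 := is_int_Beta 1 b Rlt_0_1 Hb).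
assert (H2 : is_int 1 (fun u => Rpower u (1 - 1) * Rpower (1 - u) (b - 1)) (- / b * 0 - - / b * Rpower (1 - 0) b)).
{ apply (is_int_antideriv 1 (fun u => - / b * Rpower (1 - u) b)).
  - simpl; lra.
  - intros x [Hx1 Hx2]. simpl in Hx2.
    eapply is_derive_eq. apply d_scal. now apply d_Rpower_one_minus.
    replace (1 - 1) with 0 by ring. rewrite Rpower_O by auto. field. lra.
  - intros x [Hx1 Hx2]. simpl in Hx2. apply c_beta; lra.
  - apply flim_scal; [apply _|].
    apply (lim_right_continuous (fun u => Rpower (1 - u) b)).
    apply (c_Rpower b (fun u => 1 - u)). lra. apply c_one_minus.
  - apply flim_scal; [apply _|]. now apply Rpower_one_minus_lim. }
rewrite (is_int_unique _ _ _ _ H1 H2). rewrite Rminus_0_r, Rpower_1_l. ring.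
Qed.

(** The argument of [Gamma_add_le], with the tangent taken at [a / (a + b)], the mean of [u] for the
    Beta weight. *)
Lemma Beta_add_le a b x : 0 < a -> 0 < b -> 0 <= x <= 1 ->
  Beta (a + x) b <= Rpower (a / (a + b)) x * Beta a b.
Proof.
intros Ha Hb Hx. set (r := a / (a + b)).
assert (Hr : 0 < r) by (unfold r; apply Rdiv_lt_0_compat; lra).
assert (E : Rpower r x * Beta a b = Rpower r x * ((1 - x) * Beta a b + x / r * Beta (a + 1) b)).
{ rewrite Beta_succ by auto. fold r. field. lra. }
rewrite E. clear E.
apply (is_int_le 1 (fun u => Rpower u (a + x - 1) * Rpower (1 - u) (b - 1))
  (fun u => Rpower r x * ((1 - x) * (Rpower u (a - 1) * Rpower (1 - u) (b - 1))
     + x / r * (Rpower u (a + 1 - 1) * Rpower (1 - u) (b - 1))))).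
- simpl; lra.
- intros u [Hu1 Hu2]. simpl in Hu2.
  replace (a + x - 1) with (a - 1 + x) by ring. replace (a + 1 - 1) with (a - 1 + 1) by ring.
  rewrite !Rpower_plus, Rpower_1 by auto. generalize (Rpower_mean_bound u r x Hu1 Hr Hx).
  generalize (Rpower_pos u (a-1)) (Rpower_pos (1-u) (b-1)).
  set (p := Rpower u (a - 1)). set (q := Rpower (1 - u) (b - 1)). intros Hp Hq HH.
  replace (p * Rpower u x * q) with (p * q * Rpower u x) by ring.
  replace (Rpower r x * ((1 - x) * (p * q) + x / r * (p * u * q))) with
    (p * q * (Rpower r x * (1 - x + x / r * u))) by ring.
  apply Rmult_le_compat_l; auto. nra.
- apply is_int_Beta; lra.
- apply is_int_scal. apply is_int_plus; apply is_int_scal; apply is_int_Beta; lra.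
Qed.

(** A zero at [a] would, by [Beta_add_le], force a nonpositive value at the next integer, where the
    recurrence from [Beta 1 b = 1 / b] gives a positive one. *)
Lemma Beta_pos a b : 0 < a -> 0 < b -> 0 < Beta a b.
Proof.
intros Ha Hb. destruct (Beta_nonneg a b Ha Hb) as [H|H]; auto. exfalso.
assert (Hn : forall n, Beta (a + INR n) b = 0).
{ induction n. simpl. now rewrite Rplus_0_r. rewrite S_INR, <- Rplus_assoc, Beta_succ, IHn; auto. ring.
  generalize (pos_INR n); lra. }
set (m := Z.to_nat (up a)).
assert (Hm : 0 < INR m - a <= 1).
{ unfold m. destruct (archimed a). rewrite INR_IZR_INZ, Z2Nat.id. lra.
  apply le_IZR. lra. }
assert (Hm1 : (1 <= m)%nat). { apply INR_lt. simpl. lra. }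
assert (HH : forall k, 0 < Beta (1 + INR k) b).
{ induction k. simpl. rewrite Rplus_0_r, Beta_1 by auto. now apply Rinv_0_lt_compat.
  rewrite S_INR, <- Rplus_assoc. assert (0 <= INR k) by apply pos_INR. rewrite Beta_succ by lra.
  apply Rmult_lt_0_compat; auto. apply Rdiv_lt_0_compat; lra. }
assert (H0 := Beta_add_le a b (INR m - a) Ha Hb ltac:(lra)).
replace (a + (INR m - a)) with (1 + INR (m - 1)) in H0 by (rewrite minus_INR by auto; simpl; ring).
specialize (HH (m - 1)%nat). rewrite <- H in H0. lra.
Qed.

(** No double integral: [Gamma (x + b) Beta x b] is itself [gamma_like] in [x], hence proportional
    to [Gamma x], and [x = 1] fixes the factor. *)
Lemma Beta_Gamma a b : 0 < a -> 0 < b -> Beta a b * Gamma (a + b) = Gamma a * Gamma b.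
Proof.
intros Ha Hb.
assert (HG : gamma_like (fun x => Gamma (x + b) * Beta x b)).
{ repeat split.
  - intros x Hx. apply Rmult_lt_0_compat. apply Gamma_pos; lra. now apply Beta_pos.
  - intros x Hx. rewrite Beta_succ by auto. replace (x + 1 + b) with (x + b + 1) by ring.
    rewrite Gamma_succ by lra. field. lra.
  - intros y x Hy Hx.
    replace (Rpower y x * (Gamma (y + b) * Beta y b)) with
      (Rpower (y + b) x * Gamma (y + b) * (Rpower (y / (y + b)) x * Beta y b)).
    + replace (y + x + b) with (y + b + x) by ring.
      apply Rmult_le_compat. apply Gamma_nonneg; lra. apply Beta_nonneg; lra.
      apply Gamma_add_le; lra. now apply Beta_add_le.
    + transitivity ((Rpower (y + b) x * Rpower (y / (y + b)) x) * (Gamma (y + b) * Beta y b)). ring.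
      rewrite Rpower_mult_distr by (try apply Rdiv_lt_0_compat; lra).
      f_equal. f_equal. field. lra. }
assert (E := gamma_like_unique _ _ a HG gamma_like_Gamma Ha). cbv beta in E.
rewrite Gamma_1, Beta_1, (Rplus_comm 1 b), (Gamma_succ b) in E by auto.
replace (Beta a b * Gamma (a + b)) with (Gamma (a + b) * Beta a b * 1) by ring.
rewrite E. field. lra.
Qed.

(** * The reflection formula and 1/Gamma *)

(* Euler's integral for the sine product: [cos_int (2 m) x / cos_int (2 m) 0] is
   [sin (PI x) / (PI x)] divided by the product of the [1 - x^2/k^2], [k <= m], and tends to 1. *)
Definition cos_int (n : nat) (x : R) : R := RInt (fun t => cos t ^ n * cos (2 * x * t)) 0 (PI / 2).

Lemma d_cos_int_integrand n x t :
  ex_derive (fun t => cos t ^ n * cos (2 * x * t)) t.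
Proof. auto_derive. auto. Qed.

Lemma is_RInt_cos_int n x :
  is_RInt (fun t => cos t ^ n * cos (2 * x * t)) 0 (PI / 2) (cos_int n x).
Proof.
apply (RInt_correct (fun t => cos t ^ n * cos (2 * x * t))).
apply (ex_RInt_continuous (fun t => cos t ^ n * cos (2 * x * t))).
intros t _. apply (ex_derive_continuous (fun t => cos t ^ n * cos (2 * x * t))).
apply d_cos_int_integrand.
Qed.

Lemma cos_int_rec n x :
  (INR (n + 2) ^ 2 - 4 * x ^ 2) * cos_int (n + 2) x = INR (n + 2) * INR (n + 1) * cos_int n x.
Proof.
assert (H1 : is_RInt (fun t => (INR (n + 2) ^ 2 - 4 * x ^ 2) * (cos t ^ (n + 2) * cos (2 * x * t))
    - INR (n + 2) * INR (n + 1) * (cos t ^ n * cos (2 * x * t))) 0 (PI / 2)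
   ((INR (n + 2) ^ 2 - 4 * x ^ 2) * cos_int (n + 2) x - INR (n + 2) * INR (n + 1) * cos_int n x)).
{ apply (is_RInt_minus (V := R_NormedModule)); apply (is_RInt_scal (V := R_NormedModule)); apply is_RInt_cos_int. }
(* [Phi] collects the boundary terms of two integrations by parts; it vanishes at [PI / 2] through
   the cosines and at 0 through the sines. *)
set (Phi := fun t => INR (n + 2) * (cos t ^ (n + 1) * sin t * cos (2 * x * t)) - 2 * x * (cos t ^ (n + 2) * sin (2 * x * t))).
assert (H2 : is_RInt (fun t => (INR (n + 2) ^ 2 - 4 * x ^ 2) * (cos t ^ (n + 2) * cos (2 * x * t))
    - INR (n + 2) * INR (n + 1) * (cos t ^ n * cos (2 * x * t))) 0 (PI / 2)
   (Phi (PI / 2) - Phi 0)).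
{ apply (is_RInt_derive (V := R_CompleteNormedModule) Phi).
  - intros t _. unfold Phi.
    assert (Hs : sin t * sin t = 1 - cos t * cos t).
    { generalize (sin2_cos2 t). unfold Rsqr. lra. }
    auto_derive. auto.
    replace (Init.Nat.pred (n + 1)) with n by lia. replace (Init.Nat.pred (n + 2)) with (n + 1)%nat by lia.
    rewrite !pow_add, !plus_INR. simpl (INR 1). simpl (INR 2). simpl (cos t ^ 1). simpl (cos t ^ 2).
    transitivity ((INR n + (1 + 1)) * (- (INR n + 1) * (sin t * sin t) * cos t ^ n * cos (2 * x * t)
      + cos t ^ n * cos t * cos t * cos (2 * x * t)) - 4 * x ^ 2 * (cos t ^ n * cos t * cos t * cos (2 * x * t))).
    ring. rewrite Hs. ring.
  - intros t _.
    apply (ex_derive_continuous (fun t => (INR (n + 2) ^ 2 - 4 * x ^ 2) * (cos t ^ (n + 2) * cos (2 * x * t))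
    - INR (n + 2) * INR (n + 1) * (cos t ^ n * cos (2 * x * t)))). auto_derive. auto. }
assert (E := is_RInt_unique _ _ _ _ H1). rewrite (is_RInt_unique _ _ _ _ H2) in E.
assert (E0 : Phi (PI / 2) - Phi 0 = 0).
{ unfold Phi. replace (2 * x * 0) with 0 by ring. rewrite cos_PI2, !sin_0.
  rewrite !pow_i by lia. ring. }
lra.
Qed.

Lemma cos_int_0_0 : cos_int 0 0 = PI / 2.
Proof.
unfold cos_int. rewrite (RInt_ext _ (fun _ => 1)).
rewrite RInt_const. unfold scal; simpl; unfold mult; simpl. lra.
intros t _. rewrite Rmult_0_r, Rmult_0_l, cos_0. simpl. lra.
Qed.

Lemma cos_int_0 x : x <> 0 -> cos_int 0 x = sin (PI * x) / (2 * x).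
Proof.
intros Hx. unfold cos_int.
assert (H : is_RInt (fun t => cos t ^ 0 * cos (2 * x * t)) 0 (PI / 2)
   (sin (2 * x * (PI / 2)) / (2 * x) - sin (2 * x * 0) / (2 * x))).
{ apply (is_RInt_derive (V := R_CompleteNormedModule) (fun t => sin (2 * x * t) / (2 * x))).
  - intros t _. auto_derive. auto. field. auto.
  - intros t _. apply (ex_derive_continuous (fun t => cos t ^ 0 * cos (2 * x * t))). auto_derive. auto. }
rewrite (is_RInt_unique _ _ _ _ H). rewrite Rmult_0_r, sin_0.
replace (2 * x * (PI / 2)) with (PI * x) by field. field. auto.
Qed.

Lemma cos_int_even_rec m :
  cos_int (2 * m) 0 = INR (2 * m + 2) / INR (2 * m + 1) * cos_int (2 * (m + 1)) 0.
Proof.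
generalize (cos_int_rec (2 * m) 0). replace (2 * (m + 1))%nat with (2 * m + 2)%nat by lia.
assert (0 < INR (2 * m + 2)) by (apply lt_0_INR; lia).
assert (0 < INR (2 * m + 1)) by (apply lt_0_INR; lia).
intros E. apply Rmult_eq_reg_l with (INR (2 * m + 2) * INR (2 * m + 1)).
rewrite <- E. field. lra. apply Rgt_not_eq, Rmult_lt_0_compat; auto.
Qed.

Lemma cos_int_even_pos m : 0 < cos_int (2 * m) 0.
Proof.
induction m.
- simpl. rewrite cos_int_0_0. generalize PI_RGT_0. lra.
- rewrite cos_int_even_rec in IHm.
  assert (0 < INR (2 * m + 2) / INR (2 * m + 1)).
  { apply Rdiv_lt_0_compat; apply lt_0_INR; lia. }
  replace (S m) with (m + 1)%nat by lia.
  apply Rmult_lt_reg_l with (INR (2 * m + 2) / INR (2 * m + 1)); auto. lra.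
Qed.

Lemma mul_cos_le_sin t : 0 <= t <= PI / 2 -> 0 <= t * cos t <= sin t.
Proof.
intros Ht. assert (HP := PI_RGT_0).
split. apply Rmult_le_pos; try lra. apply cos_ge_0; lra.
destruct (Req_dec t 0) as [E|E]. subst. rewrite sin_0. lra.
destruct (MVT_gen (fun u => sin u - u * cos u) 0 t (fun u => u * sin u)) as [c [Hc Ec]].
- intros u _. auto_derive. auto. ring.
- intros u _. apply continuity_pt_filterlim, (ex_derive_continuous (fun u => sin u - u * cos u)). auto_derive. auto.
- rewrite Rmin_left, Rmax_right in Hc by lra. rewrite sin_0 in Ec.
  assert (0 <= sin c) by (apply sin_ge_0; lra).
  assert (0 <= c * sin c * (t - 0)). { repeat apply Rmult_le_pos; lra. } lra.
Qed.

Lemma Rabs_sin_le v : Rabs (sin v) <= Rabs v.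
Proof.
assert (H : forall y, 0 <= y -> Rabs (sin y) <= y).
{ intros y [Hy|Hy].
  - apply Rabs_le. split. 2: left; now apply sin_lt_x.
    destruct (Rle_or_lt y PI). assert (0 <= sin y) by (apply sin_ge_0; lra). lra.
    generalize (SIN_bound y) PI2_1. lra.
  - rewrite <- Hy, sin_0, Rabs_R0. lra. }
destruct (Rle_or_lt 0 v) as [Hv|Hv].
- rewrite (Rabs_right v) by lra. now apply H.
- rewrite (Rabs_left v), <- Rabs_Ropp, <- sin_neg by lra. apply H. lra.
Qed.

(** From [1 - cos (2 x t) <= 2 x^2 t^2] and [t cos t <= sin t]: the factor [t^2 cos^(n+2)] becomes
    [sin^2 cos^n], whose integral is a difference of two cosine integrals, small by the
    recurrence. *)
Lemma cos_int_diff n x :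
  Rabs (cos_int (n + 2) 0 - cos_int (n + 2) x) <= 2 * x ^ 2 * (cos_int n 0 - cos_int (n + 2) 0).
Proof.
assert (HP := PI_RGT_0).
apply (norm_RInt_le (V := R_NormedModule)
   (fun t => cos t ^ (n + 2) * cos (2 * 0 * t) - cos t ^ (n + 2) * cos (2 * x * t))
   (fun t => 2 * x ^ 2 * (cos t ^ n * cos (2 * 0 * t) - cos t ^ (n + 2) * cos (2 * 0 * t))) 0 (PI / 2)).
- lra.
- intros t Ht. rewrite Rmult_0_r, Rmult_0_l, cos_0.
  destruct (mul_cos_le_sin t Ht) as [H1 H2].
  assert (Hc : 0 <= cos t ^ n) by (apply pow_le, cos_ge_0; lra).
  assert (Hc2 : 0 <= cos t ^ (n + 2)) by (apply pow_le, cos_ge_0; lra).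
  assert (H3 : 0 <= 1 - cos (2 * x * t) <= 2 * x ^ 2 * t ^ 2).
  { replace (2 * x * t) with (2 * (x * t)) by ring. rewrite cos_2a_sin.
    assert (Hs := Rabs_sin_le (x * t)).
    apply Rsqr_le_abs_1 in Hs. unfold Rsqr in Hs. split; nra. }
  change (Rabs (cos t ^ (n + 2) * 1 - cos t ^ (n + 2) * cos (2 * x * t)) <=
    2 * x ^ 2 * (cos t ^ n * 1 - cos t ^ (n + 2) * 1)).
  rewrite Rabs_right.
  2:{ apply Rle_ge. nra. }
  apply Rle_trans with (cos t ^ (n + 2) * (2 * x ^ 2 * t ^ 2)). nra.
  assert (Hs : sin t * sin t = 1 - cos t * cos t).
  { generalize (sin2_cos2 t). unfold Rsqr. lra. }
  rewrite !pow_add. simpl (cos t ^ 2).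
  replace (2 * x ^ 2 * (cos t ^ n * 1 - cos t ^ n * (cos t * (cos t * 1)) * 1)) with
    (2 * x ^ 2 * cos t ^ n * (1 - cos t * cos t)) by ring.
  rewrite <- Hs.
  replace (cos t ^ n * (cos t * (cos t * 1)) * (2 * x ^ 2 * t ^ 2)) with
    (2 * x ^ 2 * cos t ^ n * ((t * cos t) * (t * cos t))) by ring.
  apply Rmult_le_compat_l. { apply Rmult_le_pos; auto. nra. }
  apply Rmult_le_compat; auto.
- apply (is_RInt_minus (V := R_NormedModule)); apply is_RInt_cos_int.
- apply (is_RInt_scal (V := R_NormedModule)), (is_RInt_minus (V := R_NormedModule)); apply is_RInt_cos_int.
Qed.

Lemma cos_ratio_bound m x :
  Rabs (cos_int (2 * (m + 1)) x / cos_int (2 * (m + 1)) 0 - 1) <= 2 * x ^ 2 / INR (2 * m + 1).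
Proof.
assert (Hp := cos_int_even_pos (m + 1)).
assert (H := cos_int_diff (2 * m) x). replace (2 * m + 2)%nat with (2 * (m + 1))%nat in H by lia.
rewrite (cos_int_even_rec m) in H.
assert (Hm : 0 < INR (2 * m + 1)) by (apply lt_0_INR; lia).
replace (INR (2 * m + 2)) with (INR (2 * m + 1) + 1) in H by (rewrite !plus_INR; simpl; ring).
set (a := cos_int (2 * (m + 1)) 0) in *. set (b := cos_int (2 * (m + 1)) x) in *.
replace (b / a - 1) with (- ((a - b) / a)) by (field; lra).
rewrite Rabs_Ropp, Rabs_div, (Rabs_right a) by lra.
apply Rle_div_l; auto.
replace (2 * x ^ 2 / INR (2 * m + 1) * a) with
  (2 * x ^ 2 * ((INR (2 * m + 1) + 1) / INR (2 * m + 1) * a - a)) by (field; lra). auto.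
Qed.

(** Four uses of [Gamma_add_le] squeeze the product. The exponents [x] and [1 - x] add up to 1, so
    the powers combine into ratios of linear terms in [m]. *)
Lemma Gamma_ratio_bound m x : 0 < x < 1 -> 1 <= m ->
  Rabs (Gamma (m + 1 + x) * Gamma (m + 1 - x) / Gamma (m + 1) ^ 2 - 1) <= / m.
Proof.
intros Hx Hm.
assert (G0 : 0 < Gamma m) by (apply Gamma_pos; lra).
assert (G1 : 0 < Gamma (m + 1)) by (apply Gamma_pos; lra).
assert (G2 : 0 < Gamma (m + 1 + x)) by (apply Gamma_pos; lra).
assert (G3 : 0 < Gamma (m + 1 - x)) by (apply Gamma_pos; lra).
assert (E1 := Gamma_succ m ltac:(lra)).
assert (U1 := Gamma_add_le (m + 1) x ltac:(lra) ltac:(lra)).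
assert (U2 := Gamma_add_le m (1 - x) ltac:(lra) ltac:(lra)).
replace (m + (1 - x)) with (m + 1 - x) in U2 by ring.
assert (L1 := Gamma_add_le (m + x) (1 - x) ltac:(lra) ltac:(lra)).
replace (m + x + (1 - x)) with (m + 1) in L1 by ring.
assert (L2 := Gamma_add_le (m + 1 - x) x ltac:(lra) ltac:(lra)).
replace (m + 1 - x + x) with (m + 1) in L2 by ring.
assert (E2 := Gamma_succ (m + x) ltac:(lra)). replace (m + x + 1) with (m + 1 + x) in E2 by ring.
assert (P1 : forall y, 0 < y -> Rpower y x * Rpower y (1 - x) = y).
{ intros y Hy. rewrite <- Rpower_plus. replace (x + (1 - x)) with 1 by ring. now apply Rpower_1. }
assert (Q1 : Rpower (m + 1) x * Rpower m (1 - x) <= m + 1).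
{ apply Rle_trans with (Rpower (m + 1) x * Rpower (m + 1) (1 - x)); [|rewrite P1; lra].
  apply Rmult_le_compat_l. left; apply Rpower_pos. apply Rle_Rpower_l; lra. }
assert (Q2 : Rpower (m + x) (1 - x) * Rpower (m + 1 - x) x <= m + 1).
{ apply Rle_trans with (Rpower (m + 1) (1 - x) * Rpower (m + 1) x); [|rewrite Rmult_comm, P1; lra].
  apply Rmult_le_compat; try (left; apply Rpower_pos); apply Rle_Rpower_l; lra. }
set (g0 := Gamma m) in *. set (g1 := Gamma (m + 1)) in *. set (g2 := Gamma (m + 1 + x)) in *.
set (g3 := Gamma (m + 1 - x)) in *.
assert (U : g2 * g3 <= (m + 1) * g1 * g0).
{ apply Rle_trans with ((Rpower (m + 1) x * g1) * (Rpower m (1 - x) * g0)).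
  apply Rmult_le_compat; auto; lra.
  replace (Rpower (m + 1) x * g1 * (Rpower m (1 - x) * g0)) with (Rpower (m + 1) x * Rpower m (1 - x) * (g1 * g0)) by ring.
  rewrite (Rmult_assoc (m + 1)). apply Rmult_le_compat_r; auto. left. now apply Rmult_lt_0_compat. }
assert (L : (m + x) * g1 * g1 <= (m + 1) * (g2 * g3)).
{ assert (L1' : (m + x) * g1 <= Rpower (m + x) (1 - x) * g2).
  { rewrite E2. replace (Rpower (m + x) (1 - x) * ((m + x) * Gamma (m + x))) with
     ((m + x) * (Rpower (m + x) (1 - x) * Gamma (m + x))) by ring.
    apply Rmult_le_compat_l; lra. }
  apply Rle_trans with ((Rpower (m + x) (1 - x) * g2) * (Rpower (m + 1 - x) x * g3)).
  apply Rmult_le_compat; auto; try lra. apply Rmult_le_pos; lra.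
  replace (Rpower (m + x) (1 - x) * g2 * (Rpower (m + 1 - x) x * g3)) with
    ((Rpower (m + x) (1 - x) * Rpower (m + 1 - x) x) * (g2 * g3)) by ring.
  apply Rmult_le_compat_r; auto. left. now apply Rmult_lt_0_compat. }
assert (Hgg : 0 < g1 ^ 2) by (apply pow_lt; auto).
replace (g2 * g3 / g1 ^ 2 - 1) with ((g2 * g3 - g1 ^ 2) / g1 ^ 2) by (field; lra).
rewrite Rabs_div, (Rabs_right (g1 ^ 2)) by lra.
apply Rle_div_l; auto.
apply Rmult_le_reg_l with m. lra.
replace (m * (/ m * g1 ^ 2)) with (g1 ^ 2) by (field; lra).
rewrite <- (Rabs_right m) at 1 by lra. rewrite <- Rabs_mult.
apply Rabs_le. split.
- assert (m * g1 ^ 2 <= (m + 1) * (g2 * g3)). { eapply Rle_trans; [|exact L]. simpl. nra. }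
  assert (m / (m + 1) * g1 ^ 2 <= g2 * g3).
  { apply Rmult_le_reg_l with (m + 1). lra. replace ((m + 1) * (m / (m + 1) * g1 ^ 2)) with (m * g1 ^ 2) by (field; lra). auto. }
  assert (m * (m / (m + 1) * g1 ^ 2) <= m * (g2 * g3)) by (apply Rmult_le_compat_l; lra).
  assert ((m - 1) * g1 ^ 2 <= m * (m / (m + 1) * g1 ^ 2)).
  { apply Rmult_le_reg_l with (m + 1). lra.
    replace ((m + 1) * (m * (m / (m + 1) * g1 ^ 2))) with (m * m * g1 ^ 2) by (field; lra). nra. }
  lra.
- assert (m * (g2 * g3) <= m * ((m + 1) * g1 * g0)) by (apply Rmult_le_compat_l; lra).
  replace (m * ((m + 1) * g1 * g0)) with ((m + 1) * g1 * (m * g0)) in H by ring.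
  rewrite <- E1 in H. lra.
Qed.

Lemma inv_INR_small e : 0 < e -> exists n, (1 <= n)%nat /\ / INR n < e.
Proof.
intros He. destruct (INR_unbounded (/ e)) as [n Hn].
assert (0 < / e) by now apply Rinv_0_lt_compat.
assert (0 < INR n) by lra.
exists n. split. apply INR_le. simpl. destruct n; [simpl in *; lra|]. apply (le_INR 1); lia.
rewrite <- (Rinv_inv e). apply Rinv_lt_contravar; auto. now apply Rmult_lt_0_compat.
Qed.

(** The cosine ratio [q] and the Gamma ratio [r] obey reciprocal recurrences, so [q m * r m] is
    constant. It tends to 1, and at [m = 0] it is the left side divided by [PI]. *)
Lemma Gamma_reflection x : 0 < x < 1 -> Gamma x * Gamma (1 - x) * sin (PI * x) = PI.
Proof.
intros Hx.
set (q := fun m => cos_int (2 * m) x / cos_int (2 * m) 0).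
set (r := fun m => Gamma (INR m + 1 + x) * Gamma (INR m + 1 - x) / Gamma (INR m + 1) ^ 2).
assert (Hc : forall m, q m * r m = q O * r O).
{ induction m; auto. rewrite <- IHm. unfold q, r.
  rewrite S_INR. set (y := INR m).
  assert (Hy : 0 <= y) by apply pos_INR.
  replace (y + 1 + 1 + x) with (y + 1 + x + 1) by ring. replace (y + 1 + 1 - x) with (y + 1 - x + 1) by ring.
  rewrite !(Gamma_succ (y + 1)), (Gamma_succ (y + 1 + x)), (Gamma_succ (y + 1 - x)) by lra.
  assert (E0 := cos_int_even_rec m). assert (Ex := cos_int_rec (2 * m) x).
  assert (P0 := cos_int_even_pos m). assert (P1 := cos_int_even_pos (m + 1)).
  replace (2 * m + 2)%nat with (2 * (m + 1))%nat in Ex by lia.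
  replace (INR (2 * m + 2)) with (2 * (y + 1)) in E0 by (unfold y; rewrite plus_INR, mult_INR; simpl; ring).
  replace (INR (2 * (m + 1))) with (2 * (y + 1)) in Ex by (unfold y; rewrite mult_INR, plus_INR; simpl; ring).
  replace (INR (2 * m + 1)) with (2 * y + 1) in * by (unfold y; rewrite plus_INR, mult_INR; simpl; ring).
  replace (S m) with (m + 1)%nat by lia.
  assert (Ex' : cos_int (2 * m) x = 2 * ((y + 1) ^ 2 - x ^ 2) / ((y + 1) * (2 * y + 1)) * cos_int (2 * (m + 1)) x).
  { apply Rmult_eq_reg_l with (2 * (y + 1) * (2 * y + 1)). rewrite <- Ex. field. lra. apply Rgt_not_eq. nra. }
  rewrite E0, Ex'. field. repeat split; try lra. apply Rgt_not_eq, Gamma_pos; lra. }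
assert (HS : q O * r O = 1).
(* The 5 comes from [q r - 1 = (q - 1) r + (r - 1)] with [|q - 1| <= 2/m], [|r| <= 2] and
   [|r - 1| <= 1/m]. *)
{ assert (Hb : forall m, (1 <= m)%nat -> Rabs (q O * r O - 1) <= 5 * / INR m).
  { intros m Hm. assert (Hm1 : 1 <= INR m) by (apply (le_INR 1); auto).
    assert (Hi : 0 < / INR m <= 1).
    { split. apply Rinv_0_lt_compat; lra. rewrite <- Rinv_1. apply Rinv_le_contravar; lra. }
    assert (B1 : Rabs (q m - 1) <= 2 * / INR m).
    { assert (B := cos_ratio_bound (m - 1) x). replace (m - 1 + 1)%nat with m in B by lia.
      fold (q m) in B. eapply Rle_trans. apply B.
      unfold Rdiv. apply Rmult_le_compat. nra.
      left; apply Rinv_0_lt_compat, lt_0_INR; lia. nra. apply Rinv_le_contravar. lra. apply le_INR. lia. }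
    assert (B2 : Rabs (r m - 1) <= / INR m) by exact (Gamma_ratio_bound (INR m) x Hx Hm1).
    rewrite <- (Hc m). replace (q m * r m - 1) with ((q m - 1) * r m + (r m - 1)) by ring.
    eapply Rle_trans. apply Rabs_triang. rewrite Rabs_mult.
    assert (B3 : Rabs (r m) <= 2).
    { apply Rabs_le. apply Rabs_le_between in B2. lra. }
    generalize (Rabs_pos (q m - 1)) (Rabs_pos (r m)). nra. }
  destruct (Req_dec (q O * r O) 1) as [E|E]; auto. exfalso.
  assert (Hp : 0 < Rabs (q O * r O - 1) / 5).
  { apply Rdiv_lt_0_compat; [|lra]. apply Rabs_pos_lt. lra. }
  destruct (inv_INR_small _ Hp) as [n [Hn1 Hn2]]. specialize (Hb n Hn1). lra. }
unfold q, r in HS. simpl (2 * 0)%nat in HS. simpl (INR 0) in HS.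
rewrite cos_int_0_0, cos_int_0 in HS by lra. rewrite !Rplus_0_l, Gamma_1, (Rplus_comm 1 x), Gamma_succ in HS by lra.
assert (HP := PI_RGT_0).
replace (sin (PI * x) / (2 * x) / (PI / 2) * (x * Gamma x * Gamma (1 - x) / 1 ^ 2)) with
  (Gamma x * Gamma (1 - x) * sin (PI * x) / PI) in HS by (field; lra).
apply Rmult_eq_reg_r with (/ PI). rewrite Rinv_r by lra. exact HS. apply Rinv_neq_0_compat; lra.
Qed.

(** * The reciprocal Gamma function on the whole line and its factorial bounds *)

Lemma rgamma_shift x N : 0 < x + INR N -> rgamma x = pochhammer x N / Gamma (x + INR N).
Proof.
assert (H : forall N k, 0 < x + INR N ->
   pochhammer x (k + N) / Gamma (x + INR (k + N)) = pochhammer x N / Gamma (x + INR N)).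
{ intros M k HM. induction k; auto. rewrite <- IHk.
  assert (0 < x + INR (k + M)). { rewrite plus_INR. generalize (pos_INR k). lra. }
  replace (S k + M)%nat with (S (k + M)) by lia. rewrite S_INR, <- Rplus_assoc, Gamma_succ by auto.
  simpl. field. split. apply Rgt_not_eq, Gamma_pos; auto. lra. }
intros HN. unfold rgamma. set (M := Z.to_nat (up (- x))).
assert (HM : 0 < x + INR M).
{ destruct (archimed (- x)) as [H1 H2]. unfold M. destruct (Z_le_gt_dec 0 (up (- x))) as [Hz|Hz].
  - rewrite INR_IZR_INZ, Z2Nat.id by auto. lra.
  - assert (IZR (up (- x)) < 0) by (apply IZR_lt; lia).
    replace (Z.to_nat (up (- x))) with O by (destruct (up (- x)); simpl; lia). simpl. lra. }
rewrite <- (H M N HM), <- (H N M HN). now rewrite Nat.add_comm.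
Qed.

Lemma rgamma_pos_arg x : 0 < x -> rgamma x = / Gamma x.
Proof.
intros Hx. rewrite (rgamma_shift x 0) by (simpl; lra). simpl. rewrite Rplus_0_r.
unfold Rdiv; ring.
Qed.

Lemma pochhammer_S_l x n : pochhammer x (S n) = x * pochhammer (x + 1) n.
Proof.
induction n. simpl; ring.
change (pochhammer x (S n) * (x + INR (S n)) = x * (pochhammer (x + 1) n * (x + 1 + INR n))).
rewrite IHn, S_INR. ring.
Qed.

Lemma rgamma_rec x : rgamma x = x * rgamma (x + 1).
Proof.
destruct (INR_unbounded (- x)) as [n Hn].
rewrite (rgamma_shift x (S n)) by (rewrite S_INR; lra).
rewrite (rgamma_shift (x + 1) n) by lra.
rewrite pochhammer_S_l, S_INR. replace (x + (INR n + 1)) with (x + 1 + INR n) by ring.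
unfold Rdiv; ring.
Qed.

Lemma rgamma_1 : rgamma 1 = 1.
Proof. rewrite rgamma_pos_arg, Gamma_1 by lra. apply Rinv_1. Qed.

Lemma rgamma_reflection x : x < 1 -> rgamma x = Gamma (1 - x) * sin (PI * x) / PI.
Proof.
assert (HP := PI_RGT_0).
assert (H : forall n x, - INR n < x < 1 -> rgamma x = Gamma (1 - x) * sin (PI * x) / PI).
{ induction n; intros y Hy.
  - simpl in Hy. rewrite rgamma_pos_arg by lra.
    assert (E := Gamma_reflection y ltac:(lra)). assert (0 < Gamma y) by (apply Gamma_pos; lra).
    rewrite <- E at 2. field. repeat split; apply Rgt_not_eq; auto. apply sin_gt_0; nra. apply Gamma_pos; lra.
  - rewrite S_INR in Hy. destruct (Rlt_or_le (- INR n) y) as [H1|H1]. apply IHn; lra.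
    assert (0 <= INR n) by apply pos_INR.
    rewrite rgamma_rec. destruct (Req_dec y 0) as [E|E].
    + subst. rewrite Rmult_0_r, sin_0. unfold Rdiv. ring.
    + rewrite IHn by lra. replace (1 - (y + 1)) with (- y) by ring.
      replace (1 - y) with (- y + 1) by ring. rewrite Gamma_succ by lra.
      replace (PI * (y + 1)) with (PI * y + PI) by ring. rewrite neg_sin. field. lra. }
intros Hx. destruct (INR_unbounded (- x)) as [n Hn]. apply (H n). lra.
Qed.

Lemma Gamma_ge_half_of_ge1 x : 1 <= x -> / 2 <= Gamma x.
Proof.
assert (H : forall n y, 1 <= y <= INR n + 2 -> / 2 <= Gamma y).
{ induction n; intros y Hy.
  - simpl in Hy. replace y with (1 + (y - 1)) by ring. apply Gamma_ge_half. lra.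
  - rewrite S_INR in Hy. destruct (Rle_or_lt y (INR n + 2)) as [H1|H1]. apply IHn; lra.
    assert (0 <= INR n) by apply pos_INR.
    assert (H2 := IHn (y - 1) ltac:(lra)).
    replace y with (y - 1 + 1) by ring. rewrite Gamma_succ by lra. nra. }
intros Hx. destruct (INR_unbounded x) as [n Hn]. apply (H n). lra.
Qed.

(** To the right of 1 the bound is 2, and each unit step to the left multiplies by [|x|]. This
    controls the Wright coefficients, whose arguments drift to minus infinity. *)
Lemma rgamma_bound m x : 1 - INR m <= x -> Rabs (rgamma x) <= 2 * INR (fact m).
Proof.
revert x. induction m; intros x Hx.
- simpl in *. rewrite rgamma_pos_arg by lra.
  assert (H := Gamma_ge_half_of_ge1 x ltac:(lra)).
  rewrite Rabs_right, Rmult_1_r. replace 2 with (/ / 2) by field. apply Rinv_le_contravar; lra.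
  apply Rle_ge. left. apply Rinv_0_lt_compat. lra.
- rewrite S_INR in Hx. assert (0 <= INR m) by apply pos_INR.
  assert (Hf : INR (fact (S m)) = (INR m + 1) * INR (fact m)) by (rewrite fact_simpl, mult_INR, S_INR; ring).
  assert (0 < INR (fact m)) by apply INR_fact_lt_0.
  destruct (Rlt_or_le x (1 - INR m)) as [H1|H1].
  + rewrite rgamma_rec, Rabs_mult, Hf.
    replace (2 * ((INR m + 1) * INR (fact m))) with ((INR m + 1) * (2 * INR (fact m))) by ring.
    destruct (Rle_or_lt x 1).
    * apply Rmult_le_compat; try apply Rabs_pos. apply Rabs_le; lra. apply IHm. lra.
    * exfalso. lra.
  + eapply Rle_trans. apply IHm; lra. rewrite Hf. nra.
Qed.

Lemma Gamma_fact_bound m x : 1 <= x <= INR m + 2 -> Gamma x <= INR (fact (m + 1)).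
Proof.
revert x. induction m; intros x Hx.
- simpl in *. assert (H := Gamma_add_le 1 (x - 1) ltac:(lra) ltac:(lra)).
  replace (1 + (x - 1)) with x in H by ring. rewrite Gamma_1, Rpower_1_l in H. lra.
- rewrite S_INR in Hx. assert (0 <= INR m) by apply pos_INR.
  assert (Hf : INR (fact (S m + 1)) = (INR m + 2) * INR (fact (m + 1))).
  { replace (S m + 1)%nat with (S (m + 1)) by lia. rewrite fact_simpl, mult_INR, S_INR, plus_INR. simpl. ring. }
  assert (0 < INR (fact (m + 1))) by apply INR_fact_lt_0.
  rewrite Hf.
  destruct (Rle_or_lt x (INR m + 2)) as [H1|H1].
  + apply Rle_trans with (INR (fact (m + 1))). apply IHm; lra. nra.
  + replace x with (x - 1 + 1) by ring. rewrite Gamma_succ by lra.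
    apply Rmult_le_compat; try lra. apply Gamma_nonneg; lra. apply IHm; lra.
Qed.

(** * The Wright function *)

Lemma fact_pow_le N k : (fact N * (N + 1) ^ k <= fact (N + k))%nat.
Proof.
induction k. simpl. rewrite Nat.add_0_r. lia.
replace (N + S k)%nat with (S (N + k)) by lia. rewrite fact_simpl, Nat.pow_succ_r'. nia.
Qed.

Lemma bounded_of_eventually (u : nat -> R) n0 M0 : (forall n, (n0 <= n)%nat -> u n <= M0) ->
  exists M, forall n, u n <= M.
Proof.
revert M0. induction n0; intros M0 H. exists M0. intros n. apply H. lia.
apply (IHn0 (Rmax M0 (u n0))). intros n Hn.
destruct (Nat.eq_dec n n0) as [->|E]. apply Rmax_r.
eapply Rle_trans. apply H. lia. apply Rmax_l.
Qed.

(** [n! / N!] is at least [(N + 1)^(n - N)], hence eventually at least [(n/2)^(d n / 2)], which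
    beats [x^n]. *)
Lemma fact_growth_aux (N : nat -> nat) d K x : 0 < d -> 1 <= x ->
  (forall n, INR (N n) <= (1 - d) * INR n + K) -> (forall n, INR n / 2 <= INR (N n) + 1) ->
  exists M, forall n, x ^ n * INR (fact (N n)) / INR (fact n) <= M.
Proof.
intros Hd Hx HN HN2.
(* Beyond [n0], half of [d n] absorbs [K], the base [n / 2] exceeds 1, and it exceeds [x^(2/d)],
   whose power [d n / 2] is [x^n]. *)
destruct (INR_unbounded (Rmax (2 * Rabs K / d) (Rmax 2 (2 * Rpower x (2 / d))))) as [n0 Hn0].
apply (bounded_of_eventually _ n0 1). intros n Hn. apply le_INR in Hn.
assert (H1 : 2 * Rabs K / d < INR n) by (eapply Rle_lt_trans; [apply Rmax_l|]; eapply Rlt_le_trans; eauto).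
assert (H2 : Rmax 2 (2 * Rpower x (2 / d)) < INR n) by (eapply Rle_lt_trans; [apply Rmax_r|]; eapply Rlt_le_trans; eauto).
assert (H3 : 2 < INR n) by (eapply Rle_lt_trans; [apply Rmax_l|exact H2]).
assert (H4 : 2 * Rpower x (2 / d) < INR n) by (eapply Rle_lt_trans; [apply Rmax_r|exact H2]).
apply Rlt_div_l in H1; auto.
assert (HK : K <= Rabs K) by apply Rle_abs.
specialize (HN n). specialize (HN2 n).
assert (HNn : INR (N n) <= INR n - d * INR n / 2) by nra.
assert (HNn' : (N n <= n)%nat). { apply INR_le. nra. }
assert (Hk : d * INR n / 2 <= INR (n - N n)) by (rewrite minus_INR by auto; lra).
assert (HF := fact_pow_le (N n) (n - N n)). replace (N n + (n - N n))%nat with n in HF by lia.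
apply le_INR in HF. rewrite mult_INR, pow_INR, plus_INR in HF. simpl (INR 1) in HF.
assert (F1 := INR_fact_lt_0 (N n)). assert (F2 := INR_fact_lt_0 n).
apply Rle_div_l; auto. rewrite Rmult_1_l.
apply Rle_trans with (INR (fact (N n)) * (INR (N n) + 1) ^ (n - N n)); auto.
rewrite Rmult_comm. apply Rmult_le_compat_l. lra.
apply Rle_trans with ((INR n / 2) ^ (n - N n)). 2: apply pow_incr; lra.
rewrite <- (Rpower_pow _ (INR n / 2)) by lra.
apply Rle_trans with (Rpower (INR n / 2) (d * INR n / 2)). 2: apply Rle_Rpower; lra.
replace (x ^ n) with (Rpower (Rpower x (2 / d)) (d * INR n / 2)).
apply Rle_Rpower_l. nra. split. apply Rpower_pos. lra.
rewrite Rpower_mult. replace (2 / d * (d * INR n / 2)) with (INR n) by (field; lra).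
apply Rpower_pow. lra.
Qed.

Lemma fact_growth (N : nat -> nat) th K x : th < 1 -> 0 <= x ->
  (forall n, INR (N n) <= th * INR n + K) ->
  exists M, forall n, x ^ n * INR (fact (N n)) / INR (fact n) <= M.
Proof.
intros Hth Hx HN.
(* The auxiliary lemma also wants [N] to be at least about [n / 2], so [N] is replaced by its
   maximum with [n / 2]; [d <= 1/2] keeps that within [(1 - d) n]. *)
set (d := Rmin (1 - th) (/ 2)).
assert (Hd : 0 < d) by (apply Rmin_pos; lra).
assert (Hd1 : d <= 1 - th) by apply Rmin_l. assert (Hd2 : d <= / 2) by apply Rmin_r.
destruct (fact_growth_aux (fun n => Nat.max (N n) (n / 2)) d (Rabs K) (Rmax 1 x)) as [M HM]; auto.
- apply Rmax_l.
- intros n. assert (0 <= INR n) by apply pos_INR.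
  destruct (Nat.max_spec (N n) (n / 2)) as [[_ ->]|[_ ->]].
  + assert (H0 : INR (n / 2) * 2 <= INR n).
    { change 2 with (INR 2). rewrite <- mult_INR. apply le_INR. generalize (Nat.div_mod n 2). lia. }
    generalize (Rabs_pos K). nra.
  + specialize (HN n). assert (K <= Rabs K) by apply Rle_abs. nra.
- intros n. assert (H0 : INR n <= (INR (Nat.max (N n) (n / 2)) + 1) * 2).
  { change 2 with (INR 2). rewrite <- S_INR, <- mult_INR. apply le_INR.
    generalize (Nat.div_mod n 2) (Nat.mod_upper_bound n 2). lia. }
  lra.
- exists M. intros n. eapply Rle_trans; [|apply (HM n)].
  assert (F2 := INR_fact_lt_0 n). unfold Rdiv. apply Rmult_le_compat_r. left; now apply Rinv_0_lt_compat.
  apply Rmult_le_compat. now apply pow_le. left; apply INR_fact_lt_0.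
  apply pow_incr. split; auto. apply Rmax_r. apply le_INR, fact_le. lia.
Qed.

Lemma lim_0_of_bounded_pow (u : nat -> R) Z : 0 < Z ->
  (exists M, forall n, u n * (2 * Z) ^ n <= M) -> (forall n, 0 <= u n) ->
  is_lim_seq (fun n => u n * Z ^ n) 0.
Proof.
intros HZ [M HM] Hu.
apply (is_lim_seq_le_le (fun _ => 0) _ (fun n => M * (/ 2) ^ n)).
- intros n. split. apply Rmult_le_pos; auto. apply pow_le; lra.
  apply Rmult_le_reg_r with (2 ^ n). apply pow_lt; lra.
  rewrite !Rmult_assoc, <- !Rpow_mult_distr, (Rmult_comm Z), Rinv_l, pow1, Rmult_1_r by lra. auto.
- apply is_lim_seq_const.
- replace (Finite 0) with (Rbar_mult M 0) by (simpl; f_equal; ring).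
  apply is_lim_seq_scal_l. apply is_lim_seq_geom. rewrite Rabs_right; lra.
Qed.

Lemma CV_radius_infinite (a : nat -> R) :
  (forall x, 0 <= x -> exists M, forall n, Rabs (a n) * x ^ n <= M) -> CV_radius a = p_infty.
Proof.
intros H. destruct (CV_radius_bounded a) as [H1 _].
assert (Hx : forall x, 0 <= x -> Rbar_le x (CV_radius a)).
{ intros x Hx. apply H1. destruct (H x Hx) as [M HM]. exists M. intros n.
  rewrite Rabs_mult, <- RPow_abs, (Rabs_right x) by lra. auto. }
destruct (CV_radius a) as [r| |]; auto.
- specialize (Hx (Rabs r + 1) ltac:(generalize (Rabs_pos r); lra)). simpl in Hx.
  generalize (Rle_abs r). lra.
- now specialize (Hx 0 (Rle_refl 0)).
Qed.

Definition wcoef (nu b : R) (n : nat) : R := rgamma (INR n * - nu + b) / INR (fact n).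

(** [W nu 1] is the temperature profile and [W nu (1 - nu)] the Mainardi function. With [b] ranging
    over all reals the family is closed under differentiation. *)
Definition W (nu b z : R) : R := Wright (- z) (- nu) b.

Lemma wcoef_bound nu b k n : 0 < nu < / 2 -> - INR k <= b ->
  Rabs (wcoef nu b n) <= 2 * INR (fact (n / 2 + (k + 2))) / INR (fact n).
Proof.
intros Hnu Hb. unfold wcoef. assert (F2 := INR_fact_lt_0 n).
rewrite Rabs_div, (Rabs_right (INR (fact n))) by lra.
unfold Rdiv at 1 2. apply Rmult_le_compat_r. left; now apply Rinv_0_lt_compat.
(* The offset 2 pays for the 1 in [rgamma_bound] and for the rounding in [n / 2]; [nu < 1/2] gives
   [nu n <= n/2]. *)
apply rgamma_bound. rewrite !plus_INR. simpl (INR 2).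
assert (H0 : INR n <= (INR (n / 2) + 1) * 2).
{ change 2 with (INR 2). rewrite <- S_INR, <- mult_INR. apply le_INR.
  generalize (Nat.div_mod n 2) (Nat.mod_upper_bound n 2). lia. }
assert (0 <= INR n) by apply pos_INR. nra.
Qed.

Lemma half_fact_growth k x : 0 <= x ->
  exists M, forall n, 2 * INR (fact (n / 2 + k)) / INR (fact n) * x ^ n <= M.
Proof.
intros Hx. destruct (fact_growth (fun n => (n / 2 + k)%nat) (/ 2) (INR k) x) as [M HM]; try lra.
- intros n. rewrite plus_INR.
  assert (H0 : INR (n / 2) * 2 <= INR n).
  { change 2 with (INR 2). rewrite <- mult_INR. apply le_INR. generalize (Nat.div_mod n 2). lia. }
  lra.
- exists (2 * M). intros n. specialize (HM n). unfold Rdiv in *. lra.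
Qed.

Lemma INR_ge_neg b : exists k, - INR k <= b.
Proof. destruct (INR_unbounded (- b)) as [k Hk]. exists k. lra. Qed.

Lemma wcoef_radius nu b : 0 < nu < / 2 -> CV_radius (wcoef nu b) = p_infty.
Proof.
intros Hnu. destruct (INR_ge_neg b) as [k Hk]. apply CV_radius_infinite. intros x Hx.
destruct (half_fact_growth (k + 2) x Hx) as [M HM]. exists M. intros n.
eapply Rle_trans; [|apply (HM n)]. apply Rmult_le_compat_r. now apply pow_le.
now apply wcoef_bound.
Qed.

Lemma W_PSeries nu b z : W nu b z = PSeries (wcoef nu b) (- z).
Proof.
unfold W, Wright, PSeries. apply Series_ext. intros n. unfold wcoef. unfold Rdiv. ring.
Qed.

Lemma is_derive_W nu b z : 0 < nu < / 2 -> is_derive (W nu b) z (- W nu (b - nu) z).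
Proof.
intros Hnu. apply (is_derive_ext (fun z => PSeries (wcoef nu b) (- z))).
{ intros t. now rewrite W_PSeries. }
eapply is_derive_eq. apply (d_comp (PSeries (wcoef nu b)) (fun z => - z)).
apply is_derive_PSeries. rewrite wcoef_radius; simpl; auto.
instantiate (1 := -1). auto_derive; auto.
rewrite W_PSeries. rewrite (PSeries_ext (PS_derive (wcoef nu b)) (wcoef nu (b - nu))). ring.
intros n. unfold PS_derive, wcoef. rewrite S_INR, fact_simpl, mult_INR, S_INR.
replace ((INR n + 1) * - nu + b) with (INR n * - nu + (b - nu)) by ring.
field. split. apply INR_fact_neq_0. generalize (pos_INR n); lra.
Qed.

(** Coefficientwise this is [1/Gamma x = x / Gamma (x + 1)] at [x = b - nu n]: the part [b] gives
    the first term, the part [- nu n] cancels a factor of [n!] and shifts the index. *)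
Lemma W_rec nu b z : 0 < nu < / 2 ->
  b * W nu (b + 1) z + nu * z * W nu (b + 1 - nu) z = W nu b z.
Proof.
intros Hnu. rewrite !W_PSeries.
assert (Hex : forall b x, ex_pseries (wcoef nu b) x).
{ intros b' x. apply CV_radius_inside. rewrite wcoef_radius; simpl; auto. }
replace (b * PSeries (wcoef nu (b + 1)) (- z) + nu * z * PSeries (wcoef nu (b + 1 - nu)) (- z)) with
  (b * PSeries (wcoef nu (b + 1)) (- z) + - nu * (- z * PSeries (wcoef nu (b + 1 - nu)) (- z))) by ring.
rewrite <- PSeries_incr_1, <- !PSeries_scal, <- PSeries_plus.
- apply PSeries_ext. intros n. unfold PS_plus, PS_scal, PS_incr_1, scal, plus; simpl; unfold mult; simpl.
  unfold wcoef. rewrite (rgamma_rec (INR n * - nu + b)).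
  destruct n.
  + simpl. replace (0 * - nu + (b + 1)) with (0 * - nu + b + 1) by ring. unfold zero; simpl. field.
  + rewrite S_INR, fact_simpl, mult_INR, S_INR.
    replace (INR n * - nu + (b + 1 - nu)) with ((INR n + 1) * - nu + b + 1) by ring.
    replace ((INR n + 1) * - nu + (b + 1)) with ((INR n + 1) * - nu + b + 1) by ring.
    field. split. apply INR_fact_neq_0. generalize (pos_INR n); lra.
- apply ex_pseries_scal; auto. apply Rmult_comm.
- apply ex_pseries_scal; auto. apply Rmult_comm. apply (ex_pseries_incr_1 (wcoef nu (b + 1 - nu))); auto.
Qed.

Lemma W_0 nu b : W nu b 0 = rgamma b.
Proof.
rewrite W_PSeries, Ropp_0, PSeries_0. unfold wcoef. simpl. rewrite Rmult_0_l, Rplus_0_l. field.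
Qed.

Lemma W_bound_le1 nu : 0 < nu < / 2 ->
  exists K, forall b z, 0 <= b -> 0 <= z <= 1 -> Rabs (W nu b z) <= K.
Proof.
intros Hnu. set (a := fun n => 2 * INR (fact (n / 2 + (0 + 2))) / INR (fact n)).
assert (Ha : forall n, 0 <= a n).
{ intros n. unfold a. assert (F2 := INR_fact_lt_0 n). apply Rdiv_le_0_compat; auto.
  generalize (INR_fact_lt_0 (n / 2 + (0 + 2))). lra. }
assert (Hr : CV_radius a = p_infty).
{ apply CV_radius_infinite. intros x Hx. destruct (half_fact_growth (0 + 2) x Hx) as [M HM].
  exists M. intros n. rewrite Rabs_right by (apply Rle_ge, Ha). apply HM. }
assert (Hs : ex_series (fun n => Rabs (a n * 1 ^ n))).
{ apply CV_disk_inside. rewrite Hr. simpl. auto. }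
exists (Series (fun n => Rabs (a n * 1 ^ n))). intros b z Hb Hz. rewrite W_PSeries. unfold PSeries.
assert (HH : forall n, 0 <= Rabs (wcoef nu b n * (- z) ^ n) <= Rabs (a n * 1 ^ n)).
{ intros n. split. apply Rabs_pos. rewrite !Rabs_mult. apply Rmult_le_compat; try apply Rabs_pos.
  - rewrite (Rabs_right (a n)) by (apply Rle_ge, Ha). apply (wcoef_bound nu b 0 n); auto. simpl. lra.
  - rewrite pow1, Rabs_R1, <- RPow_abs, Rabs_Ropp, (Rabs_right z) by lra.
    rewrite <- (pow1 n). apply pow_incr. lra. }
eapply Rle_trans. apply Series_Rabs. { apply (@ex_series_le R_AbsRing R_CompleteNormedModule (fun n => Rabs (wcoef nu b n * (- z) ^ n)) (fun n => Rabs (a n * 1 ^ n))); auto.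
  intros n. change (Rabs (Rabs (wcoef nu b n * (- z) ^ n)) <= Rabs (a n * 1 ^ n)).
  rewrite Rabs_Rabsolu. apply HH. }
apply Series_le; auto.
Qed.

(* [G nu b y] has Laplace transform [s^(-b) exp (- y s^nu)] in [t]. *)
Definition G (nu b y t : R) : R := Rpower t (b - 1) * W nu b (y * Rpower t (- nu)).

Lemma G_1 nu b y : G nu b y 1 = W nu b y.
Proof. unfold G. now rewrite !Rpower_1_l, Rmult_1_l, Rmult_1_r. Qed.

Lemma G_rec nu b y t : 0 < nu < / 2 -> 0 < t ->
  t * G nu b y t = b * G nu (b + 1) y t + nu * y * G nu (b + 1 - nu) y t.
Proof.
intros Hnu Ht. unfold G. rewrite <- (W_rec nu b) by auto.
rewrite <- Rmult_assoc, Rpower_mult_self by auto.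
replace (b + 1 - 1) with (b - 1 + 1) by ring.
replace (b + 1 - nu - 1) with (b - 1 + 1 + - nu) by ring. rewrite (Rpower_plus _ (- nu)). ring.
Qed.

Lemma is_derive_G_t nu b y t : 0 < nu < / 2 -> 0 < t ->
  is_derive (fun t => G nu (b + 1) y t) t (G nu b y t).
Proof.
intros Hnu Ht. unfold G. eapply is_derive_eq. apply d_mult. now apply is_derive_Rpower.
apply (d_comp (W nu (b + 1))). now apply is_derive_W. apply d_scal. now apply is_derive_Rpower.
cbv beta. rewrite <- (W_rec nu b) by auto.
replace (b + 1 - 1) with b by ring. replace (Rpower t b) with (t * Rpower t (b - 1)) by (rewrite Rpower_mult_self; [f_equal; ring|auto]).
replace (Rpower t (- nu)) with (t * Rpower t (- nu - 1)) by (rewrite Rpower_mult_self; [f_equal; ring|auto]).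
ring.
Qed.

Lemma is_derive_G_y nu b y t : 0 < nu < / 2 -> 
  is_derive (fun y => G nu b y t) y (- G nu (b - nu) y t).
Proof.
intros Hnu. unfold G. eapply is_derive_eq. apply d_scal.
apply (d_comp (W nu b) (fun y => y * Rpower t (- nu))). now apply is_derive_W.
instantiate (1 := Rpower t (- nu)). auto_derive; auto; ring.
cbv beta. replace (b - nu - 1) with (b - 1 + - nu) by ring. rewrite Rpower_plus. ring.
Qed.

(** * Taylor series from a chain of derivatives *)

Lemma nonneg_of_derive (f df : R -> R) Z : 
  (forall z, 0 < z <= Z -> is_derive f z (df z)) -> (forall z, 0 < z <= Z -> 0 <= df z) ->
  filterlim f (at_right 0) (locally 0) -> forall z, 0 < z <= Z -> 0 <= f z.
Proof.
intros Hd Hp Hl z Hz. destruct (Rle_or_lt 0 (f z)) as [H|H]; auto. exfalso.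
assert (HP : at_right 0 (fun x => f z < f x)).
{ apply (Hl (fun u => f z < u)). now apply (open_gt (f z)). }
destruct (filter_ex _ (filter_and _ _ HP (at_right_below z (proj1 Hz)))) as [x [H1 H2]].
destruct (MVT_gen f x z df) as [c [Hc Ec]].
- intros u Hu. rewrite Rmin_left, Rmax_right in Hu by lra. apply Hd; lra.
- intros u Hu. rewrite Rmin_left, Rmax_right in Hu by lra.
  apply continuity_pt_filterlim, (is_derive_continuous f u (df u)), Hd; lra.
- rewrite Rmin_left, Rmax_right in Hc by lra. assert (0 <= df c) by (apply Hp; lra). nra.
Qed.

Lemma growth_of_derive (f df : R -> R) Z C n :
  (forall z, 0 < z <= Z -> is_derive f z (df z)) ->
  (forall z, 0 < z <= Z -> Rabs (df z) <= C * z ^ n / INR (fact n)) ->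
  filterlim f (at_right 0) (locally 0) ->
  forall z, 0 < z <= Z -> Rabs (f z) <= C * z ^ (S n) / INR (fact (S n)).
Proof.
intros Hd Hb Hl z Hz.
assert (Hf : INR (fact (S n)) = (INR n + 1) * INR (fact n)) by (rewrite fact_simpl, mult_INR, S_INR; ring).
assert (0 < INR (fact n)) by apply INR_fact_lt_0. assert (0 <= INR n) by apply pos_INR.
assert (Hp : forall u, is_derive (fun z => C * z ^ S n / INR (fact (S n))) u (C * u ^ n / INR (fact n))).
{ intros u. evar_last. apply (is_derive_ext (fun z => C / INR (fact (S n)) * z ^ S n)). intros; unfold Rdiv; simpl; ring.
  apply d_scal. apply (is_derive_pow (fun z => z) (S n)). apply d_id.
  simpl Init.Nat.pred. rewrite Hf, S_INR. simpl. field. lra. }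
assert (Hl2 : filterlim (fun z => C * z ^ S n / INR (fact (S n))) (at_right 0) (locally 0)).
{ replace 0 with (C * 0 ^ S n / INR (fact (S n))) at 2 by (rewrite pow_i by lia; unfold Rdiv; ring).
  apply (lim_right_continuous (fun z => C * z ^ S n / INR (fact (S n)))). eapply is_derive_continuous, Hp. }
apply Rabs_le. split.
- cut (0 <= C * z ^ S n / INR (fact (S n)) + f z). lra.
  apply (nonneg_of_derive (fun z => C * z ^ S n / INR (fact (S n)) + f z) (fun z => C * z ^ n / INR (fact n) + df z) Z); auto.
  + intros u Hu. apply d_plus; auto.
  + intros u Hu. specialize (Hb u Hu). apply Rabs_le_between in Hb. lra.
  + replace 0 with (0 + 0) at 2 by ring. apply flim_plus; auto; apply _.
- cut (0 <= C * z ^ S n / INR (fact (S n)) - f z). lra.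
  apply (nonneg_of_derive (fun z => C * z ^ S n / INR (fact (S n)) - f z) (fun z => C * z ^ n / INR (fact n) - df z) Z); auto.
  + intros u Hu. apply d_minus; auto.
  + intros u Hu. specialize (Hb u Hu). apply Rabs_le_between in Hb. lra.
  + replace 0 with (0 - 0) at 2 by ring. apply flim_minus; auto; apply _.
Qed.

(** Taylor's theorem at 0 for functions controlled only on [(0, Z]], the coefficients being
    one-sided limits. Integrating the bound on [f (j + n)] [n] times gives a remainder
    [B (j + n) z^n / n!], so only the growth of [B] decides convergence. *)
Lemma taylor_series_of_chain (f : nat -> R -> R) (a B : nat -> R) Z : 0 < Z ->
  (forall n z, 0 < z <= Z -> is_derive (f n) z (- f (S n) z)) ->
  (forall n, filterlim (f n) (at_right 0) (locally (a n))) ->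
  (forall n z, 0 < z <= Z -> Rabs (f n z) <= B n) ->
  is_lim_seq (fun n => B n / INR (fact n) * Z ^ n) 0 ->
  is_series (fun n => a n * (- Z) ^ n / INR (fact n)) (f O Z).
Proof.
intros HZ Hd Ha HB Hlim.
(* The Taylor polynomial of [f j] with [n] terms, empty for [n = 0], so that [P] satisfies the same
   chain rule as [f] with one term fewer. *)
set (P := fun n j z => match n with O => 0 | S m => sum_f_R0 (fun k => a (j + k)%nat * (- z) ^ k / INR (fact k)) m end).
assert (HPd : forall n j z, is_derive (P (S n) j) z (- P n (S j) z)).
{ intros n j z. induction n.
  - unfold P. simpl. apply (is_derive_ext (fun _ => a (j + 0)%nat)).
    { intros t. change (a (j + 0)%nat = a (j + 0)%nat * 1 / 1). field. }
    eapply is_derive_eq. apply d_const. ring.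
  - change (P (S (S n)) j) with (fun z => P (S n) j z + a (j + S n)%nat * (- z) ^ S n / INR (fact (S n))).
    assert (E : P (S n) (S j) z = P n (S j) z + a (j + S n)%nat * (- z) ^ n / INR (fact n)).
    { unfold P. destruct n. simpl. rewrite Rplus_0_l. replace (S (j + 0)) with (j + 1)%nat by lia. reflexivity.
      rewrite tech5. replace (S j + S n)%nat with (j + S (S n))%nat by lia. reflexivity. }
    rewrite E. eapply is_derive_eq. apply d_plus. exact IHn.
    instantiate (1 := - (a (j + S n)%nat * (- z) ^ n / INR (fact n))).
    evar_last. apply (is_derive_ext (fun z => a (j + S n)%nat / INR (fact (S n)) * (- z) ^ S n)). intros; unfold Rdiv; simpl; ring.
    apply d_scal. apply (is_derive_pow (fun z => - z) (S n) z (-1)). auto_derive; auto.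
    simpl Init.Nat.pred. rewrite fact_simpl, mult_INR, S_INR. simpl. field.
    split. apply INR_fact_neq_0. generalize (pos_INR n); lra. ring. }
assert (HP0 : forall n j, P (S n) j 0 = a j).
{ intros n j. unfold P. induction n. simpl. rewrite Nat.add_0_r. field.
  rewrite tech5, IHn. rewrite Ropp_0, pow_i by lia. unfold Rdiv. ring. }
assert (HR : forall n j z, 0 < z <= Z -> Rabs (f j z - P n j z) <= B (j + n)%nat * z ^ n / INR (fact n)).
{ induction n; intros j z Hz.
  - simpl. rewrite Rminus_0_r, Nat.add_0_r. replace (B j * 1 / 1) with (B j) by field. auto.
  - apply (growth_of_derive (fun z => f j z - P (S n) j z) (fun z => - (f (S j) z - P n (S j) z)) Z (B (j + S n)%nat)); auto.
    + intros u Hu. eapply is_derive_eq. apply d_minus; [now apply Hd|apply HPd]. ring.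
    + intros u Hu. rewrite Rabs_Ropp. replace (j + S n)%nat with (S j + n)%nat by lia. auto.
    + replace 0 with (a j - a j) at 2 by ring. apply flim_minus; [apply _|auto|].
      replace (locally (a j)) with (locally (P (S n) j 0)) by now rewrite HP0. apply (lim_right_continuous (P (S n) j)). eapply is_derive_continuous, HPd. }
assert (HS : is_lim_seq (fun n => sum_n (fun k => a k * (- Z) ^ k / INR (fact k)) n) (f O Z)).
{ apply is_lim_seq_spec. intros eps. apply is_lim_seq_spec in Hlim. destruct (Hlim eps) as [N HN].
  exists N. intros n Hn. rewrite sum_n_Reals. change (sum_f_R0 _ n) with (P (S n) O Z).
  rewrite Rabs_minus_sym. eapply Rle_lt_trans. apply HR; lra.
  specialize (HN (S n) ltac:(lia)). rewrite Rminus_0_r in HN.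
  eapply Rle_lt_trans; [|exact HN]. rewrite Nat.add_0_l.
  eapply Rle_trans; [|apply Rle_abs]. right. unfold Rdiv. ring. }
exact HS.
Qed.

(** * Integral representation *)

Definition env (nu b y t r : R) : R :=
  Rpower r (- b) * exp (- (r * t) - y * cos (PI * nu) * Rpower r nu).

(* Up to a constant factor, the jump of [s^(-b) exp (s t - y s^nu)] across the negative axis at [s = - r]. *)
Definition K (nu b y t r : R) : R :=
  env nu b y t r * sin (PI * b + y * sin (PI * nu) * Rpower r nu).

Definition Kint (nu b y t : R) : R := RInt_gen (K nu b y t) (at_right 0) (Rbar_locally p_infty).

Lemma env_pos nu b y t r : 0 < env nu b y t r.
Proof. apply Rmult_lt_0_compat; apply exp_pos. Qed.

Lemma c_env nu b y t r : 0 < r -> continuous (env nu b y t) r.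
Proof.
intros Hr. unfold env. apply c_mult. now apply continuous_Rpower.
apply c_exp, c_minus. apply (ex_derive_continuous (fun r => - (r * t))). auto_derive; auto.
apply c_scal. now apply continuous_Rpower.
Qed.

Lemma c_K nu b y t r : 0 < r -> continuous (K nu b y t) r.
Proof.
intros Hr. unfold K. apply c_mult. now apply c_env.
apply c_sin, c_plus. apply c_const. apply c_scal. now apply continuous_Rpower.
Qed.

Lemma cos_sin_pos nu : 0 < nu < / 2 -> 0 < cos (PI * nu) <= 1 /\ 0 < sin (PI * nu) <= 1.
Proof.
intros H. assert (HP := PI_RGT_0). split; split.
- apply cos_gt_0; nra. - apply COS_bound. - apply sin_gt_0; nra. - apply SIN_bound.
Qed.

Lemma env_le nu b y t y' t' r : 0 < nu < / 2 -> 0 < r -> y' <= y -> t' <= t ->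
  env nu b y t r <= env nu b y' t' r.
Proof.
intros Hnu Hr Hy Ht. unfold env. apply Rmult_le_compat_l. left; apply Rpower_pos.
apply exp_le. destruct (cos_sin_pos nu Hnu) as [[H1 _] _]. generalize (Rpower_pos r nu); intros Hp.
assert (r * t' <= r * t) by (apply Rmult_le_compat_l; lra).
assert (y' * (cos (PI * nu) * Rpower r nu) <= y * (cos (PI * nu) * Rpower r nu)).
{ apply Rmult_le_compat_r; auto. left. now apply Rmult_lt_0_compat. }
lra.
Qed.

(** Decay at infinity has two independent sources, [exp (- r t)] and, since [cos (PI nu) > 0], the
    factor with [y r^nu]. The second one alone allows [t = 0]. *)
Lemma ex_int_env nu b y t C f : 0 < nu < / 2 -> b < 1 -> 0 <= y -> 0 <= t -> 0 < y \/ 0 < t ->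
  (forall r, 0 < r -> continuous f r) ->
  (forall r, 0 < r -> Rabs (f r) <= C * env nu b y t r) ->
  exists l, is_int p_infty f l.
Proof.
intros Hnu Hb Hy Ht Hyt Hf H. destruct (cos_sin_pos nu Hnu) as [[H1 _] _].
assert (H' : forall r, 0 < r -> Rabs (f r) <= Rabs C * env nu b y t r).
{ intros r Hr. eapply Rle_trans. now apply H. apply Rmult_le_compat_r. left; apply env_pos. apply Rle_abs. }
destruct Hyt as [Hy0|Ht0].
- apply (ex_int_exp (1 - b) (y * cos (PI * nu)) nu (Rabs C)); auto; try lra. now apply Rmult_lt_0_compat.
  intros r Hr. eapply Rle_trans. now apply H'. apply Rmult_le_compat_l. apply Rabs_pos.
  eapply Rle_trans. apply (env_le nu b y t y 0); auto; lra.
  unfold env. replace (1 - b - 1) with (- b) by ring. right. f_equal. f_equal. ring.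
- apply (ex_int_exp (1 - b) t 1 (Rabs C)); auto; try lra.
  intros r Hr. eapply Rle_trans. now apply H'. apply Rmult_le_compat_l. apply Rabs_pos.
  eapply Rle_trans. apply (env_le nu b y t 0 t); auto; lra.
  unfold env. replace (1 - b - 1) with (- b) by ring. rewrite Rpower_1 by auto. right. f_equal. f_equal. ring.
Qed.

Definition Nint (nu b y t : R) : R := RInt_gen (env nu b y t) (at_right 0) (Rbar_locally p_infty).

Lemma is_int_Nint nu b y t : 0 < nu < / 2 -> b < 1 -> 0 <= y -> 0 <= t -> 0 < y \/ 0 < t ->
  is_int p_infty (env nu b y t) (Nint nu b y t).
Proof.
intros Hnu Hb Hy Ht Hyt.
destruct (ex_int_env nu b y t 1 (env nu b y t)) as [l Hl]; auto.
- intros; now apply c_env.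
- intros r Hr. rewrite Rabs_right by (left; apply env_pos). lra.
- unfold Nint. erewrite is_RInt_gen_unique; [|exact Hl]. exact Hl.
Qed.

Lemma K_Rabs_le nu b y t r : Rabs (K nu b y t r) <= env nu b y t r.
Proof.
unfold K. rewrite Rabs_mult, (Rabs_right (env _ _ _ _ _)) by (left; apply env_pos).
assert (Rabs (sin (PI * b + y * sin (PI * nu) * Rpower r nu)) <= 1) by apply Rabs_le, SIN_bound.
generalize (env_pos nu b y t r). nra.
Qed.

(** At [b = 1] the factor [1/r] is not integrable at 0, but there the phase starts at [PI], and the
    sine gains a factor [y r^nu]. *)
Lemma K_1_Rabs_le nu y t r : 0 < nu < / 2 -> 0 <= y -> Rabs (K nu 1 y t r) <= y * env nu (1 - nu) y t r.
Proof.
intros Hnu Hy. unfold K. rewrite Rabs_mult, (Rabs_right (env _ _ _ _ _)) by (left; apply env_pos).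
rewrite Rmult_1_r, Rplus_comm, neg_sin, Rabs_Ropp.
destruct (cos_sin_pos nu Hnu) as [_ [H1 H2]]. generalize (Rpower_pos r nu); intros Hp.
assert (HS : Rabs (sin (y * sin (PI * nu) * Rpower r nu)) <= y * Rpower r nu).
{ eapply Rle_trans. apply Rabs_sin_le. rewrite Rabs_right.
  2:{ apply Rle_ge. repeat apply Rmult_le_pos; lra. }
  apply Rmult_le_compat_r; [lra|]. nra. }
replace (env nu (1 - nu) y t r) with (env nu 1 y t r * Rpower r nu).
2:{ unfold env. replace (- (1 - nu)) with (- (1) + nu) by ring. rewrite Rpower_plus. ring. }
generalize (env_pos nu 1 y t r). nra.
Qed.

Lemma is_int_Kint nu b y t : 0 < nu < / 2 -> b <= 1 -> 0 <= y -> 0 <= t -> 0 < y \/ 0 < t ->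
  is_int p_infty (K nu b y t) (Kint nu b y t).
Proof.
intros Hnu Hb Hy Ht Hyt.
assert (HH : exists l, is_int p_infty (K nu b y t) l).
{ destruct Hb as [Hb|Hb].
  - apply (ex_int_env nu b y t 1); auto. intros; now apply c_K.
    intros r Hr. rewrite Rmult_1_l. apply K_Rabs_le.
  - subst. apply (ex_int_env nu (1 - nu) y t y); auto. lra. intros; now apply c_K.
    intros r Hr. now apply K_1_Rabs_le. }
destruct HH as [l Hl].
unfold Kint. erewrite is_RInt_gen_unique; [|exact Hl]. exact Hl.
Qed.

Lemma is_derive_K_y nu b y t r : is_derive (fun y => K nu b y t r) y (- K nu (b - nu) y t r).
Proof.
unfold K, env. auto_derive. auto.
replace (- (b - nu)) with (- b + nu) by ring. rewrite Rpower_plus.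
replace (PI * (b - nu) + y * sin (PI * nu) * Rpower r nu) with
  ((PI * b + y * sin (PI * nu) * Rpower r nu) - PI * nu) by ring.
rewrite (sin_minus (PI * b + y * sin (PI * nu) * Rpower r nu)).
replace (- (r * t) + - (y * cos (PI * nu) * Rpower r nu)) with (- (r * t) - y * cos (PI * nu) * Rpower r nu) by ring.
ring.
Qed.

Lemma is_derive_Kint nu b y t : 0 < nu < / 2 -> b <= 1 -> 0 < y -> 0 <= t ->
  is_derive (fun y => Kint nu b y t) y (- Kint nu (b - nu) y t).
Proof.
intros Hnu Hb Hy Ht.
apply (is_derive_int p_infty (fun y r => K nu b y t r) (fun y r => - K nu (b - nu) y t r)
   (fun y r => - - K nu (b - nu - nu) y t r) _ _ _ (y / 2) (env nu (b - nu - nu) (y / 2) t) (Nint nu (b - nu - nu) (y / 2) t)).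
- easy.
- lra.
- intros u Hu. apply Rabs_lt_between in Hu. apply is_int_Kint; lra.
- apply (is_int_ext p_infty (fun r => -1 * K nu (b - nu) y t r)). easy. intros; ring.
  replace (- Kint nu (b - nu) y t) with (-1 * Kint nu (b - nu) y t) by ring.
  apply is_int_scal, is_int_Kint; lra.
- intros u r _ _. apply is_derive_K_y.
- intros u r _ _. apply (is_derive_opp (fun v => K nu (b - nu) v t r)). apply is_derive_K_y.
- intros u r Hu [Hr _]. apply Rabs_lt_between in Hu. rewrite Ropp_involutive.
  eapply Rle_trans. apply K_Rabs_le. apply env_le; lra.
- apply is_int_Nint; lra.
Qed.

Lemma Nint_0 nu b t : 0 < nu < / 2 -> b < 1 -> 0 < t -> Nint nu b 0 t = Rpower t (b - 1) * Gamma (1 - b).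
Proof.
intros Hnu Hb Ht.
assert (H1 := is_int_Nint nu b 0 t Hnu Hb (Rle_refl 0) (Rlt_le _ _ Ht) (or_intror Ht)).
assert (Hi : 0 < / t) by now apply Rinv_0_lt_compat.
assert (H2 := is_int_comp_scal p_infty (/ t) _ _ Hi I (is_int_Gamma (1 - b) ltac:(lra))).
apply (is_int_scal _ _ (Rpower t (b - 1))) in H2.
apply (is_int_unique _ _ _ _ H1).
revert H2. apply is_int_ext. easy. intros r [Hr _].
unfold env. rewrite Rinv_inv. rewrite <- Rpower_mult_distr by auto.
replace (1 - b - 1) with (- b) by ring. rewrite Rmult_0_l, Rmult_0_l, Rminus_0_r, (Rmult_comm t r).
replace (Rpower t (b - 1) * (t * (Rpower t (- b) * Rpower r (- b) * exp (- (r * t))))) with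
 (t * (Rpower t (b - 1) * Rpower t (- b)) * (Rpower r (- b) * exp (- (r * t)))) by ring.
rewrite <- Rpower_plus. rewrite Rpower_mult_self by auto.
replace (b - 1 + - b + 1) with 0 by ring. rewrite Rpower_O by auto. ring.
Qed.

(** At [y = 0] the sine is the constant [sin (PI b)] and the rest integrates to [Gamma (1 - b)];
    reflection turns the product into [1/Gamma b]. *)
Lemma Kint_0 nu b t : 0 < nu < / 2 -> b < 1 -> 0 < t ->
  Kint nu b 0 t = PI * (Rpower t (b - 1) * rgamma b).
Proof.
intros Hnu Hb Ht. rewrite rgamma_reflection by auto.
replace (PI * (Rpower t (b - 1) * (Gamma (1 - b) * sin (PI * b) / PI))) with
  (sin (PI * b) * (Rpower t (b - 1) * Gamma (1 - b))) by (field; apply PI_neq0).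
rewrite <- (Nint_0 nu) by auto.
apply (is_int_unique p_infty (K nu b 0 t)). apply is_int_Kint; lra.
apply (is_int_ext p_infty (fun r => sin (PI * b) * env nu b 0 t r)). easy.
- intros r _. unfold K. rewrite Rmult_0_l, Rmult_0_l, Rplus_0_r. ring.
- apply is_int_scal, is_int_Nint; lra.
Qed.

Lemma Kint_Rabs_le nu b y t : 0 < nu < / 2 -> b < 1 -> 0 <= y -> 0 <= t -> 0 < y \/ 0 < t ->
  Rabs (Kint nu b y t) <= Nint nu b y t.
Proof.
intros Hnu Hb Hy Ht Hyt. apply (is_int_Rabs p_infty (K nu b y t) (env nu b y t)). easy.
intros r _. apply K_Rabs_le. apply is_int_Kint; auto; lra. now apply is_int_Nint.
Qed.

Lemma Nint_le nu b y t y' t' : 0 < nu < / 2 -> b < 1 -> 0 <= y' <= y -> 0 <= t' <= t -> 0 < y' \/ 0 < t' ->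
  Nint nu b y t <= Nint nu b y' t'.
Proof.
intros Hnu Hb Hy Ht Hyt. apply (is_int_le p_infty (env nu b y t) (env nu b y' t')). easy.
intros r [Hr _]. apply env_le; lra. apply is_int_Nint; auto; lra. apply is_int_Nint; auto; lra.
Qed.

Lemma Kint_lim_y nu b t : 0 < nu < / 2 -> b < 1 -> 0 < t ->
  filterlim (fun y => Kint nu b y t) (at_right 0) (locally (Kint nu b 0 t)).
Proof.
intros Hnu Hb Ht.
apply flim_squeeze with (fun y => y * Nint nu (b - nu) 0 t); [apply _| |].
- generalize (at_right_below 1 Rlt_0_1). apply filter_imp. intros y Hy.
  apply (is_int_Rabs p_infty (fun r => K nu b y t r - K nu b 0 t r) (fun r => y * env nu (b - nu) 0 t r)). easy.
  + intros r [Hr _]. destruct (MVT_gen (fun y => K nu b y t r) 0 y (fun y => - K nu (b - nu) y t r)) as [z [Hz Ez]].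
    * intros u _. apply is_derive_K_y.
    * intros u _. apply continuity_pt_filterlim.
      apply (is_derive_continuous (fun y => K nu b y t r) u (- K nu (b - nu) u t r)), is_derive_K_y.
    * rewrite Ez, Rmult_comm, Rabs_mult, Rabs_Ropp, Rminus_0_r, (Rabs_right y) by lra.
      rewrite Rmin_left, Rmax_right in Hz by lra.
      apply Rmult_le_compat_l. lra. eapply Rle_trans. apply K_Rabs_le. apply env_le; lra.
  + apply is_int_minus; apply is_int_Kint; lra.
  + apply is_int_scal, is_int_Nint; lra.
- replace 0 with (0 * Nint nu (b - nu) 0 t) at 2 by ring.
  apply (lim_right_continuous (fun y => y * Nint nu (b - nu) 0 t)).
  apply (ex_derive_continuous (fun y => y * Nint nu (b - nu) 0 t)). auto_derive; auto.
Qed.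

(** Differentiation in [y] only lowers [b], so [b < 1] keeps every integral of the chain convergent
    at [r = 0]. The remainders are bounded by [Nint] at [y = 0], that is by [Gamma (1 - b + nu n)],
    which [nu < 1/2] keeps of order [(n/2)!]. *)
Lemma G_eq_Kint nu b y t : 0 < nu < / 2 -> b < 1 -> 0 < y -> 0 < t -> G nu b y t = Kint nu b y t / PI.
Proof.
intros Hnu Hb Hy Ht. assert (HP := PI_RGT_0).
assert (Hbn : forall n, b - nu * INR n <= b). { intros n. generalize (pos_INR n). nra. }
assert (HS := taylor_series_of_chain
  (fun n z => / PI * Kint nu (b - nu * INR n) z t)
  (fun n => Rpower t (b - nu * INR n - 1) * rgamma (b - nu * INR n))
  (fun n => / PI * Nint nu (b - nu * INR n) 0 t) y Hy).
cbv beta in HS.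
assert (HS' : is_series (fun n => Rpower t (b - nu * INR n - 1) * rgamma (b - nu * INR n) * (- y) ^ n / INR (fact n))
   (/ PI * Kint nu (b - nu * INR 0) y t)).
{ apply HS; clear HS.
  - intros n z Hz. eapply is_derive_eq. apply (d_scal (fun z => Kint nu (b - nu * INR n) z t)).
    apply is_derive_Kint; auto; try lra. specialize (Hbn n); lra.
    rewrite S_INR. replace (b - nu * INR n - nu) with (b - nu * (INR n + 1)) by ring. ring.
  - intros n. specialize (Hbn n).
    replace (Rpower t (b - nu * INR n - 1) * rgamma (b - nu * INR n)) with (/ PI * Kint nu (b - nu * INR n) 0 t).
    apply flim_scal; [apply _|]. apply Kint_lim_y; auto; lra.
    rewrite Kint_0 by (auto; lra). field. lra.
  - intros n z Hz. specialize (Hbn n). rewrite Rabs_mult, (Rabs_right (/ PI)) by (left; now apply Rinv_0_lt_compat).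
    apply Rmult_le_compat_l. left; now apply Rinv_0_lt_compat.
    eapply Rle_trans. apply Kint_Rabs_le; auto; lra. apply Nint_le; auto; lra.
  - apply lim_0_of_bounded_pow; auto.
    + destruct (INR_ge_neg (b - 3)) as [k Hk].
      set (X := 2 * y * Rpower t (- nu)).
      assert (HX : 0 <= X). { unfold X. apply Rmult_le_pos. lra. left; apply Rpower_pos. }
      destruct (half_fact_growth (k + 1) X HX) as [M HM].
      set (D := / PI * (Rpower t (b - 1) / (1 - b))).
      assert (HD : 0 <= D).
      { apply Rmult_le_pos. left; now apply Rinv_0_lt_compat. left. apply Rdiv_lt_0_compat. apply Rpower_pos. lra. }
      exists (D * M). intros n. specialize (HM n). specialize (Hbn n).
      assert (F := INR_fact_lt_0 n). assert (F2 := INR_fact_lt_0 (n / 2 + (k + 1))).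
      apply Rle_trans with (D * (2 * INR (fact (n / 2 + (k + 1))) / INR (fact n) * X ^ n)).
      2: apply Rmult_le_compat_l; auto.
      rewrite Nint_0 by lra. unfold X. rewrite (Rpow_mult_distr (2 * y) (Rpower t (- nu))).
      rewrite <- (Rpower_pow n (Rpower t (- nu))), Rpower_mult by apply Rpower_pos.
      replace (b - nu * INR n - 1) with (b - 1 + - nu * INR n) by ring. rewrite Rpower_plus.
      (* The argument may lie in [(0, 1)], out of reach of [Gamma_fact_bound]; raising it by one
         costs the factor [1 / (1 - b)]. *)
      assert (HG : Gamma (1 - (b - nu * INR n)) <= INR (fact (n / 2 + (k + 1))) / (1 - b)).
      { apply Rle_div_r. lra.
        apply Rle_trans with (Gamma (1 - (b - nu * INR n) + 1)).
        - rewrite Gamma_succ by lra. rewrite Rmult_comm. apply Rmult_le_compat_r. apply Gamma_nonneg; lra. lra.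
        - replace (n / 2 + (k + 1))%nat with (n / 2 + k + 1)%nat by lia. apply Gamma_fact_bound. split. lra.
          rewrite plus_INR.
          assert (H0 : INR n <= (INR (n / 2) + 1) * 2).
          { change 2 with (INR 2). rewrite <- S_INR, <- mult_INR. apply le_INR.
            generalize (Nat.div_mod n 2) (Nat.mod_upper_bound n 2). lia. }
          assert (0 <= INR n) by apply pos_INR. nra. }
      set (g := Gamma (1 - (b - nu * INR n))) in *. set (f := INR (fact (n / 2 + (k + 1)))) in *.
      generalize (Rpower_pos t (b - 1)) (Rpower_pos t (- nu * INR n)). unfold D.
      set (p := Rpower t (b - 1)). set (q := Rpower t (- nu * INR n)). intros Hp Hq.
      assert (H2y : 0 <= (2 * y) ^ n) by (apply pow_le; lra).
      replace (/ PI * (p * q * g) / INR (fact n) * (2 * y) ^ n) with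
        ((/ PI * p * q * / INR (fact n) * (2 * y) ^ n) * g) by (field; lra).
      replace (/ PI * (p / (1 - b)) * (2 * f / INR (fact n) * ((2 * y) ^ n * q))) with
        ((/ PI * p * q * / INR (fact n) * (2 * y) ^ n) * (2 * (f / (1 - b)))) by (field; lra).
      apply Rmult_le_compat_l.
      { repeat apply Rmult_le_pos; auto; try lra; left; now apply Rinv_0_lt_compat. }
      assert (0 <= f / (1 - b)). { left. apply Rdiv_lt_0_compat; lra. } lra.
    + intros n. specialize (Hbn n). apply Rdiv_le_0_compat. 2: apply INR_fact_lt_0.
      apply Rmult_le_pos. left; now apply Rinv_0_lt_compat.
      apply (is_int_nonneg p_infty (env nu (b - nu * INR n) 0 t)). easy. intros; left; apply env_pos.
      apply is_int_Nint; lra. }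
simpl (INR 0) in HS'. rewrite Rmult_0_r, Rminus_0_r in HS'.
unfold Rdiv. rewrite (Rmult_comm (Kint _ _ _ _)), <- (is_series_unique _ _ HS').
unfold G. rewrite W_PSeries. unfold PSeries. rewrite <- Series_scal_l. apply Series_ext. intros n.
unfold wcoef. replace (- (y * Rpower t (- nu))) with (- y * Rpower t (- nu)) by ring.
rewrite (Rpow_mult_distr (- y) (Rpower t (- nu))), <- (Rpower_pow n (Rpower t (- nu))), Rpower_mult by apply Rpower_pos.
replace (b - nu * INR n - 1) with (b - 1 + - nu * INR n) by ring. rewrite Rpower_plus.
replace (INR n * - nu + b) with (b - nu * INR n) by ring. unfold Rdiv. ring.
Qed.

(** The 1 is the contribution of the small circle around the origin, which survives at [b = 1]. Both
    sides have the same [y]-derivative, by the case [1 - nu], and the same limit 1 at [y = 0]. *)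
Lemma G_1_eq_Kint nu y t : 0 < nu < / 2 -> 0 < y -> 0 < t -> G nu 1 y t = 1 + Kint nu 1 y t / PI.
Proof.
intros Hnu Hy Ht. assert (HP := PI_RGT_0).
assert (HI : 0 < / PI) by now apply Rinv_0_lt_compat.
assert (H := growth_of_derive (fun y => G nu 1 y t - (1 + / PI * Kint nu 1 y t)) (fun _ => 0) y 0 0).
cbv beta in H.
assert (Rabs (G nu 1 y t - (1 + / PI * Kint nu 1 y t)) <= 0 * y ^ 1 / INR (fact 1)).
{ apply H; clear H; try lra.
  - intros z Hz. eapply is_derive_eq. apply d_minus. now apply is_derive_G_y.
    apply d_plus. apply d_const. apply d_scal. apply is_derive_Kint; lra.
    rewrite G_eq_Kint by lra. unfold Rdiv. ring.
  - intros z Hz. rewrite Rabs_R0. simpl. lra.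
  - replace 0 with (1 - (1 + / PI * 0)) at 2 by ring. apply flim_minus; [apply _| |].
    + replace (locally 1) with (locally (G nu 1 0 t)).
      apply (lim_right_continuous (fun y => G nu 1 y t)).
      apply (is_derive_continuous (fun y => G nu 1 y t) 0 (- G nu (1 - nu) 0 t)). now apply is_derive_G_y.
      f_equal. unfold G. rewrite Rmult_0_l, W_0, rgamma_1. replace (1 - 1) with 0 by ring. rewrite Rpower_O by auto. ring.
    + apply flim_plus; [apply _| |]. apply flim_const, _. apply flim_scal; [apply _|].
      apply flim_squeeze with (fun y => y * Nint nu (1 - nu) 0 t); [apply _| |].
      * generalize (at_right_below 1 Rlt_0_1). apply filter_imp. intros z Hz. rewrite Rminus_0_r.
        apply (is_int_Rabs p_infty (K nu 1 z t) (fun r => z * env nu (1 - nu) 0 t r)). easy.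
        intros r [Hr _]. eapply Rle_trans. apply K_1_Rabs_le; lra. apply Rmult_le_compat_l. lra. apply env_le; lra.
        apply is_int_Kint; lra. apply is_int_scal, is_int_Nint; lra.
      * replace 0 with (0 * Nint nu (1 - nu) 0 t) at 2 by ring.
        apply (lim_right_continuous (fun y => y * Nint nu (1 - nu) 0 t)).
        apply (ex_derive_continuous (fun y => y * Nint nu (1 - nu) 0 t)). auto_derive; auto. }
unfold Rdiv in H0. rewrite Rmult_0_l, Rmult_0_l in H0. unfold Rdiv. rewrite (Rmult_comm (Kint _ _ _ _)).
assert (H1 := Rabs_pos (G nu 1 y t - (1 + / PI * Kint nu 1 y t))).
assert (H2 : G nu 1 y t - (1 + / PI * Kint nu 1 y t) = 0).
{ apply Rabs_eq_0. lra. }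
lra.
Qed.

(** * Decay at small times *)

(* At [th = PI nu] this is [- K nu b y 0]; rotating the ray of integration down to [th = 0] makes it vanish. *)
Definition rot (nu b y th r : R) : R :=
  Rpower r (- b) * exp (- (y * Rpower r nu * cos th)) * sin (y * Rpower r nu * sin th - (1 - b) / nu * th).

(** Here [th] is the angle of [s^nu] up to sign, so the ray itself has angle [th / nu]; [s^(-b) ds]
    then carries the phase [p th] with [p = (1 - b) / nu]. *)
Definition rot1 (nu b y th r : R) : R :=
  let w := y * Rpower r nu in let p := (1 - b) / nu in let A := w * sin th - p * th in
  Rpower r (- b) * exp (- (w * cos th)) * (w * cos (A - th) - p * cos A).

Definition rot2 (nu b y th r : R) : R :=
  let w := y * Rpower r nu in let p := (1 - b) / nu in let A := w * sin th - p * th in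
  Rpower r (- b) * exp (- (w * cos th)) *
   (- w ^ 2 * sin (A - th - th) + (2 * p + 1) * w * sin (A - th) - p ^ 2 * sin A).

Lemma is_derive_rot nu b y th r : nu <> 0 -> is_derive (fun th => rot nu b y th r) th (rot1 nu b y th r).
Proof.
intros Hnu. unfold rot, rot1. set (w := y * Rpower r nu). set (p := (1 - b) / nu).
auto_derive. auto. rewrite cos_minus.
replace (w * sin th + - (p * th)) with (w * sin th - p * th) by ring. ring.
Qed.

Lemma is_derive_rot1 nu b y th r : nu <> 0 -> is_derive (fun th => rot1 nu b y th r) th (rot2 nu b y th r).
Proof.
intros Hnu. unfold rot1, rot2. set (w := y * Rpower r nu). set (p := (1 - b) / nu).
auto_derive. auto.
replace (w * sin th + - (p * th) + - th) with (w * sin th - p * th - th) by ring.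
replace (w * sin th + - (p * th)) with (w * sin th - p * th) by ring.
set (A := w * sin th - p * th).
rewrite (sin_minus (A - th) th). rewrite !(sin_minus A th), !(cos_minus A th).
assert (Hs : sin th * sin th = 1 - cos th * cos th).
{ generalize (sin2_cos2 th). unfold Rsqr. lra. }
set (sa := sin A). set (ca := cos A). set (s := sin th) in *. set (c := cos th) in *.
ring_simplify. 
replace (s ^ 2) with (1 - c * c) by (rewrite <- Hs; ring).
ring.
Qed.

Lemma Rabs_mult_sin_le k x : Rabs (k * sin x) <= Rabs k.
Proof.
rewrite Rabs_mult. assert (Rabs (sin x) <= 1) by apply Rabs_le, SIN_bound.
generalize (Rabs_pos k). nra.
Qed.

Lemma Rabs_mult_cos_le k x : Rabs (k * cos x) <= Rabs k.
Proof.
rewrite Rabs_mult. assert (Rabs (cos x) <= 1) by apply Rabs_le, COS_bound.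
generalize (Rabs_pos k). nra.
Qed.

Lemma Rpower_self_inv r nu : Rpower r (- (1)) * Rpower r nu = Rpower r (nu - 1).
Proof. rewrite <- Rpower_plus. f_equal. ring. Qed.

Lemma exp_cos_le w th c1 : 0 <= w -> c1 <= cos th -> exp (- (w * cos th)) <= exp (- (w * c1)).
Proof. intros Hw Hc. apply exp_le. nra. Qed.

(** Two angular derivatives bring out at most a quadratic in [w = y r^nu]; half of the exponential
    rate absorbs it. For [b < 1] the exponent is [a = 1 - b]. For [b = 1] one has [p = 0], every
    term keeps a factor [w], and this gives [a = nu]. *)
Lemma rot_bound nu b y c1 : 0 < nu -> b <= 1 -> 0 < y -> 0 < c1 ->
  exists a C, 0 < a /\ forall th r, 0 < r -> c1 <= cos th ->
   Rabs (rot nu b y th r) <= C * (Rpower r (a - 1) * exp (- (y * (c1 / 2) * Rpower r nu))) /\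
   Rabs (rot1 nu b y th r) <= C * (Rpower r (a - 1) * exp (- (y * (c1 / 2) * Rpower r nu))) /\
   Rabs (rot2 nu b y th r) <= C * (Rpower r (a - 1) * exp (- (y * (c1 / 2) * Rpower r nu))).
Proof.
intros Hnu Hb Hy Hc.
destruct (exp_poly_bound (c1 / 2)) as [C1 [HC1 H1]]. lra.
set (p := (1 - b) / nu).
assert (Hp : 0 <= p) by (apply Rdiv_le_0_compat; lra).
assert (Hexp : forall th w, 0 <= w -> c1 <= cos th -> (1 + w) ^ 2 * exp (- (w * cos th)) <= C1 * exp (- (w * (c1 / 2)))).
{ intros th w Hw Hth. eapply Rle_trans. apply Rmult_le_compat_l. apply pow2_ge_0. now apply (exp_cos_le w th c1).
  replace (- (w * c1)) with (- (c1 / 2 * w) + - (w * (c1 / 2))) by field. rewrite exp_plus.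
  rewrite <- Rmult_assoc. apply Rmult_le_compat_r. left; apply exp_pos. auto. }
assert (Hgen : forall th r X Y D, 0 < r -> c1 <= cos th -> 0 <= D -> 0 <= Y ->
   Rabs X * Rpower r (- b) <= D * Y * (1 + y * Rpower r nu) ^ 2 ->
   Rabs (Rpower r (- b) * exp (- (y * Rpower r nu * cos th)) * X) <=
   D * C1 * (Y * exp (- (y * (c1 / 2) * Rpower r nu)))).
{ intros th r X Y D Hr Hth HD HY HX. generalize (Rpower_pos r nu); intros Hn.
  assert (Hw : 0 <= y * Rpower r nu) by (apply Rmult_le_pos; lra).
  specialize (Hexp th _ Hw Hth). set (w := y * Rpower r nu) in *.
  rewrite !Rabs_mult, (Rabs_right (Rpower r (- b))), (Rabs_right (exp _)).
  2: left; apply exp_pos. 2: left; apply Rpower_pos.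
  replace (y * (c1 / 2) * Rpower r nu) with (w * (c1 / 2)) by (unfold w; ring).
  assert (HE := exp_pos (- (w * cos th))).
  apply Rle_trans with (D * Y * (1 + w) ^ 2 * exp (- (w * cos th))).
  - replace (Rpower r (- b) * exp (- (w * cos th)) * Rabs X) with (Rabs X * Rpower r (- b) * exp (- (w * cos th))) by ring.
    apply Rmult_le_compat_r; lra.
  - replace (D * C1 * (Y * exp (- (w * (c1 / 2))))) with (D * Y * (C1 * exp (- (w * (c1 / 2))))) by ring.
    rewrite Rmult_assoc. apply Rmult_le_compat_l; auto. now apply Rmult_le_pos. }
destruct Hb as [Hb|Hb].
- exists (1 - b), ((1 + 2 * p + p ^ 2) * C1). split. lra. intros th r Hr Hth.
  replace (1 - b - 1) with (- b) by ring. generalize (Rpower_pos r nu) (Rpower_pos r (- b)); intros Hn Hrb.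
  assert (Hw : 0 <= y * Rpower r nu) by (apply Rmult_le_pos; lra).
  unfold rot, rot1, rot2. fold p. cbv zeta. set (w := y * Rpower r nu) in *. set (A := w * sin th - p * th).
  assert (HD : 0 <= 1 + 2 * p + p ^ 2) by nra.
  assert (Hgen' : forall X, Rabs X <= (1 + 2 * p + p ^ 2) * (1 + w) ^ 2 ->
     Rabs X * Rpower r (- b) <= (1 + 2 * p + p ^ 2) * Rpower r (- b) * (1 + w) ^ 2).
  { intros X HX. replace ((1 + 2 * p + p ^ 2) * Rpower r (- b) * (1 + w) ^ 2) with
      ((1 + 2 * p + p ^ 2) * (1 + w) ^ 2 * Rpower r (- b)) by ring. apply Rmult_le_compat_r; lra. }
  repeat split; apply Hgen; auto; try lra; apply Hgen'.
  + assert (Rabs (sin A) <= 1) by apply Rabs_le, SIN_bound. nra.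
  + unfold Rminus. eapply Rle_trans. apply Rabs_triang. rewrite Rabs_Ropp.
    assert (U1 := Rabs_mult_cos_le w (A + - th)). assert (U2 := Rabs_mult_cos_le p A).
    rewrite (Rabs_right w) in U1 by lra. rewrite (Rabs_right p) in U2 by lra. nra.
  + unfold Rminus. eapply Rle_trans. apply Rabs_triang. rewrite Rabs_Ropp.
    assert (U0 := Rabs_triang (- w ^ 2 * sin (A + - th + - th)) ((2 * p + 1) * w * sin (A + - th))).
    assert (U1 := Rabs_mult_sin_le (- w ^ 2) (A + - th + - th)).
    assert (U2 := Rabs_mult_sin_le ((2 * p + 1) * w) (A + - th)).
    assert (U3 := Rabs_mult_sin_le (p ^ 2) A).
    rewrite (Rabs_Ropp (w ^ 2)), (Rabs_right (w ^ 2)) in U1 by nra. rewrite (Rabs_right ((2 * p + 1) * w)) in U2 by nra.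
    rewrite (Rabs_right (p ^ 2)) in U3 by nra. nra.
- assert (Hp0 : p = 0) by (unfold p; rewrite Hb; field; lra).
  exists nu, (y * C1). split; auto. intros th r Hr Hth.
  generalize (Rpower_pos r nu) (Rpower_pos r (nu - 1)); intros Hn Hrb.
  assert (Hw : 0 <= y * Rpower r nu) by (apply Rmult_le_pos; lra).
  unfold rot, rot1, rot2. fold p. rewrite Hp0. cbv zeta.
  assert (Hgen' : forall X, Rabs X <= y * Rpower r nu * (1 + y * Rpower r nu) ^ 2 ->
     Rabs X * Rpower r (- b) <= y * Rpower r (nu - 1) * (1 + y * Rpower r nu) ^ 2).
  { intros X HX. rewrite Hb. rewrite <- Rpower_self_inv.
    eapply Rle_trans. apply Rmult_le_compat_r. left; apply Rpower_pos. exact HX. right; ring. }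
  repeat split; apply Hgen; auto; try lra; apply Hgen'; set (w := y * Rpower r nu) in *.
  + eapply Rle_trans. apply Rabs_sin_le. rewrite Rmult_0_l, Rminus_0_r.
    rewrite Rabs_mult, (Rabs_right w) by lra.
    assert (Rabs (sin th) <= 1) by apply Rabs_le, SIN_bound. nra.
  + rewrite !Rmult_0_l, !Rminus_0_r.
    eapply Rle_trans. apply Rabs_mult_cos_le. rewrite (Rabs_right w) by lra. nra.
  + replace (- w ^ 2 * sin (w * sin th - 0 * th - th - th) + (2 * 0 + 1) * w * sin (w * sin th - 0 * th - th) -
      0 ^ 2 * sin (w * sin th - 0 * th)) with
     (- w ^ 2 * sin (w * sin th - 0 * th - th - th) + w * sin (w * sin th - 0 * th - th)) by ring.
    eapply Rle_trans. apply Rabs_triang.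
    assert (U1 := Rabs_mult_sin_le (- w ^ 2) (w * sin th - 0 * th - th - th)).
    assert (U2 := Rabs_mult_sin_le w (w * sin th - 0 * th - th)).
    rewrite (Rabs_Ropp (w ^ 2)), (Rabs_right (w ^ 2)) in U1 by nra. rewrite (Rabs_right w) in U2 by lra. nra.
Qed.

Lemma c_rot nu b y th r : 0 < r -> continuous (rot nu b y th) r.
Proof.
intros Hr. unfold rot. apply c_mult; [apply c_mult|].
now apply continuous_Rpower.
apply (continuous_comp (fun r => Rpower r nu) (fun u => exp (- (y * u * cos th)))). now apply continuous_Rpower.
apply (ex_derive_continuous (fun u => exp (- (y * u * cos th)))). auto_derive; auto.
apply (continuous_comp (fun r => Rpower r nu) (fun u => sin (y * u * sin th - (1 - b) / nu * th))). now apply continuous_Rpower.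
apply (ex_derive_continuous (fun u => sin (y * u * sin th - (1 - b) / nu * th))). auto_derive; auto.
Qed.

Lemma c_rot1 nu b y th r : 0 < r -> continuous (rot1 nu b y th) r.
Proof.
intros Hr. unfold rot1. cbv zeta. apply c_mult; [apply c_mult|].
now apply continuous_Rpower.
apply (continuous_comp (fun r => Rpower r nu) (fun u => exp (- (y * u * cos th)))). now apply continuous_Rpower.
apply (ex_derive_continuous (fun u => exp (- (y * u * cos th)))). auto_derive; auto.
set (f := fun u => y * u * cos (y * u * sin th - (1 - b) / nu * th - th) - (1 - b) / nu * cos (y * u * sin th - (1 - b) / nu * th)).
apply (continuous_comp (fun r => Rpower r nu) f). now apply continuous_Rpower.
apply (ex_derive_continuous f). unfold f. auto_derive; auto.
Qed.

(* The [th]-derivative of [rot] is an exact [r]-derivative. *)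
Lemma is_derive_rot_prim nu b y th r : 0 < nu -> 0 < r ->
  is_derive (fun r => - / nu * (Rpower r (1 - b) * exp (- (y * Rpower r nu * cos th)) *
     cos (y * Rpower r nu * sin th - (1 - b) / nu * th))) r (rot1 nu b y th r).
Proof.
intros Hnu Hr. assert (D := is_derive_Rpower nu r Hr).
eapply is_derive_eq. apply d_scal, d_mult; [apply d_mult|].
now apply is_derive_Rpower.
apply (d_comp (fun u => exp (- (y * u * cos th))) (fun r => Rpower r nu)). auto_derive; [auto|reflexivity]. exact D.
apply (d_comp (fun u => cos (y * u * sin th - (1 - b) / nu * th)) (fun r => Rpower r nu)). auto_derive; [auto|reflexivity]. exact D.
unfold rot1. cbv beta zeta.
replace (1 - b - 1) with (- b) by ring.
replace (Rpower r (1 - b)) with (r * Rpower r (- b)) by (rewrite Rpower_mult_self; [f_equal; ring|auto]).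
replace (Rpower r nu) with (r * Rpower r (nu - 1)) by (rewrite Rpower_mult_self; [f_equal; ring|auto]).
set (q := Rpower r (nu - 1)). set (w := y * (r * q)).
replace (w * sin th + - ((1 - b) / nu * th)) with (w * sin th - (1 - b) / nu * th) by ring.
set (A := w * sin th - (1 - b) / nu * th). rewrite (cos_minus A th). unfold w. field. lra.
Qed.

(** Minus the limit at [r = 0] of the [r]-primitive of [rot1]: its factor [r^(1-b)] vanishes there
    unless [b = 1]. *)
Definition rot_const (nu b : R) : R := if Rlt_dec b 1 then 0 else / nu.

Lemma is_int_rot1 nu b y th : 0 < nu -> b <= 1 -> 0 < y -> 0 < cos th ->
  is_int p_infty (rot1 nu b y th) (rot_const nu b).
Proof.
intros Hnu Hb Hy Hc.
set (l0 := if Rlt_dec b 1 then 0 else - / nu).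
replace (rot_const nu b) with (0 - l0) by (unfold rot_const, l0; destruct (Rlt_dec b 1); ring).
assert (HB : forall r, 0 < r -> Rabs (Rpower r (1 - b) * exp (- (y * Rpower r nu * cos th)) *
     cos (y * Rpower r nu * sin th - (1 - b) / nu * th)) <= Rpower r (1 - b) * exp (- (y * cos th * Rpower r nu))).
{ intros r Hr. eapply Rle_trans. apply Rabs_mult_cos_le.
  rewrite Rabs_right. right. f_equal. f_equal. ring. left. apply Rmult_lt_0_compat; apply exp_pos. }
assert (Hyc : 0 < y * cos th) by now apply Rmult_lt_0_compat.
apply (is_int_antideriv p_infty (fun r => - / nu * (Rpower r (1 - b) * exp (- (y * Rpower r nu * cos th)) *
     cos (y * Rpower r nu * sin th - (1 - b) / nu * th)))).
- easy.
- intros r [Hr _]. now apply is_derive_rot_prim.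
- intros r [Hr _]. now apply c_rot1.
- unfold l0. destruct (Rlt_dec b 1) as [H|H].
  + replace 0 with (- / nu * 0) at 2 by ring. apply flim_scal; [apply _|].
    apply flim_squeeze with (fun r => Rpower r (1 - b) * exp (- (y * cos th * Rpower r nu))); [apply _| |].
    generalize (at_right_below 1 Rlt_0_1). apply filter_imp. intros r Hr. rewrite Rminus_0_r. apply HB; lra.
    apply Rpower_mul_exp_lim_0; lra.
  + assert (E : b = 1) by lra. subst b. replace (locally (- / nu)) with (locally (- / nu * 1)) by (f_equal; ring). apply flim_scal; [apply _|].
    apply filterlim_ext_loc with (fun r => exp (- (y * Rpower r nu * cos th)) * cos (y * Rpower r nu * sin th)).
    { generalize (at_right_below 1 Rlt_0_1). apply filter_imp. intros r Hr.
      replace (1 - 1) with 0 by ring. rewrite Rpower_O by lra. rewrite Rmult_1_l. f_equal. f_equal. field. lra. }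
    replace (locally 1) with (locally ((fun u => exp (- (y * u * cos th)) * cos (y * u * sin th)) 0)).
    2:{ cbv beta. f_equal. rewrite Rmult_0_r, !Rmult_0_l, Ropp_0, exp_0, cos_0. ring. }
    apply (filterlim_comp _ _ _ (fun r => Rpower r nu) (fun u => exp (- (y * u * cos th)) * cos (y * u * sin th)) _ (locally 0)).
    now apply Rpower_lim_0.
    apply (ex_derive_continuous (fun u => exp (- (y * u * cos th)) * cos (y * u * sin th))). auto_derive; auto.
- replace 0 with (- / nu * 0) by ring. apply flim_scal; [apply _|].
  apply flim_squeeze with (fun r => Rpower r (1 - b) * exp (- (y * cos th * Rpower r nu))); [apply _| |].
  exists 0. intros r Hr. rewrite Rminus_0_r. now apply HB.
  apply Rpower_mul_exp_lim_infty; lra.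
Qed.

(** Cauchy's theorem in real form: the angular derivative of the integral is the constant boundary
    term [rot_const], and at [th = 0] the integrand is zero. *)
Lemma is_int_rot nu b y th : 0 < nu < / 2 -> b <= 1 -> 0 < y -> 0 <= th <= PI * nu ->
  is_int p_infty (rot nu b y th) (rot_const nu b * th).
Proof.
intros Hnu Hb Hy Hth. assert (HP := PI_RGT_0).
(* The midpoint of [PI nu] and [PI / 2]: it leaves room for two-sided derivatives at both end angles
   while keeping the cosine bounded below. *)
set (th1 := PI * (nu + / 2) / 2).
assert (Ht1 : PI * nu < th1 < PI / 2) by (unfold th1; nra).
set (c1 := cos th1). assert (Hc1 : 0 < c1) by (apply cos_gt_0; nra).
assert (Hcos : forall u, Rabs u <= th1 -> c1 <= cos u).
{ assert (H : forall u, 0 <= u <= th1 -> c1 <= cos u) by (intros u Hu; apply cos_decr_1; lra).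
  intros u Hu. apply Rabs_le_between in Hu. destruct (Rle_or_lt 0 u). apply H; lra.
  rewrite <- cos_neg. apply H. lra. }
destruct (rot_bound nu b y c1) as [a [C [Ha HB]]]; auto; try lra.
assert (Hdel : 0 < y * (c1 / 2)) by (apply Rmult_lt_0_compat; lra).
assert (Hex : forall u, Rabs u <= th1 -> exists l, is_int p_infty (rot nu b y u) l).
{ intros u Hu. apply (ex_int_exp a (y * (c1 / 2)) nu C); auto; try lra.
  intros; now apply c_rot. intros r Hr. now apply HB; auto. }
set (Q := fun u => RInt_gen (rot nu b y u) (at_right 0) (Rbar_locally p_infty)).
assert (HQ : forall u, Rabs u <= th1 -> is_int p_infty (rot nu b y u) (Q u)).
{ intros u Hu. destruct (Hex u Hu) as [l Hl]. unfold Q. erewrite is_RInt_gen_unique; [|exact Hl]. exact Hl. }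
assert (Hg : exists l, is_int p_infty (fun r => C * (Rpower r (a - 1) * exp (- (y * (c1 / 2) * Rpower r nu)))) l).
{ apply (ex_int_exp a (y * (c1 / 2)) nu (Rabs C)); auto; try lra.
  - intros r Hr. apply c_scal, c_mult. now apply continuous_Rpower.
    apply (continuous_comp (fun r => Rpower r nu) (fun u => exp (- (y * (c1 / 2) * u)))). now apply continuous_Rpower.
    apply (ex_derive_continuous (fun u => exp (- (y * (c1 / 2) * u)))). auto_derive; auto.
  - intros r Hr. rewrite Rabs_mult. apply Rmult_le_compat_l. apply Rabs_pos.
    rewrite Rabs_right. lra. left. apply Rmult_lt_0_compat; apply exp_pos. }
destruct Hg as [lg Hlg].
assert (HD : forall u, Rabs u < th1 -> is_derive Q u (rot_const nu b)).
{ intros u Hu.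
  assert (Hv : forall v, Rabs (v - u) < th1 - Rabs u -> Rabs v <= th1).
  { intros v Hv. replace v with (v - u + u) by ring. eapply Rle_trans. apply Rabs_triang. lra. }
  apply (is_derive_int p_infty (fun th r => rot nu b y th r) (fun th r => rot1 nu b y th r) (fun th r => rot2 nu b y th r)
     Q u _ (th1 - Rabs u) (fun r => C * (Rpower r (a - 1) * exp (- (y * (c1 / 2) * Rpower r nu)))) lg); auto.
  - easy.
  - lra.
  - apply is_int_rot1; auto; try lra. apply Rlt_le_trans with c1; auto. apply Hcos. lra.
  - intros v r _ _. apply is_derive_rot; lra.
  - intros v r _ _. apply is_derive_rot1; lra.
  - intros v r Hvu [Hr _]. apply HB; auto. }
assert (HQ0 : Q 0 = 0).
{ apply (is_int_unique p_infty (rot nu b y 0)). apply HQ. rewrite Rabs_R0; lra.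
  apply (is_int_ext p_infty (fun _ => 0)). easy.
  - intros r _. unfold rot. rewrite sin_0, !Rmult_0_r, Rminus_0_r, sin_0. ring.
  - now apply is_int_zero. }
replace (rot_const nu b * th) with (Q th). apply HQ. rewrite Rabs_right; lra.
destruct (MVT_gen Q 0 th (fun _ => rot_const nu b)) as [z [_ Ez]].
- intros u Hu. rewrite Rmin_left, Rmax_right in Hu by lra. apply HD. rewrite Rabs_right; lra.
- intros u Hu. rewrite Rmin_left, Rmax_right in Hu by lra.
  apply continuity_pt_filterlim, (is_derive_continuous Q u (rot_const nu b)), HD. rewrite Rabs_right; lra.
- lra.
Qed.

Lemma Kint_t0 nu b y : 0 < nu < / 2 -> b <= 1 -> 0 < y -> Kint nu b y 0 = - (rot_const nu b * (PI * nu)).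
Proof.
intros Hnu Hb Hy. assert (HP := PI_RGT_0).
apply (is_int_unique p_infty (K nu b y 0)). apply is_int_Kint; lra.
apply (is_int_ext p_infty (fun r => -1 * rot nu b y (PI * nu) r)). easy.
- intros r _. unfold K, env, rot.
  replace (y * Rpower r nu * sin (PI * nu) - (1 - b) / nu * (PI * nu)) with
    (PI * b + y * sin (PI * nu) * Rpower r nu - PI) by (field; lra).
  rewrite sin_minus, sin_PI, cos_PI.
  replace (- (r * 0) - y * cos (PI * nu) * Rpower r nu) with (- (y * Rpower r nu * cos (PI * nu))) by ring. ring.
- replace (- (rot_const nu b * (PI * nu))) with (-1 * (rot_const nu b * (PI * nu))) by ring.
  apply is_int_scal, is_int_rot; nra.
Qed.

(** [Kint] at [t = 0] is 0 for [b < 1] and [- PI] for [b = 1], where it cancels the extra 1. So [G]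
    is in both cases the increment of [Kint / PI] from [t = 0], and [1 - exp (- r t) <= r t] costs
    one power of [r], which lowers [b] by 1. *)
Lemma G_small_of_le1 nu b y : 0 < nu < / 2 -> b <= 1 -> 0 < y ->
  exists C, forall t, 0 < t -> Rabs (G nu b y t) <= C * t.
Proof.
intros Hnu Hb Hy. assert (HP := PI_RGT_0). assert (HI : 0 < / PI) by now apply Rinv_0_lt_compat.
exists (/ PI * Nint nu (b - 1) y 0). intros t Ht.
assert (E : G nu b y t = / PI * (Kint nu b y t - Kint nu b y 0)).
{ rewrite Kint_t0 by auto. unfold rot_const. destruct (Rlt_dec b 1) as [H|H].
  - rewrite G_eq_Kint by lra. field. lra.
  - replace b with 1 by lra. rewrite G_1_eq_Kint by lra. field. lra. }
rewrite E, Rabs_mult, (Rabs_right (/ PI)), Rmult_assoc by lra. apply Rmult_le_compat_l. lra.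
rewrite (Rmult_comm (Nint nu (b - 1) y 0) t).
apply (is_int_Rabs p_infty (fun r => K nu b y t r - K nu b y 0 r) (fun r => t * env nu (b - 1) y 0 r)).
- easy.
- intros r [Hr _]. unfold K.
  replace (env nu b y t r) with (exp (- (r * t)) * env nu b y 0 r).
  2:{ unfold env. rewrite Rmult_0_r, Ropp_0. unfold Rminus. rewrite !exp_plus, exp_0. ring. }
  rewrite <- Rmult_minus_distr_r. eapply Rle_trans. apply Rabs_mult_sin_le.
  replace (exp (- (r * t)) * env nu b y 0 r - env nu b y 0 r) with (- ((1 - exp (- (r * t))) * env nu b y 0 r)) by ring.
  rewrite Rabs_Ropp, Rabs_mult, (Rabs_right (env _ _ _ _ _)) by (left; apply env_pos).
  replace (env nu (b - 1) y 0 r) with (r * env nu b y 0 r).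
  2:{ unfold env. rewrite <- Rmult_assoc, Rpower_mult_self by auto. f_equal. f_equal. ring. }
  rewrite <- Rmult_assoc. apply Rmult_le_compat_r. left; apply env_pos.
  assert (H0 : exp (- (r * t)) <= 1) by (rewrite <- exp_0; apply exp_le; nra).
  generalize (exp_ineq1_le (- (r * t))). intros H1. rewrite Rabs_right; lra.
- apply is_int_minus; apply is_int_Kint; lra.
- apply is_int_scal, is_int_Nint; lra.
Qed.

(** For [b > 1] the recurrence, solved for its term of highest index, expresses [G] at [b] through
    [b - 1] and [b - nu]; finitely many steps of at least [nu] lead to [b <= 1]. *)
Lemma G_lim_0 nu b y : 0 < nu < / 2 -> 0 < y -> filterlim (G nu b y) (at_right 0) (locally 0).
Proof.
intros Hnu. revert b y.
assert (H : forall n b y, 0 < y -> b < 1 + INR n * nu -> filterlim (G nu b y) (at_right 0) (locally 0)).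
{ assert (Hle : forall b y, 0 < y -> b <= 1 -> filterlim (G nu b y) (at_right 0) (locally 0)).
  { intros b y Hy Hb. destruct (G_small_of_le1 nu b y Hnu Hb Hy) as [C HC].
    apply (lim_0_of_Rpower _ 1 C). lra. intros t Ht. rewrite Rpower_1 by lra. apply HC; lra. }
  induction n; intros b y Hy Hb.
  - simpl in Hb. apply Hle; lra.
  - rewrite S_INR in Hb. destruct (Rle_or_lt b 1) as [H1|H1]. now apply Hle.
    apply filterlim_ext_loc with (fun t => / (b - 1) * (t * G nu (b - 1) y t - nu * y * G nu (b - nu) y t)).
    + generalize (at_right_below 1 Rlt_0_1). apply filter_imp. intros t Ht.
      rewrite G_rec by lra. replace (b - 1 + 1) with b by ring. field. lra.
    + replace 0 with (/ (b - 1) * (0 * 0 - nu * y * 0)) at 2 by ring.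
      apply flim_scal; [apply _|]. apply flim_minus; [apply _| |].
      * apply flim_mult; [apply _| |]. apply (lim_right_continuous (fun t => t)), c_id. apply IHn; auto; lra.
      * apply flim_scal; [apply _|]. apply IHn; auto; lra. }
intros b y Hy. destruct (INR_unbounded ((b - 1) / nu)) as [n Hn]. apply (H n); auto.
apply Rlt_div_l in Hn; lra.
Qed.

(** Since [G] vanishes at [t = 0], integrating [j] times in [t] over at most unit length carries
    over the bound from [b - j], where the integral representation applies. *)
Lemma G_bound nu j b y t : 0 < nu < / 2 -> b - INR j < 1 -> 0 < y -> 0 < t <= 1 ->
  Rabs (G nu b y t) <= / PI * Nint nu (b - INR j) y 0.
Proof.
intros Hnu. assert (HP := PI_RGT_0). assert (HI : 0 < / PI) by now apply Rinv_0_lt_compat.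
revert b t. induction j; intros b t Hb Hy Ht.
- simpl in *. rewrite Rminus_0_r in *. rewrite G_eq_Kint by lra. unfold Rdiv.
  rewrite Rmult_comm, Rabs_mult, (Rabs_right (/ PI)) by lra. apply Rmult_le_compat_l. lra.
  eapply Rle_trans. apply Kint_Rabs_le; lra. apply Nint_le; lra.
- rewrite S_INR in *.
  assert (H := growth_of_derive (G nu b y) (G nu (b - 1) y) 1 (/ PI * Nint nu (b - (INR j + 1)) y 0) 0).
  eapply Rle_trans. apply H; auto.
  + intros u Hu. replace b with (b - 1 + 1) at 1 by ring. apply is_derive_G_t; lra.
  + intros u Hu. replace (b - (INR j + 1)) with (b - 1 - INR j) by ring. simpl. unfold Rdiv.
    rewrite Rmult_1_r, Rinv_1, Rmult_1_r. apply IHj; lra.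
  + now apply G_lim_0.
  + simpl. rewrite Rmult_1_r. unfold Rdiv. rewrite Rinv_1, Rmult_1_r.
    assert (H0 : 0 <= / PI * Nint nu (b - (INR j + 1)) y 0).
    { apply Rmult_le_pos. lra. apply (is_int_nonneg p_infty (env nu (b - (INR j + 1)) y 0)). easy.
      intros; left; apply env_pos. apply is_int_Nint; lra. }
    nra.
Qed.

Lemma W_bounded nu : 0 < nu < / 2 -> exists M, 0 < M /\ forall b z, 0 <= b <= 3 -> 0 <= z -> Rabs (W nu b z) <= M.
Proof.
intros Hnu. assert (HP := PI_RGT_0). assert (HI : 0 < / PI) by now apply Rinv_0_lt_compat.
destruct (W_bound_le1 nu Hnu) as [M1 HM1].
(* Four integrations bring every [b] in [[0, 3]] below 1; the power of [r] then has exponent between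
   1 and 4, hence is at most [r^0 + r^4]. *)
set (M2 := / PI * (Nint nu 0 1 0 + Nint nu (-4) 1 0)).
exists (Rabs M1 + Rabs M2 + 1). split. generalize (Rabs_pos M1) (Rabs_pos M2). lra.
intros b z Hb Hz. destruct (Rle_or_lt z 1) as [H|H].
- specialize (HM1 b z). eapply Rle_trans. apply HM1; lra. generalize (Rle_abs M1) (Rabs_pos M2). lra.
- apply Rle_trans with M2. 2: generalize (Rle_abs M2) (Rabs_pos M1); lra.
  rewrite <- G_1. eapply Rle_trans. apply (G_bound nu 4); simpl; lra.
  unfold M2. apply Rmult_le_compat_l. lra. simpl.
  apply (is_int_le p_infty (env nu (b - (1 + 1 + 1 + 1)) z 0) (fun r => env nu 0 1 0 r + env nu (-4) 1 0 r)). easy.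
  + intros r [Hr _]. eapply Rle_trans. apply (env_le nu _ z 0 1 0); lra. unfold env.
    rewrite <- Rmult_plus_distr_r. apply Rmult_le_compat_r. left; apply exp_pos.
    destruct (Rle_or_lt r 1).
    * rewrite Ropp_0. assert (Rpower r (- (b - (1 + 1 + 1 + 1))) <= Rpower r 0) by (apply Rpower_le_le1; lra).
      generalize (Rpower_pos r (- -4)). lra.
    * assert (Rpower r (- (b - (1 + 1 + 1 + 1))) <= Rpower r (- -4)) by (apply Rle_Rpower; lra).
      generalize (Rpower_pos r (- 0)). lra.
  + apply is_int_Nint; lra.
  + apply is_int_plus; apply is_int_Nint; lra.
Qed.

(** * Fractional integration *)

(** [Gamma be] times the Riemann-Liouville integral of order [be] of [G nu b z], at time 1; other
    times follow by self-similarity. *)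
Definition frac_int (nu be b z : R) : R :=
  RInt_gen (fun t => Rpower (1 - t) (be - 1) * G nu b z t) (at_right 0) (at_left 1).

Lemma c_G_t nu b y t : 0 < nu < / 2 -> 0 < t -> continuous (G nu b y) t.
Proof.
intros Hnu Ht. apply (is_derive_continuous (G nu b y) t (G nu (b - 1) y t)).
replace b with (b - 1 + 1) at 1 by ring. now apply is_derive_G_t.
Qed.

Lemma c_frac_int nu be b z t : 0 < nu < / 2 -> 0 < t < 1 ->
  continuous (fun t => Rpower (1 - t) (be - 1) * G nu b z t) t.
Proof.
intros Hnu Ht. apply c_mult. apply (c_Rpower (be - 1) (fun u => 1 - u)). lra. apply c_one_minus.
apply c_G_t; lra.
Qed.

Lemma G_locally_bounded nu b y0 : 0 < nu < / 2 -> 0 < y0 ->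
  exists C, forall y t, y0 <= y -> 0 < t <= 1 -> Rabs (G nu b y t) <= C.
Proof.
intros Hnu Hy0. assert (HP := PI_RGT_0). assert (HI : 0 < / PI) by now apply Rinv_0_lt_compat.
destruct (INR_unbounded b) as [j Hj].
exists (/ PI * Nint nu (b - INR j) y0 0). intros y t Hy Ht.
eapply Rle_trans. apply (G_bound nu j); lra. apply Rmult_le_compat_l. lra. apply Nint_le; lra.
Qed.

Lemma is_int_frac_int nu be b z : 0 < nu < / 2 -> 0 < be -> 0 < z ->
  is_int 1 (fun t => Rpower (1 - t) (be - 1) * G nu b z t) (frac_int nu be b z).
Proof.
intros Hnu Hbe Hz. destruct (G_locally_bounded nu b z Hnu Hz) as [C HC].
destruct (ex_int_beta 1 be C (fun t => Rpower (1 - t) (be - 1) * G nu b z t)) as [l Hl]; auto; try lra.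
- intros t Ht. now apply c_frac_int.
- intros t Ht. specialize (HC z t ltac:(lra) ltac:(lra)).
  rewrite Rabs_mult, (Rabs_right (Rpower _ _)) by (left; apply Rpower_pos).
  replace (1 - 1) with 0 by ring. rewrite Rpower_O, Rmult_1_l, Rmult_comm by lra.
  apply Rmult_le_compat_r; auto. left; apply Rpower_pos.
- unfold frac_int. erewrite is_RInt_gen_unique; [|exact Hl]. exact Hl.
Qed.

Lemma is_int_one_minus be : 0 < be -> is_int 1 (fun t => Rpower (1 - t) (be - 1)) (/ be).
Proof.
intros Hbe. rewrite <- Beta_1 by auto. generalize (is_int_Beta 1 be Rlt_0_1 Hbe). apply is_int_ext. simpl; lra.
intros t [Ht _]. replace (1 - 1) with 0 by ring. rewrite Rpower_O by auto. ring.
Qed.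

Lemma is_derive_frac_int nu be b z : 0 < nu < / 2 -> 0 < be -> 0 < z ->
  is_derive (frac_int nu be b) z (- frac_int nu be (b - nu) z).
Proof.
intros Hnu Hbe Hz. destruct (G_locally_bounded nu (b - nu - nu) (z / 2) Hnu ltac:(lra)) as [C HC].
apply (is_derive_int 1 (fun z t => Rpower (1 - t) (be - 1) * G nu b z t)
   (fun z t => Rpower (1 - t) (be - 1) * - G nu (b - nu) z t)
   (fun z t => Rpower (1 - t) (be - 1) * - - G nu (b - nu - nu) z t) _ _ _ (z / 2)
   (fun t => C * Rpower (1 - t) (be - 1)) (C * / be)).
- simpl; lra.
- lra.
- intros u Hu. apply Rabs_lt_between in Hu. apply is_int_frac_int; lra.
- apply (is_int_ext 1 (fun t => -1 * (Rpower (1 - t) (be - 1) * G nu (b - nu) z t))). simpl; lra. intros; ring.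
  replace (- frac_int nu be (b - nu) z) with (-1 * frac_int nu be (b - nu) z) by ring. now apply is_int_scal, is_int_frac_int.
- intros u t _ _. apply (d_scal (fun v => G nu b v t)). now apply is_derive_G_y.
- intros u t _ _. apply (d_scal (fun v => - G nu (b - nu) v t)).
  apply (is_derive_opp (fun v => G nu (b - nu) v t)). now apply is_derive_G_y.
- intros u t Hu [Ht1 Ht2]. simpl in Ht2. apply Rabs_lt_between in Hu. rewrite Ropp_involutive.
  rewrite Rabs_mult, (Rabs_right (Rpower _ _)), Rmult_comm by (left; apply Rpower_pos).
  apply Rmult_le_compat_r. left; apply Rpower_pos. apply HC; lra.
- now apply is_int_scal, is_int_one_minus.
Qed.

(** This is [W_rec] with [b + be] for [b], as the expected value [Gamma be W (b + be)] requires. It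
    is the integral of the [t]-derivative of [(1 - t)^be G (b + 1)], whose boundary values vanish,
    at [t = 0] by [G_lim_0]. *)
Lemma frac_int_rec nu be b z : 0 < nu < / 2 -> 0 < be -> 0 < z ->
  frac_int nu be b z = (b + be) * frac_int nu be (b + 1) z + nu * z * frac_int nu be (b + 1 - nu) z.
Proof.
intros Hnu Hbe Hz.
assert (H1 : is_int 1 (fun t => Rpower (1 - t) (be - 1) * G nu b z t -
    ((b + be) * (Rpower (1 - t) (be - 1) * G nu (b + 1) z t) + nu * z * (Rpower (1 - t) (be - 1) * G nu (b + 1 - nu) z t)))
  (frac_int nu be b z - ((b + be) * frac_int nu be (b + 1) z + nu * z * frac_int nu be (b + 1 - nu) z))).
{ apply is_int_minus. now apply is_int_frac_int. apply is_int_plus; now apply is_int_scal, is_int_frac_int. }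
assert (H2 : is_int 1 (fun t => Rpower (1 - t) (be - 1) * G nu b z t -
    ((b + be) * (Rpower (1 - t) (be - 1) * G nu (b + 1) z t) + nu * z * (Rpower (1 - t) (be - 1) * G nu (b + 1 - nu) z t)))
  (0 * G nu (b + 1) z 1 - Rpower (1 - 0) be * 0)).
{ apply (is_int_antideriv 1 (fun t => Rpower (1 - t) be * G nu (b + 1) z t)).
  - simpl; lra.
  - intros t [Ht1 Ht2]. simpl in Ht2.
    eapply is_derive_eq. apply d_mult. now apply d_Rpower_one_minus. now apply is_derive_G_t.
    assert (E1 : Rpower (1 - t) be = (1 - t) * Rpower (1 - t) (be - 1)).
    { rewrite Rpower_mult_self by lra. f_equal. ring. }
    assert (E := G_rec nu b z t Hnu Ht1).
    transitivity (Rpower (1 - t) (be - 1) * (G nu b z t - t * G nu b z t - be * G nu (b + 1) z t)).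
    rewrite E1. ring.
    transitivity (Rpower (1 - t) (be - 1) * (G nu b z t - (t * G nu b z t) - be * G nu (b + 1) z t)). ring.
    rewrite E. ring.
  - intros t [Ht1 Ht2]. simpl in Ht2. apply c_minus. apply c_frac_int; lra. apply c_plus; apply c_scal; apply c_frac_int; lra.
  - apply flim_mult; [apply _| |]. apply (lim_right_continuous (fun t => Rpower (1 - t) be)).
    apply (c_Rpower be (fun u => 1 - u)). lra. apply c_one_minus. apply G_lim_0; auto.
  - apply flim_mult; [apply _| |]. now apply Rpower_one_minus_lim.
    apply lim_left_continuous. apply c_G_t; auto; lra. }
generalize (is_int_unique _ _ _ _ H1 H2). lra.
Qed.

(** Replacing [W] by its value at 0 costs at most [M z t^(-nu)], harmless against [t^(b-1)] once
    [b >= 1 + nu]; what is left is a Beta integral. The strip has width 1, the largest step of the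
    recurrence. *)
Lemma frac_int_base nu be : 0 < nu < / 2 -> 0 < be ->
  exists M, 0 < M /\ forall b z, 1 + nu <= b <= 2 + nu -> 0 < z ->
    Rabs (frac_int nu be b z) <= M /\ Rabs (frac_int nu be b z - Gamma be * rgamma (b + be)) <= M * z.
Proof.
intros Hnu Hbe. destruct (W_bounded nu Hnu) as [M [HM HW]].
assert (Hi : 0 < / be) by now apply Rinv_0_lt_compat.
exists (M * / be). split. now apply Rmult_lt_0_compat.
intros b z Hb Hz.
assert (HL : forall u, 0 < u -> Rabs (W nu b u - rgamma b) <= M * u).
{ intros u Hu. rewrite <- (W_0 nu b).
  destruct (MVT_gen (W nu b) 0 u (fun v => - W nu (b - nu) v)) as [c [Hc Ec]].
  - intros v _. now apply is_derive_W.
  - intros v _. apply continuity_pt_filterlim. eapply is_derive_continuous. now apply is_derive_W.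
  - rewrite Rmin_left, Rmax_right in Hc by lra. rewrite Ec, Rminus_0_r, Rabs_mult, Rabs_Ropp, (Rabs_right u) by lra.
    apply Rmult_le_compat_r. lra. apply HW; lra. }
split.
- apply (is_int_Rabs 1 (fun t => Rpower (1 - t) (be - 1) * G nu b z t) (fun t => M * Rpower (1 - t) (be - 1))).
  + simpl; lra.
  + intros t [Ht1 Ht2]. simpl in Ht2. rewrite Rabs_mult, (Rabs_right (Rpower _ _)), Rmult_comm by (left; apply Rpower_pos).
    apply Rmult_le_compat_r. left; apply Rpower_pos. unfold G.
    rewrite Rabs_mult, (Rabs_right (Rpower _ _)) by (left; apply Rpower_pos).
    assert (Rpower t (b - 1) <= 1) by (apply Rpower_le1; lra). generalize (Rpower_pos t (b - 1)).
    assert (Rabs (W nu b (z * Rpower t (- nu))) <= M).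
    { apply HW. lra. apply Rmult_le_pos. lra. left; apply Rpower_pos. }
    generalize (Rabs_pos (W nu b (z * Rpower t (- nu)))). nra.
  + now apply is_int_frac_int.
  + now apply is_int_scal, is_int_one_minus.
- replace (Gamma be * rgamma (b + be)) with (rgamma b * Beta b be).
  2:{ rewrite !rgamma_pos_arg by lra. assert (E := Beta_Gamma b be ltac:(lra) Hbe).
      assert (0 < Gamma b) by (apply Gamma_pos; lra). assert (0 < Gamma (b + be)) by (apply Gamma_pos; lra).
      apply Rmult_eq_reg_r with (Gamma b * Gamma (b + be)). 2: apply Rgt_not_eq; now apply Rmult_lt_0_compat.
      replace (/ Gamma b * Beta b be * (Gamma b * Gamma (b + be))) with (Beta b be * Gamma (b + be)) by (field; lra).
      rewrite E. field. lra. }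
  replace (M * / be * z) with (M * z * / be) by ring.
  apply (is_int_Rabs 1 (fun t => Rpower (1 - t) (be - 1) * G nu b z t - rgamma b * (Rpower t (b - 1) * Rpower (1 - t) (be - 1)))
     (fun t => M * z * Rpower (1 - t) (be - 1))).
  + simpl; lra.
  + intros t [Ht1 Ht2]. simpl in Ht2. unfold G.
    replace (Rpower (1 - t) (be - 1) * (Rpower t (b - 1) * W nu b (z * Rpower t (- nu))) -
       rgamma b * (Rpower t (b - 1) * Rpower (1 - t) (be - 1))) with
     (Rpower (1 - t) (be - 1) * (Rpower t (b - 1) * (W nu b (z * Rpower t (- nu)) - rgamma b))) by ring.
    rewrite Rabs_mult, (Rabs_right (Rpower _ _)), Rmult_comm by (left; apply Rpower_pos).
    apply Rmult_le_compat_r. left; apply Rpower_pos.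
    rewrite Rabs_mult, (Rabs_right (Rpower _ _)) by (left; apply Rpower_pos).
    assert (Hu : 0 < z * Rpower t (- nu)) by (apply Rmult_lt_0_compat; auto; apply Rpower_pos).
    apply Rle_trans with (Rpower t (b - 1) * (M * (z * Rpower t (- nu)))).
    apply Rmult_le_compat_l. left; apply Rpower_pos. now apply HL.
    replace (Rpower t (b - 1) * (M * (z * Rpower t (- nu)))) with (M * z * (Rpower t (b - 1) * Rpower t (- nu))) by ring.
    rewrite <- Rpower_plus. rewrite <- (Rmult_1_r (M * z)) at 2.
    apply Rmult_le_compat_l. left; now apply Rmult_lt_0_compat. apply Rpower_le1; lra.
  + apply is_int_minus. now apply is_int_frac_int. apply is_int_scal, is_int_Beta; lra.
  + now apply is_int_scal, is_int_one_minus.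
Qed.

(* The recurrence raises [b] by at least [1 - nu]; since [nu / (1 - nu) < 1], the bound reached at
   [b = - nu n] is beaten by the [n!] of the Taylor formula. *)
Lemma frac_int_levels nu be Z : 0 < nu < / 2 -> 0 < be <= 1 -> 0 < Z ->
  exists M k, 0 < M /\ forall m b, 1 + nu - INR m * (1 - nu) <= b <= 2 + nu ->
    filterlim (frac_int nu be b) (at_right 0) (locally (Gamma be * rgamma (b + be))) /\
    forall z, 0 < z <= Z -> Rabs (frac_int nu be b z) <= M * INR (fact (m + k)).
Proof.
intros Hnu Hbe HZ. destruct (frac_int_base nu be Hnu ltac:(lra)) as [M [HM HA]].
destruct (INR_unbounded (nu * Z + 3)) as [k Hk].
exists M, k. split; auto.
assert (Hfp : forall n, 1 <= INR (fact n)) by (intros n; apply (le_INR 1), lt_O_fact).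
assert (Hbase : forall m b, 1 + nu <= b <= 2 + nu ->
    filterlim (frac_int nu be b) (at_right 0) (locally (Gamma be * rgamma (b + be))) /\
    forall z, 0 < z <= Z -> Rabs (frac_int nu be b z) <= M * INR (fact (m + k))).
{ intros m b Hb. split.
  - apply flim_squeeze with (fun z => M * z); [apply _| |].
    + generalize (at_right_below 1 Rlt_0_1). apply filter_imp. intros z Hz. apply HA; lra.
    + replace 0 with (M * 0) at 2 by ring. apply flim_scal; [apply _|].
      apply (lim_right_continuous (fun t => t)), c_id.
  - intros z Hz. destruct (HA b z Hb ltac:(lra)) as [H1 _]. specialize (Hfp (m + k)%nat). nra. }
induction m; intros b Hb.
- simpl in Hb. apply Hbase. lra.
- rewrite S_INR in Hb. destruct (Rle_or_lt (1 + nu) b) as [H1|H1]. apply Hbase; lra.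
  assert (Hm0 : 0 <= INR m) by apply pos_INR.
  destruct (IHm (b + 1)) as [L1 B1]. nra. destruct (IHm (b + 1 - nu)) as [L2 B2]. nra. clear IHm.
  split.
  + apply filterlim_ext_loc with (fun z => (b + be) * frac_int nu be (b + 1) z + nu * (z * frac_int nu be (b + 1 - nu) z)).
    { generalize (at_right_below 1 Rlt_0_1). apply filter_imp. intros z Hz. rewrite (frac_int_rec nu be b z) by lra. ring. }
    rewrite (rgamma_rec (b + be)). replace (b + be + 1) with (b + 1 + be) by ring.
    replace (Gamma be * ((b + be) * rgamma (b + 1 + be))) with
     ((b + be) * (Gamma be * rgamma (b + 1 + be)) + nu * (0 * (Gamma be * rgamma (b + 1 - nu + be)))) by ring.
    apply flim_plus; [apply _| |]; apply flim_scal; try apply _; auto.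
    apply flim_mult; [apply _| |auto]. apply (lim_right_continuous (fun t => t)), c_id.
  + intros z Hz. specialize (B1 z Hz). specialize (B2 z Hz). rewrite frac_int_rec by lra.
    simpl (S m + k)%nat. rewrite fact_simpl, mult_INR, S_INR, plus_INR.
    assert (0 < INR (fact (m + k))) by apply INR_fact_lt_0. set (S := M * INR (fact (m + k))) in *.
    assert (HS : 0 < S) by (unfold S; now apply Rmult_lt_0_compat).
    eapply Rle_trans. apply Rabs_triang. rewrite !Rabs_mult, (Rabs_right nu), (Rabs_right z) by lra.
    replace (M * ((INR m + INR k + 1) * INR (fact (m + k)))) with ((INR m + INR k + 1) * S) by (unfold S; ring).
    assert (Hbb : Rabs (b + be) <= INR m + 3) by (apply Rabs_le; nra).
    apply Rle_trans with ((INR m + 3) * S + nu * Z * S).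
    * apply Rplus_le_compat. apply Rmult_le_compat; auto; apply Rabs_pos.
      apply Rmult_le_compat; auto; try apply Rabs_pos. nra. nra.
    * nra.
Qed.

Lemma is_int_frac_G nu be z : 0 < nu < / 2 -> 0 < be <= 1 -> 0 < z ->
  is_int 1 (fun t => Rpower (1 - t) (be - 1) * G nu 0 z t) (Gamma be * W nu be z).
Proof.
intros Hnu Hbe Hz. destruct (frac_int_levels nu be z Hnu Hbe Hz) as [M [k [HM HA]]].
(* Enough steps of length [1 - nu] to lift [- nu n] to the strip that starts at [1 + nu]. *)
set (m := fun n => Z.to_nat (up ((1 + nu + nu * INR n) / (1 - nu)))).
assert (Hm : forall n, (1 + nu + nu * INR n) / (1 - nu) < INR (m n) <= (1 + nu + nu * INR n) / (1 - nu) + 1).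
{ intros n. unfold m. destruct (archimed ((1 + nu + nu * INR n) / (1 - nu))) as [H1 H2].
  assert (0 < (1 + nu + nu * INR n) / (1 - nu)). { apply Rdiv_lt_0_compat. generalize (pos_INR n); nra. lra. }
  rewrite (INR_IZR_INZ (Z.to_nat _)), Z2Nat.id. lra. apply le_IZR. lra. }
assert (HAn : forall n, filterlim (frac_int nu be (0 - nu * INR n)) (at_right 0) (locally (Gamma be * rgamma (0 - nu * INR n + be))) /\
    forall u, 0 < u <= z -> Rabs (frac_int nu be (0 - nu * INR n) u) <= M * INR (fact (m n + k))).
{ intros n. apply HA. destruct (Hm n) as [H1 _]. apply Rlt_div_l in H1; [|lra]. generalize (pos_INR n). nra. }
replace (Gamma be * W nu be z) with (frac_int nu be 0 z). apply is_int_frac_int; lra.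
assert (HS := taylor_series_of_chain (fun n u => frac_int nu be (0 - nu * INR n) u)
   (fun n => Gamma be * rgamma (0 - nu * INR n + be)) (fun n => M * INR (fact (m n + k))) z Hz).
assert (HS' : is_series (fun n => Gamma be * rgamma (0 - nu * INR n + be) * (- z) ^ n / INR (fact n))
    (frac_int nu be (0 - nu * INR 0) z)).
{ apply HS; clear HS.
  - intros n u Hu. rewrite S_INR. replace (0 - nu * (INR n + 1)) with (0 - nu * INR n - nu) by ring. apply is_derive_frac_int; lra.
  - intros n. apply HAn.
  - intros n u Hu. now apply HAn.
  - apply lim_0_of_bounded_pow; auto.
    + destruct (fact_growth (fun n => (m n + k)%nat) (nu / (1 - nu)) ((1 + nu) / (1 - nu) + 1 + INR k) (2 * z)) as [D HD].
      * apply Rlt_div_l; lra.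
      * lra.
      * intros n. rewrite plus_INR. destruct (Hm n) as [_ H2].
        replace ((1 + nu + nu * INR n) / (1 - nu) + 1) with (nu / (1 - nu) * INR n + ((1 + nu) / (1 - nu) + 1)) in H2 by (field; lra).
        lra.
      * exists (M * D). intros n. specialize (HD n).
        replace (M * INR (fact (m n + k)) / INR (fact n) * (2 * z) ^ n) with
          (M * ((2 * z) ^ n * INR (fact (m n + k)) / INR (fact n))) by (unfold Rdiv; ring).
        apply Rmult_le_compat_l; lra.
    + intros n. apply Rdiv_le_0_compat. 2: apply INR_fact_lt_0. apply Rmult_le_pos. lra. apply pos_INR. }
replace (0 - nu * INR 0) with 0 in HS' by (simpl; ring).
rewrite <- (is_series_unique _ _ HS'). rewrite W_PSeries. unfold PSeries. rewrite <- Series_scal_l.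
apply Series_ext. intros n. unfold wcoef. replace (0 - nu * INR n + be) with (INR n * - nu + be) by ring.
unfold Rdiv. ring.
Qed.

(** * Positivity and monotonicity *)

(* Integration by parts: [(1-t)^(be-1)] increases, and [f 1 - f t >= 0]. *)
Lemma extremum_principle (f df : R -> R) be C l : 0 < be <= 1 ->
  (forall t, 0 < t <= 1 -> is_derive f t (df t)) ->
  (forall t, 0 < t <= 1 -> continuous df t) ->
  (forall t, 0 < t <= 1 -> Rabs (df t) <= C) ->
  filterlim f (at_right 0) (locally 0) ->
  (forall t, 0 < t <= 1 -> f t <= f 1) ->
  is_int 1 (fun t => Rpower (1 - t) (be - 1) * df t) l ->
  f 1 <= l.
Proof.
intros Hbe Hd Hc Hb Hl Hmax HI.
assert (H2 : is_int 1 (fun t => Rpower (1 - t) (be - 1) * df t - (1 - be) * ((f 1 - f t) * Rpower (1 - t) (be - 1 - 1)))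
   (0 - -1 * ((f 1 - 0) * Rpower (1 - 0) (be - 1)))).
{ apply (is_int_antideriv 1 (fun t => -1 * ((f 1 - f t) * Rpower (1 - t) (be - 1)))).
  - simpl; lra.
  - intros t [Ht1 Ht2]. simpl in Ht2. eapply is_derive_eq. apply d_scal, d_mult.
    apply d_minus. apply d_const. apply Hd; lra. now apply d_Rpower_one_minus. cbv beta. ring.
  - intros t [Ht1 Ht2]. simpl in Ht2. apply c_minus. apply c_mult. apply (c_Rpower (be - 1) (fun u => 1 - u)). lra. apply c_one_minus.
    apply Hc; lra. apply c_scal, c_mult. apply c_minus. apply c_const. apply (is_derive_continuous f t (df t)), Hd; lra.
    apply (c_Rpower (be - 1 - 1) (fun u => 1 - u)). lra. apply c_one_minus.
  - apply flim_scal; [apply _|]. apply flim_mult; [apply _| |].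
    apply flim_minus; [apply _| |]. apply flim_const, _. auto.
    apply (lim_right_continuous (fun t => Rpower (1 - t) (be - 1))).
    apply (c_Rpower (be - 1) (fun u => 1 - u)). lra. apply c_one_minus.
  (* At [t = 1] the power blows up, but the mean value theorem gives [|f 1 - f t| <= C (1 - t)],
     which leaves [(1 - t)^be]. *)
  - apply flim_squeeze with (fun t => C * Rpower (1 - t) be); [apply _| |].
    + assert (H1 : Rbar_lt (/ 2) 1) by (simpl; lra).
      generalize (left_filter_above 1 (/ 2) H1). apply filter_imp. intros t [Ht1 Ht2]. simpl in Ht2.
      destruct (MVT_gen f t 1 df) as [z [Hz Ez]].
      * intros u Hu. rewrite Rmin_left, Rmax_right in Hu by lra. apply Hd; lra.
      * intros u Hu. rewrite Rmin_left, Rmax_right in Hu by lra.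
        apply continuity_pt_filterlim, (is_derive_continuous f u (df u)), Hd; lra.
      * rewrite Rmin_left, Rmax_right in Hz by lra. rewrite Ez.
        replace (-1 * (df z * (1 - t) * Rpower (1 - t) (be - 1)) - 0) with
          (- (df z * ((1 - t) * Rpower (1 - t) (be - 1)))) by ring.
        rewrite Rpower_mult_self by lra. replace (be - 1 + 1) with be by ring.
        rewrite Rabs_Ropp, Rabs_mult, (Rabs_right (Rpower _ _)) by (left; apply Rpower_pos).
        apply Rmult_le_compat_r. left; apply Rpower_pos. apply Hb; lra.
    + replace 0 with (C * 0) by ring. apply flim_scal; [apply _|]. apply Rpower_one_minus_lim; lra. }
assert (E : 0 - -1 * ((f 1 - 0) * Rpower (1 - 0) (be - 1)) = f 1).
{ rewrite (Rminus_0_r 1), Rpower_1_l. ring. }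
rewrite E in H2.
revert H2 HI. apply is_int_le. simpl; lra. intros t [Ht1 Ht2]. simpl in Ht2.
assert (0 <= (1 - be) * ((f 1 - f t) * Rpower (1 - t) (be - 1 - 1))); [|lra].
apply Rmult_le_pos. lra. apply Rmult_le_pos. specialize (Hmax t). lra. left; apply Rpower_pos.
Qed.

Lemma G_1_eq nu y t : 0 < t -> G nu 1 y t = W nu 1 (y * Rpower t (- nu)).
Proof. intros Ht. unfold G. replace (1 - 1) with 0 by ring. rewrite Rpower_O by auto. ring. Qed.

Lemma is_derive_G_1 nu y t : 0 < nu < / 2 -> 0 < t -> is_derive (G nu 1 y) t (G nu 0 y t).
Proof. intros Hnu Ht. replace 1 with (0 + 1) by ring. now apply is_derive_G_t. Qed.

(** Earlier times are larger similarity variables, so an extremum over the past is an extremum over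
    [[z, infinity)]. *)
Lemma past_ge nu z t : 0 < nu -> 0 < z -> 0 < t <= 1 -> z <= z * Rpower t (- nu).
Proof.
intros Hnu Hz Ht. rewrite <- (Rmult_1_r z) at 1. apply Rmult_le_compat_l. lra.
rewrite <- (Rpower_O t) by lra. apply Rpower_le_le1; lra.
Qed.

Lemma W_max_principle nu z : 0 < nu < / 2 -> 0 < z ->
  (forall w, z <= w -> W nu 1 w <= W nu 1 z) -> W nu 1 z <= Gamma (1 - nu) * W nu (1 - nu) z.
Proof.
intros Hnu Hz Hmax. destruct (G_locally_bounded nu 0 z Hnu Hz) as [C HC].
rewrite <- G_1.
apply (extremum_principle (G nu 1 z) (G nu 0 z) (1 - nu) C); try lra.
- intros t Ht. apply is_derive_G_1; lra.
- intros t Ht. apply c_G_t; lra.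
- intros t Ht. apply HC; lra.
- now apply G_lim_0.
- intros t Ht. rewrite !G_1_eq, Rpower_1_l, Rmult_1_r by lra. apply Hmax, past_ge; lra.
- apply is_int_frac_G; lra.
Qed.

Lemma W_min_principle nu z : 0 < nu < / 2 -> 0 < z ->
  (forall w, z <= w -> W nu 1 z <= W nu 1 w) -> Gamma (1 - nu) * W nu (1 - nu) z <= W nu 1 z.
Proof.
intros Hnu Hz Hmin. destruct (G_locally_bounded nu 0 z Hnu Hz) as [C HC].
rewrite <- (G_1 nu 1).
cut (-1 * G nu 1 z 1 <= -1 * (Gamma (1 - nu) * W nu (1 - nu) z)). lra.
apply (extremum_principle (fun t => -1 * G nu 1 z t) (fun t => -1 * G nu 0 z t) (1 - nu) C); try lra.
- intros t Ht. apply d_scal, is_derive_G_1; lra.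
- intros t Ht. apply c_scal, c_G_t; lra.
- intros t Ht. replace (-1 * G nu 0 z t) with (- G nu 0 z t) by ring. rewrite Rabs_Ropp. apply HC; lra.
- replace 0 with (-1 * 0) at 2 by ring. apply flim_scal; [apply _|]. now apply G_lim_0.
- intros t Ht. rewrite !G_1_eq, Rpower_1_l, Rmult_1_r by lra.
  assert (W nu 1 z <= W nu 1 (z * Rpower t (- nu))) by (apply Hmin, past_ge; lra). lra.
- apply (is_int_ext 1 (fun t => -1 * (Rpower (1 - t) (1 - nu - 1) * G nu 0 z t))). simpl; lra. intros; ring.
  apply is_int_scal, is_int_frac_G; lra.
Qed.

(** Decay at infinity is the small-time limit of [G nu 1 1 t] read through [w = t^(-nu)]; it makes
    extrema over half-lines attained. *)
Lemma W_1_small nu e : 0 < nu < / 2 -> 0 < e -> exists Z, 0 < Z /\ forall w, Z <= w -> Rabs (W nu 1 w) < e.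
Proof.
intros Hnu He. assert (HP : at_right 0 (fun t => Rabs (G nu 1 1 t) < e)).
{ apply (G_lim_0 nu 1 1 Hnu Rlt_0_1 (fun u => Rabs u < e)). exists (mkposreal e He). intros y Hy.
  apply ball_Rabs in Hy. now rewrite Rminus_0_r in Hy. }
destruct HP as [d Hd]. set (t0 := d / 2). assert (Hd0 := cond_pos d).
exists (Rpower t0 (- nu)). split. apply Rpower_pos. intros w Hw.
assert (Hw0 : 0 < w) by (eapply Rlt_le_trans; [apply Rpower_pos|exact Hw]).
set (t := Rpower w (- / nu)). assert (Ht : 0 < t) by apply Rpower_pos.
assert (Htt : t <= t0).
{ unfold t. rewrite Rpower_Ropp. replace t0 with (/ Rpower (Rpower t0 (- nu)) (/ nu)).
  - apply Rinv_le_contravar. apply Rpower_pos. apply Rle_Rpower_l. left; apply Rinv_0_lt_compat; lra. split; auto. apply Rpower_pos.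
  - rewrite Rpower_mult. replace (- nu * / nu) with (- (1)) by (field; lra).
    rewrite Rpower_Ropp, Rinv_inv. apply Rpower_1. unfold t0; lra. }
assert (H : Rabs (G nu 1 1 t) < e).
{ apply Hd; auto. change (Rabs (t - 0) < d). rewrite Rminus_0_r, Rabs_right by lra. unfold t0 in Htt; lra. }
rewrite G_1_eq, Rmult_1_l in H by auto. unfold t in H. rewrite Rpower_mult in H.
replace (- / nu * - nu) with 1 in H by (field; lra). now rewrite Rpower_1 in H.
Qed.

Lemma derive_extremum_0 (f : R -> R) x l a b : a < x < b -> is_derive f x l ->
  (forall u, a < u < b -> f x <= f u) \/ (forall u, a < u < b -> f u <= f x) -> l = 0.
Proof.
intros Hx Hd H. apply is_derive_Reals in Hd.
assert (E : derive_pt f x (exist _ l Hd) = 0).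
{ destruct H as [H|H].
  - apply (deriv_minimum f a b x); try lra. intros u H1 H2. apply H; lra.
  - apply (deriv_maximum f a b x); try lra. intros u H1 H2. apply H; lra. }
exact E.
Qed.

Lemma c_W nu b z : 0 < nu < / 2 -> continuous (W nu b) z.
Proof. intros Hnu. apply (is_derive_continuous (W nu b) z (- W nu (b - nu) z)). now apply is_derive_W. Qed.

Lemma W_1_0 nu : W nu 1 0 = 1.
Proof. rewrite W_0. apply rgamma_1. Qed.

(** A negative value would produce a global minimum at some [m > 0]. There the derivative
    [- W (1 - nu) m] is zero, and the minimum principle yields [W 1 m >= 0]. *)
Lemma W_1_nonneg nu z : 0 < nu < / 2 -> 0 <= z -> 0 <= W nu 1 z.
Proof.
intros Hnu Hz. destruct (Rle_or_lt 0 (W nu 1 z)) as [H|H]; auto. exfalso.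
destruct (W_1_small nu (- W nu 1 z) Hnu ltac:(lra)) as [Z [HZ0 HZ]].
set (Z1 := Z + z + 1).
destruct (continuity_ab_min (W nu 1) 0 Z1) as [m [Hm1 Hm2]].
{ unfold Z1; lra. }
{ intros u _. apply continuity_pt_filterlim. now apply c_W. }
assert (Hmz : W nu 1 m <= W nu 1 z) by (apply Hm1; unfold Z1; lra).
assert (Hg : forall w, 0 <= w -> W nu 1 m <= W nu 1 w).
{ intros w Hw. destruct (Rle_or_lt w Z1). apply Hm1; lra.
  specialize (HZ w ltac:(unfold Z1 in *; lra)). apply Rabs_lt_between in HZ. lra. }
assert (Hm0 : 0 < m).
{ destruct (Rle_lt_or_eq_dec 0 m) as [E|E]; try lra. exfalso. rewrite <- E, W_1_0 in Hmz. lra. }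
assert (E : - W nu (1 - nu) m = 0).
{ apply (derive_extremum_0 (W nu 1) m _ 0 (m + 1)). lra. now apply is_derive_W. left. intros u Hu. apply Hg; lra. }
assert (Hp := W_min_principle nu m Hnu Hm0 ltac:(intros; apply Hg; lra)).
replace (W nu (1 - nu) m) with 0 in Hp by lra. lra.
Qed.

Lemma is_derive_locally_0 (f : R -> R) z l w : (forall u, z <= u -> f u = 0) -> z < w -> is_derive f w l -> l = 0.
Proof.
intros H Hw Hd. apply (derive_extremum_0 f w l z (w + 1)). lra. auto.
left. intros u Hu. rewrite !H; lra.
Qed.

(** Uniform in [z], hence a bound on all derivatives of [W nu 1] over the half-line, as needed to
    expand it around an arbitrary point. *)
Lemma W_Rabs_le nu b z : 0 < nu < / 2 -> b < 1 -> 0 <= z -> Rabs (W nu b z) <= Gamma (1 - b).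
Proof.
intros Hnu Hb Hz. assert (HP : 1 <= PI) by (generalize PI2_1; lra).
assert (HI : / PI <= 1) by (rewrite <- Rinv_1; apply Rinv_le_contravar; lra).
assert (HI0 : 0 < / PI) by (apply Rinv_0_lt_compat; lra).
assert (HG := Gamma_pos (1 - b) ltac:(lra)).
assert (E : W nu b z = / PI * Kint nu b z 1).
{ destruct Hz as [Hz|Hz]. rewrite <- G_1, G_eq_Kint by lra. unfold Rdiv; ring.
  rewrite <- Hz, W_0, Kint_0, Rpower_1_l by lra. field. lra. }
rewrite E, Rabs_mult, Rabs_right by lra.
apply Rle_trans with (/ PI * Gamma (1 - b)); [|nra]. apply Rmult_le_compat_l. lra.
eapply Rle_trans. apply Kint_Rabs_le; lra. eapply Rle_trans. apply (Nint_le nu b z 1 0 1); lra.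
rewrite Nint_0, Rpower_1_l by lra. lra.
Qed.

(* Otherwise the Taylor expansion of [W nu 1] at a large point would vanish identically, contradicting [W nu 1 0 = 1]. *)
Lemma W_1_not_eventually_0 nu z : 0 < nu < / 2 -> 0 < z -> exists w, z <= w /\ W nu 1 w <> 0.
Proof.
intros Hnu Hz. destruct (Classical_Prop.classic (exists w, z <= w /\ W nu 1 w <> 0)) as [H|H]; auto. exfalso.
assert (H0 : forall u, z <= u -> W nu 1 u = 0).
{ intros u Hu. destruct (Req_dec (W nu 1 u) 0); auto. exfalso. apply H. now exists u. }
assert (Hn : forall n u, z + INR n <= u -> W nu (1 - nu * INR n) u = 0).
{ induction n; intros u Hu.
  - simpl in *. rewrite Rmult_0_r, Rminus_0_r. apply H0. lra.
  - rewrite S_INR in Hu. assert (E : - W nu (1 - nu * INR n - nu) u = 0).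
    { apply (is_derive_locally_0 (W nu (1 - nu * INR n)) (z + INR n) _ u IHn). lra. now apply is_derive_W. }
    rewrite S_INR. replace (1 - nu * (INR n + 1)) with (1 - nu * INR n - nu) by ring. lra. }
assert (Hn' : forall n u, z < u -> W nu (1 - nu * INR n) u = 0).
{ induction n; intros u Hu.
  - simpl in *. rewrite Rmult_0_r, Rminus_0_r. apply H0. lra.
  - assert (E : - W nu (1 - nu * INR n - nu) u = 0).
    { apply (is_derive_locally_0 (W nu (1 - nu * INR n)) ((z + u) / 2) _ u). intros v Hv. apply IHn; lra. lra. now apply is_derive_W. }
    rewrite S_INR. replace (1 - nu * (INR n + 1)) with (1 - nu * INR n - nu) by ring. lra. }
clear Hn. destruct (W_bounded nu Hnu) as [M [HM HW]].
set (w := z + 1).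
(* [M] serves [n = 0], where [b = 1]. For [n >= 1] the bound [Gamma x] with [x = nu n >= nu] is at
   most [Gamma (x + 1) / nu]. *)
set (B := fun n => (M + / nu) * INR (fact (n / 2 + 2))).
assert (HB : forall n u, 0 <= u -> Rabs (W nu (1 - nu * INR n) u) <= B n).
{ intros n u Hu. unfold B. assert (Hf : 1 <= INR (fact (n / 2 + 2))) by (apply (le_INR 1), lt_O_fact).
  assert (Hnu' : 0 < / nu) by (apply Rinv_0_lt_compat; lra).
  destruct n.
  - simpl (INR 0). rewrite Rmult_0_r, Rminus_0_r. specialize (HW 1 u ltac:(lra) Hu). nra.
  - assert (Hn1 : 1 <= INR (S n)) by (apply (le_INR 1); lia).
    eapply Rle_trans. apply W_Rabs_le; auto. nra.
    replace (1 - (1 - nu * INR (S n))) with (nu * INR (S n)) by ring. set (x := nu * INR (S n)).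
    assert (Hx : nu <= x) by (unfold x; nra).
    assert (HG : Gamma (x + 1) <= INR (fact (S n / 2 + 2))).
    { replace (S n / 2 + 2)%nat with (S n / 2 + 1 + 1)%nat by lia. apply Gamma_fact_bound. split. lra.
      rewrite plus_INR. simpl (INR 1).
      assert (H1 : INR (S n) <= (INR (S n / 2) + 1) * 2).
      { change 2 with (INR 2). rewrite <- S_INR, <- mult_INR. apply le_INR.
        generalize (Nat.div_mod (S n) 2) (Nat.mod_upper_bound (S n) 2). lia. }
      unfold x. nra. }
    rewrite Gamma_succ in HG by lra. assert (0 < Gamma x) by (apply Gamma_pos; lra).
    apply Rle_trans with (/ nu * INR (fact (S n / 2 + 2))). 2: nra.
    apply Rmult_le_reg_l with nu. lra. rewrite <- Rmult_assoc, Rinv_r, Rmult_1_l by lra. nra. }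
(* The expansion runs backwards from [w] to 0, so the variable is [w - v] and the signs alternate;
   its sum at [v = w] is [W nu 1 0]. *)
assert (HS : is_series (fun n => 0 * (- w) ^ n / INR (fact n)) ((fun n v => (-1) ^ n * W nu (1 - nu * INR n) (w - v)) O w)).
{ apply (taylor_series_of_chain (fun n v => (-1) ^ n * W nu (1 - nu * INR n) (w - v)) (fun _ => 0) B).
  - unfold w; lra.
  - intros n v _. eapply is_derive_eq. apply d_scal, (d_comp (W nu (1 - nu * INR n)) (fun v => w - v)).
    now apply is_derive_W. eapply is_derive_eq. apply d_minus. apply d_const. apply d_id. reflexivity.
    rewrite S_INR. replace (1 - nu * (INR n + 1)) with (1 - nu * INR n - nu) by ring. simpl. ring.
  - intros n. replace (locally 0) with (locally ((-1) ^ n * W nu (1 - nu * INR n) (w - 0))).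
    2:{ rewrite Hn', Rmult_0_r by (unfold w; lra). reflexivity. }
    apply (lim_right_continuous (fun v => (-1) ^ n * W nu (1 - nu * INR n) (w - v))).
    apply c_scal, (continuous_comp (fun v => w - v) (W nu (1 - nu * INR n))). apply c_minus. apply c_const. apply c_id. now apply c_W.
  - intros n v Hv. rewrite Rabs_mult, pow_1_abs, Rmult_1_l. apply HB. lra.
  - apply lim_0_of_bounded_pow. unfold w; lra.
    + destruct (half_fact_growth 2 (2 * w)) as [D HD]. unfold w; lra.
      exists ((M + / nu) / 2 * D). intros n. specialize (HD n). unfold B.
      replace ((M + / nu) * INR (fact (n / 2 + 2)) / INR (fact n) * (2 * w) ^ n) with
        ((M + / nu) / 2 * (2 * INR (fact (n / 2 + 2)) / INR (fact n) * (2 * w) ^ n)) by (field; split; [lra|apply INR_fact_neq_0]).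
      apply Rmult_le_compat_l; auto. assert (0 < / nu) by (apply Rinv_0_lt_compat; lra). lra.
    + intros n. apply Rdiv_le_0_compat. 2: apply INR_fact_lt_0. unfold B.
      assert (0 < / nu) by (apply Rinv_0_lt_compat; lra). apply Rmult_le_pos. lra. apply pos_INR. }
cbv beta in HS. simpl (INR 0) in HS. rewrite Rmult_0_r, !Rminus_0_r, Rminus_diag, W_1_0 in HS.
apply is_series_unique in HS. rewrite (Series_ext _ (fun n => 0 * 1)) in HS. rewrite Series_scal_l in HS. simpl in HS. lra.
intros n. unfold Rdiv; ring.
Qed.

(** For [z > 0], the maximum of [W 1] over [[z, infinity)] is positive and attained at some [m], so
    the maximum principle gives [W (1 - nu) m > 0]. If [m > z], the derivative [- W (1 - nu) m]
    would be zero; hence [m = z]. *)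
Lemma Mainardi_pos nu z : 0 < nu < / 2 -> 0 <= z -> 0 < W nu (1 - nu) z.
Proof.
intros Hnu [Hz|Hz].
2:{ rewrite <- Hz, W_0, rgamma_pos_arg by lra. apply Rinv_0_lt_compat, Gamma_pos; lra. }
destruct (W_1_not_eventually_0 nu z Hnu Hz) as [w0 [Hw0 Hne]].
assert (Hpos : 0 < W nu 1 w0) by (generalize (W_1_nonneg nu w0 Hnu ltac:(lra)); lra).
destruct (W_1_small nu (W nu 1 w0) Hnu Hpos) as [Z [HZ0 HZ]].
set (Z1 := Z + w0).
destruct (continuity_ab_maj (W nu 1) z Z1) as [m [Hm1 Hm2]].
{ unfold Z1; lra. }
{ intros u _. apply continuity_pt_filterlim. now apply c_W. }
assert (Hmz : W nu 1 w0 <= W nu 1 m) by (apply Hm1; unfold Z1; lra).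
assert (Hg : forall w, z <= w -> W nu 1 w <= W nu 1 m).
{ intros w Hw. destruct (Rle_or_lt w Z1). apply Hm1; lra.
  specialize (HZ w ltac:(unfold Z1 in *; lra)). apply Rabs_lt_between in HZ. lra. }
assert (Hp := W_max_principle nu m Hnu ltac:(lra) ltac:(intros; apply Hg; lra)).
assert (HG : 0 < Gamma (1 - nu)) by (apply Gamma_pos; lra).
assert (HMm : 0 < W nu (1 - nu) m) by nra.
destruct (Rle_lt_or_eq_dec z m) as [E|E]; try lra. 2: now rewrite E.
exfalso. assert (E0 : - W nu (1 - nu) m = 0).
{ apply (derive_extremum_0 (W nu 1) m _ z (m + 1)). lra. now apply is_derive_W. right. intros u Hu. apply Hg; lra. }
lra.
Qed.

(** At [b = 0] the recurrence reads [W 0 z = nu z W (1 - nu) z], so the integrand of the fractional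
    integral of order [1 - 2 nu] is positive. *)
Lemma W_1_sub_2nu_nonneg nu z : 0 < nu < / 2 -> 0 < z -> 0 <= W nu (1 - nu - nu) z.
Proof.
intros Hnu Hz. assert (HG : 0 < Gamma (1 - nu - nu)) by (apply Gamma_pos; lra).
assert (0 <= Gamma (1 - nu - nu) * W nu (1 - nu - nu) z); [|nra].
apply (is_int_nonneg 1 (fun t => Rpower (1 - t) (1 - nu - nu - 1) * G nu 0 z t)). simpl; lra.
- intros t [Ht _]. apply Rmult_le_pos. left; apply Rpower_pos. unfold G.
  apply Rmult_le_pos. left; apply Rpower_pos.
  assert (Hu : 0 < z * Rpower t (- nu)) by (apply Rmult_lt_0_compat; auto; apply Rpower_pos).
  rewrite <- (W_rec nu 0) by auto. replace (0 + 1 - nu) with (1 - nu) by ring.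
  assert (0 < W nu (1 - nu) (z * Rpower t (- nu))) by (apply Mainardi_pos; lra).
  assert (0 < nu * (z * Rpower t (- nu)) * W nu (1 - nu) (z * Rpower t (- nu))) by (apply Rmult_lt_0_compat; auto; apply Rmult_lt_0_compat; lra). lra.
- apply is_int_frac_G; lra.
Qed.

Lemma Mainardi_decr nu x y : 0 < nu < / 2 -> 0 <= x <= y -> W nu (1 - nu) y <= W nu (1 - nu) x.
Proof.
intros Hnu Hxy. destruct (Req_dec x y) as [->|Hne]; [lra|].
destruct (MVT_gen (W nu (1 - nu)) x y (fun z => - W nu (1 - nu - nu) z)) as [z [Hz Ez]].
- intros u _. now apply is_derive_W.
- intros u _. apply continuity_pt_filterlim. now apply c_W.
- rewrite Rmin_left, Rmax_right in Hz by lra.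
  assert (0 <= W nu (1 - nu - nu) z).
  { destruct (Rle_lt_or_eq_dec 0 z) as [H|H]; try lra. now apply W_1_sub_2nu_nonneg.
    rewrite <- H, W_0, rgamma_pos_arg by lra. left; apply Rinv_0_lt_compat, Gamma_pos; lra. }
  nra.
Qed.

Lemma one_minus_W_incr nu x y : 0 < nu < / 2 -> 0 <= x < y -> 1 - W nu 1 x < 1 - W nu 1 y.
Proof.
intros Hnu Hxy.
destruct (MVT_gen (W nu 1) x y (fun z => - W nu (1 - nu) z)) as [z [Hz Ez]].
- intros u _. now apply is_derive_W.
- intros u _. apply continuity_pt_filterlim. now apply c_W.
- rewrite Rmin_left, Rmax_right in Hz by lra.
  assert (0 < W nu (1 - nu) z) by (apply Mainardi_pos; lra). nra.
Qed.

Lemma one_minus_W_pos nu x : 0 < nu < / 2 -> 0 < x -> 0 < 1 - W nu 1 x.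
Proof.
intros Hnu Hx. generalize (one_minus_W_incr nu 0 x Hnu ltac:(lra)). rewrite W_1_0. lra.
Qed.

(** * The Stefan problem *)

Lemma caputo_of_is_int alpha f df t I :
  0 < t -> (forall tau, 0 < tau < t -> is_derive f tau (df tau)) ->
  is_int t (fun tau => df tau * Rpower (t - tau) (- alpha)) I ->
  caputo alpha f t (I / Gamma (1 - alpha)).
Proof.
intros Ht Hd HI. split.
- intros tau Htau. exists (df tau). now apply Hd.
- exists I. split; auto. revert HI. apply (is_int_ext t). exact Ht.
  intros x [Hx1 Hx2]. simpl in Hx2. f_equal. symmetry. apply is_derive_unique, Hd. lra.
Qed.

Lemma is_int_rescale t f l : 0 < t -> is_int 1 f l -> is_int t (fun tau => / t * f (/ t * tau)) l.
Proof.
intros Ht H. apply (is_int_comp_scal 1 t) in H; auto. 2: simpl; lra.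
simpl in H. now rewrite Rmult_1_r in H.
Qed.

Lemma Rpower_sub_scale t tau a : 0 < t -> 0 < tau < t ->
  Rpower (t - tau) a = Rpower t a * Rpower (1 - / t * tau) a.
Proof.
intros Ht Htau. assert (0 < 1 - / t * tau).
{ apply Rmult_lt_reg_l with t; auto. replace (t * (1 - / t * tau)) with (t - tau) by (field; lra). lra. }
rewrite Rpower_mult_distr by auto. f_equal. field. lra.
Qed.

Lemma Rpower_scale t tau a : 0 < t -> 0 < tau -> Rpower tau a = Rpower t a * Rpower (/ t * tau) a.
Proof.
intros Ht Htau. assert (0 < / t) by now apply Rinv_0_lt_compat.
rewrite Rpower_mult_distr by (auto; now apply Rmult_lt_0_compat). f_equal. field. lra.
Qed.

Lemma powr_pos t a : 0 < t -> powr t a = Rpower t a.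
Proof. intros Ht. unfold powr. destruct (Rlt_dec 0 t); easy. Qed.

Lemma locally_pos t : 0 < t -> locally t (fun u => 0 < u).
Proof. intros Ht. now apply (open_gt 0). Qed.

Lemma caputo_powr nu C t : 0 < nu < / 2 -> 0 < t ->
  caputo (nu + nu) (fun tau => C * powr tau nu) t (C * Gamma (1 + nu) / Gamma (1 - nu) * Rpower t (- nu)).
Proof.
intros Hnu Ht.
replace (C * Gamma (1 + nu) / Gamma (1 - nu) * Rpower t (- nu)) with
  (C * nu * Rpower t (- nu) * Beta nu (1 - nu - nu) / Gamma (1 - (nu + nu))).
- apply (caputo_of_is_int _ _ (fun tau => C * (nu * Rpower tau (nu - 1)))); auto.
  + intros tau Htau. apply d_scal.
    apply (is_derive_ext_loc (fun u => Rpower u nu)).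
    { generalize (locally_pos tau (proj1 Htau)). apply filter_imp. intros u Hu. now rewrite powr_pos. }
    now apply is_derive_Rpower.
  + assert (H := is_int_rescale t _ _ Ht (is_int_Beta nu (1 - nu - nu) ltac:(lra) ltac:(lra))).
    apply (is_int_scal _ _ (C * nu * Rpower t (- nu))) in H. revert H.
    apply is_int_ext. exact Ht. intros tau [H1 H2]. simpl in H2.
    rewrite (Rpower_sub_scale t tau), (Rpower_scale t tau (nu - 1)) by lra.
    replace (1 - nu - nu - 1) with (- (nu + nu)) by ring.
    replace (Rpower t (- nu)) with (t * (Rpower t (nu - 1) * Rpower t (- (nu + nu)))).
    2:{ rewrite <- Rpower_plus, Rpower_mult_self by auto. f_equal. ring. }
    field. lra.
- assert (E := Beta_Gamma nu (1 - nu - nu) ltac:(lra) ltac:(lra)).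
  replace (nu + (1 - nu - nu)) with (1 - nu) in E by ring.
  rewrite (Rplus_comm 1 nu), Gamma_succ by lra. replace (1 - (nu + nu)) with (1 - nu - nu) by ring.
  assert (0 < Gamma (1 - nu)) by (apply Gamma_pos; lra). assert (0 < Gamma (1 - nu - nu)) by (apply Gamma_pos; lra).
  replace (Beta nu (1 - nu - nu)) with (Gamma nu * Gamma (1 - nu - nu) / Gamma (1 - nu)).
  field. lra. rewrite <- E. field. lra.
Qed.

Lemma G_scale nu b y t u : 0 < t -> 0 < u -> G nu b y u = Rpower t (b - 1) * G nu b (y * Rpower t (- nu)) (/ t * u).
Proof.
intros Ht Hu. unfold G. rewrite (Rpower_scale t u (b - 1)), (Rpower_scale t u (- nu)) by auto.
rewrite !Rmult_assoc. reflexivity.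
Qed.

(** Self-similarity: rescaling [(0, t)] to the unit interval turns this into [is_int_frac_G] with
    [be = 1 - 2 nu] at [z = y t^(-nu)]. *)
Lemma caputo_W nu (f : R -> R) C0 C y t : 0 < nu < / 2 -> 0 < y -> 0 < t ->
  (forall tau, 0 < tau -> f tau = C0 + C * W nu 1 (y * Rpower tau (- nu))) ->
  caputo (nu + nu) f t (C * Rpower t (- (nu + nu)) * W nu (1 - nu - nu) (y * Rpower t (- nu))).
Proof.
intros Hnu Hy Ht Hf. set (z := y * Rpower t (- nu)).
assert (HG : 0 < Gamma (1 - nu - nu)) by (apply Gamma_pos; lra).
replace (C * Rpower t (- (nu + nu)) * W nu (1 - nu - nu) z) with
 (C * Rpower t (- (nu + nu)) * (Gamma (1 - nu - nu) * W nu (1 - nu - nu) z) / Gamma (1 - (nu + nu))).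
2:{ replace (1 - (nu + nu)) with (1 - nu - nu) by ring. field. lra. }
apply (caputo_of_is_int _ _ (fun tau => C * G nu 0 y tau)); auto.
- intros tau Htau. apply (is_derive_ext_loc (fun u => C0 + C * G nu 1 y u)).
  { generalize (locally_pos tau (proj1 Htau)). apply filter_imp. intros u Hu. now rewrite Hf, G_1_eq. }
  eapply is_derive_eq. apply d_plus. apply d_const. apply d_scal, is_derive_G_1; lra. ring.
- assert (Hz : 0 < z) by (apply Rmult_lt_0_compat; auto; apply Rpower_pos).
  assert (H := is_int_rescale t _ _ Ht (is_int_frac_G nu (1 - nu - nu) z Hnu ltac:(lra) Hz)).
  apply (is_int_scal _ _ (C * Rpower t (- (nu + nu)))) in H. revert H.
  apply is_int_ext. exact Ht. intros tau [H1 H2]. simpl in H2.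
  rewrite (Rpower_sub_scale t tau), (G_scale nu 0 y t tau) by lra. fold z.
  replace (1 - nu - nu - 1) with (- (nu + nu)) by ring.
  replace (0 - 1) with (- (1)) by ring. rewrite (Rpower_Ropp t 1), Rpower_1 by auto. ring.
Qed.

Lemma is_derive_difference_quotient (f : R -> R) (x d : R) (F : (R -> Prop) -> Prop) :
  is_derive f x d -> filter_le F (locally' x) ->
  filterlim (fun y => (f y - f x) / (y - x)) F (locally d).
Proof.
intros Hd HF P [e He]. apply HF. apply is_derive_Reals in Hd. destruct (Hd e (cond_pos e)) as [del Hdel].
exists del. intros y Hy Hne. apply He. apply ball_Rabs in Hy.
assert (Hyx : y - x <> 0) by lra.
specialize (Hdel (y - x) Hyx Hy). replace (x + (y - x)) with (y : R) in Hdel by (simpl in *; ring). exact Hdel.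
Qed.

Lemma at_left_le_locally' x : filter_le (at_left x) (locally' x).
Proof. intros P [d Hd]. exists d. intros y Hy Hlt. apply Hd; auto. lra. Qed.

Lemma at_right_le_locally' x : filter_le (at_right x) (locally' x).
Proof. intros P [d Hd]. exists d. intros y Hy Hlt. apply Hd; auto. lra. Qed.

Lemma transcendental_equation nu rhs : 0 < nu < / 2 -> 0 < rhs ->
  exists xi, 0 < xi /\ xi * (1 - W nu 1 xi) / W nu (1 - nu) xi = rhs /\
    (forall y, 0 < y -> y * (1 - W nu 1 y) / W nu (1 - nu) y = rhs -> y = xi).
Proof.
(* Clearing the positive denominator leaves an increasing term minus a decreasing one. *)
intros Hnu Hr. set (phi := fun x => x * (1 - W nu 1 x) - rhs * W nu (1 - nu) x).
assert (Heq : forall x, 0 <= x -> (x * (1 - W nu 1 x) / W nu (1 - nu) x = rhs <-> phi x = 0)).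
{ intros x Hx. assert (HM := Mainardi_pos nu x Hnu Hx). unfold phi. split; intros H.
  - rewrite <- H. field. lra.
  - replace (x * (1 - W nu 1 x)) with (rhs * W nu (1 - nu) x) by lra. field. lra. }
assert (Hinc : forall x y, 0 <= x < y -> phi x < phi y).
{ intros x y Hxy. unfold phi. assert (H1 := one_minus_W_incr nu x y Hnu Hxy).
  assert (H2 := Mainardi_decr nu x y Hnu ltac:(lra)).
  assert (H3 : 0 < 1 - W nu 1 y) by (apply one_minus_W_pos; lra). nra. }
assert (H1 := one_minus_W_pos nu 1 Hnu Rlt_0_1).
assert (M0 := Mainardi_pos nu 0 Hnu (Rle_refl 0)).
(* Chosen so that [X (1 - W 1 1)] exceeds [rhs W (1 - nu) 0]; by monotonicity [phi X > 0]. *)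
set (X := 1 + rhs * W nu (1 - nu) 0 / (1 - W nu 1 1)).
assert (HX : 1 < X).
{ unfold X. assert (0 < rhs * W nu (1 - nu) 0 / (1 - W nu 1 1)); [|lra]. apply Rdiv_lt_0_compat; auto. now apply Rmult_lt_0_compat. }
assert (HX0 : 0 < phi X).
{ unfold phi. assert (H2 := one_minus_W_incr nu 1 X Hnu ltac:(lra)). assert (H3 := Mainardi_decr nu 0 X Hnu ltac:(lra)).
  assert (H4 : X * (1 - W nu 1 1) = (1 - W nu 1 1) + rhs * W nu (1 - nu) 0) by (unfold X; field; lra). nra. }
assert (H00 : phi 0 < 0). { unfold phi. nra. }
destruct (IVT phi 0 X) as [xi [Hxi Exi]]; try lra.
{ intros u. apply continuity_pt_filterlim. unfold phi.
  apply (c_minus (fun x => x * (1 - W nu 1 x)) (fun x => rhs * W nu (1 - nu) x)).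
  - apply (c_mult (fun x => x) (fun x => 1 - W nu 1 x)). apply c_id. apply c_minus. apply c_const. now apply c_W.
  - now apply c_scal, c_W. }
assert (Hxi0 : 0 < xi). { destruct (Rle_lt_or_eq_dec 0 xi); try lra. subst. lra. }
exists xi. split; auto. split. apply Heq; auto; lra.
intros y Hy Ey. apply Heq in Ey; [|lra].
destruct (Rtotal_order y xi) as [L|[L|L]]; auto.
- specialize (Hinc y xi ltac:(lra)). lra.
- specialize (Hinc xi y ltac:(lra)). lra.
Qed.

Lemma is_derive_W_scaled nu b q x : 0 < nu < / 2 ->
  is_derive (fun y => W nu b (y / q)) x (- / q * W nu (b - nu) (x / q)).
Proof.
intros Hnu. eapply is_derive_eq. apply (d_comp (W nu b) (fun y => y / q)). now apply is_derive_W.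
instantiate (1 := / q). apply (is_derive_ext (fun y => / q * y)). intros; unfold Rdiv; apply Rmult_comm.
eapply is_derive_eq. apply d_scal, d_id. ring. ring.
Qed.

Theorem theorem6 (alpha rho c l Tm T0 q0 : R) :
  0 < alpha < 1 -> 0 < rho -> 0 < c -> 0 < l -> Tm < T0 -> 0 < q0 ->
  let F := fun x => x * (1 - Wright (- x) (- (alpha / 2)) 1) / Mainardi (alpha / 2) x in
  let rhs := c * (T0 - Tm) * Gamma (1 - alpha / 2) / (l * Gamma (1 + alpha / 2)) in
  (exists xi, 0 < xi /\ F xi = rhs /\ (forall y, 0 < y -> F y = rhs -> y = xi)) /\
  (forall xi, 0 < xi -> F xi = rhs ->
     let Wxi := 1 - Wright (- xi) (- (alpha / 2)) 1 in
     let k := q0 ^ 2 * Gamma (1 - alpha / 2) ^ 2 / (rho * c * (T0 - Tm) ^ 2) * Wxi ^ 2 in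
     let lam := q0 * Gamma (1 - alpha / 2) / (rho * c * (T0 - Tm)) * Wxi in
     let T := fun x t => T0 - (T0 - Tm) / Wxi *
                (1 - Wright (- (x / (lam * powr t (alpha / 2)))) (- (alpha / 2)) 1) in
     let s := fun t => lam * xi * powr t (alpha / 2) in
     stefan_solution alpha rho c l Tm T0 q0 k T s).
Proof.
intros Ha Hrho Hc Hl HT Hq F rhs.
set (nu := alpha / 2) in *.
assert (Hnu : 0 < nu < / 2) by (unfold nu; lra).
assert (Ea : alpha = nu + nu) by (unfold nu; field).
assert (HG1 : 0 < Gamma (1 - nu)) by (apply Gamma_pos; lra).
assert (HG2 : 0 < Gamma (1 + nu)) by (apply Gamma_pos; lra).
assert (Hr : 0 < rhs) by (unfold rhs; apply Rdiv_lt_0_compat; repeat apply Rmult_lt_0_compat; lra).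
split; [exact (transcendental_equation nu rhs Hnu Hr)|].
intros xi Hxi Exi Wxi k lam T s.
assert (HW : 0 < Wxi) by exact (one_minus_W_pos nu xi Hnu Hxi).
assert (HM : 0 < W nu (1 - nu) xi) by (apply Mainardi_pos; lra).
change (xi * Wxi / W nu (1 - nu) xi = rhs) in Exi.
assert (Hlam : 0 < lam).
{ unfold lam. apply Rmult_lt_0_compat; auto. apply Rdiv_lt_0_compat; repeat apply Rmult_lt_0_compat; lra. }
set (B := (T0 - Tm) / Wxi) in *.
assert (HB : 0 < B) by (apply Rdiv_lt_0_compat; lra).
(* [lam] is the square root of the diffusivity; the next identity is the flux condition at [x = 0]
   with the powers of [t] removed. *)
assert (Ek : k = rho * c * lam ^ 2) by (unfold k, lam; field; lra).
assert (Elam : rho * c * lam * B = q0 * Gamma (1 - nu)) by (unfold lam, B; field; lra).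
assert (Hq0 : forall t, 0 < lam * Rpower t nu) by (intros t; apply Rmult_lt_0_compat; auto; apply Rpower_pos).
assert (ET : forall x t, 0 < t -> T x t = T0 - B + B * W nu 1 (x / (lam * Rpower t nu))).
{ intros x t Ht. unfold T. rewrite powr_pos by auto.
  change (Wright (- (x / (lam * Rpower t nu))) (- nu) 1) with (W nu 1 (x / (lam * Rpower t nu))). ring. }
assert (Dx : forall x t, 0 < t -> is_derive (fun y => T y t) x (- B / (lam * Rpower t nu) * W nu (1 - nu) (x / (lam * Rpower t nu)))).
{ intros x t Ht. apply (is_derive_ext (fun y => T0 - B + B * W nu 1 (y / (lam * Rpower t nu)))). intros; symmetry; now apply ET.
  eapply is_derive_eq. apply d_plus. apply d_const. apply d_scal. now apply is_derive_W_scaled. unfold Rdiv; ring. }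
assert (Es : forall t, 0 < t -> s t / (lam * Rpower t nu) = xi).
{ intros t Ht. unfold s. rewrite powr_pos by auto. field. split; [apply Rgt_not_eq, Rpower_pos|lra]. }
unfold stefan_solution. change (alpha / 2) with nu. repeat split.
- intros x t Ht [Hx _].
  exists (B * Rpower t (- (nu + nu)) * W nu (1 - nu - nu) (x / lam * Rpower t (- nu))).
  exists (B / (lam * Rpower t nu) ^ 2 * W nu (1 - nu - nu) (x / (lam * Rpower t nu))).
  assert (Ez : forall u, x / (lam * Rpower u nu) = x / lam * Rpower u (- nu)).
  { intros u. rewrite Rpower_Ropp. field. split; [apply Rgt_not_eq, Rpower_pos|lra]. }
  split; [|split; [split|]].
  + rewrite Ea. apply (caputo_W nu _ (T0 - B)); auto. now apply Rdiv_lt_0_compat.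
    intros tau Htau. now rewrite ET, Ez.
  + apply filter_forall. intros y. eexists. now apply Dx.
  + apply (is_derive_ext (fun x => - B / (lam * Rpower t nu) * W nu (1 - nu) (x / (lam * Rpower t nu)))).
    { intros y. symmetry. apply is_derive_unique. now apply Dx. }
    eapply is_derive_eq. apply d_scal. now apply is_derive_W_scaled.
    field. split; [apply Rgt_not_eq, Rpower_pos|lra].
  + rewrite Ek, Ez. rewrite (Rpower_Ropp t (nu + nu)), Rpower_plus. field.
    repeat split; try lra. apply Rgt_not_eq, Rpower_pos.
- unfold s, powr. destruct (Rlt_dec 0 0); lra.
- intros t Ht. rewrite ET, Es by auto.
  replace (W nu 1 xi) with (1 - Wxi) by (unfold Wxi, W; ring). unfold B. field. lra.
- intros t Ht.
  exists (- B / (lam * Rpower t nu) * W nu (1 - nu) xi), (lam * xi * Gamma (1 + nu) / Gamma (1 - nu) * Rpower t (- nu)).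
  split; [|split].
  + apply (is_derive_difference_quotient (fun y => T y t) (s t) _ (at_left (s t))). 2: apply at_left_le_locally'.
    rewrite <- (Es t Ht) at 1. now apply Dx.
  + rewrite Ea. now apply caputo_powr.
  + rewrite Ek, Rpower_Ropp. assert (Hp := Rpower_pos t nu).
    (* The Stefan condition is the equation for [xi]. Only the factor [xi] of the front speed is to
       be replaced, so the first occurrence, the argument of [W], is restored. *)
    assert (E : xi = rhs * W nu (1 - nu) xi / Wxi) by (rewrite <- Exi; field; lra).
    rewrite E. rewrite <- E at 1. unfold rhs, B. field. repeat split; lra.
- intros t Ht. rewrite ET by auto. unfold Rdiv. rewrite Rmult_0_l, W_1_0. ring.
- intros t Ht. exists (- B / (lam * Rpower t nu) * W nu (1 - nu) 0). split.
  + apply (is_derive_difference_quotient (fun y => T y t) 0 _ (at_right 0)). 2: apply at_right_le_locally'.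
    replace 0 with (0 / (lam * Rpower t nu)) at 2 by (unfold Rdiv; ring). now apply Dx.
  + rewrite powr_pos, W_0, rgamma_pos_arg, Ek by lra. assert (Hp := Rpower_pos t nu).
    transitivity (- (rho * c * lam * B) / (Gamma (1 - nu) * Rpower t nu)). field. lra.
    rewrite Elam. field. lra.
Qed.
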